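(* Let $E^0,F^0\subset\mathbb{R}^N$ be two closed sets with compact boundary, let $E$ be a weak superflow (of the Minkowski curvature flow) with initial datum $E^0$, and let $F$ be a weak subflow with initial datum $F^0$. If $\operatorname{dist}(E^0,\mathbb{R}^N\setminus F^0)=:\Delta>0$, then $$\operatorname{dist}(E(t),\mathbb{R}^N\setminus F(t))\ge\Delta\qquad\text{for all }t\ge0,$$ with the convention that $\operatorname{dist}(G,\emptyset)=+\infty$ for any $G$.
   Context: Fix $N\in\mathbb N$ and $r>0$. $B_r(w)$ is the open ball of centre $w$ and radius $r$, $B_r=B_r(0)$, $C_r=\overline{B_r}\times\overline{B_r}$. $\operatorname{osc}_A v=\operatorname{ess\,sup}_A v-\operatorname{ess\,inf}_A v$. $\mathcal M^+(C_r)$ denotes the nonnegative Radon measures on $C_r$. $L^\infty_{\mathbf w}(\mathbb{R}^N\times(0,T);\mathcal M^+(C_r))$ is the set of maps $z$, $(w,t)\mapsto z_{(w,t)}\in\mathcal M^+(C_r)$, such that $(w,t)\mapsto\int_{C_r}f\,dz_{(w,t)}$ is measurable for every $f\in C^0(C_r)$ and $(w,t)\mapsto z_{(w,t)}(C_r)$ is in $L^\infty$. For such $z$, the nonlocal divergence $\mathfrak{Div}^r z$ is the measure on $\mathbb{R}^N\times(0,T)$ with $\int\varphi\,d(\mathfrak{Div}^r z)=-\frac1{2r}\int_0^T\int_{\mathbb{R}^N}\int_{C_r}(\varphi(w+x,t)-\varphi(w+y,t))\,dz_{(w,t)}(x,y)\,dw\,dt$ for $\varphi\in C^0_c(\mathbb{R}^N\times(0,T))$.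 Kuratowski convergence $D_n\xrightarrow{\mathscr K}D$ of closed sets: every cluster point of a sequence $x_n\in D_n$ lies in $D$, and every $x\in D$ is a limit of some $x_n\in D_n$. $(F)_\delta=\bigcup_{x\in F}B_\delta(x)$, with $(\emptyset)_\delta=\emptyset$. For $E\subset\mathbb{R}^N\times[0,\infty)$, $E(t)=\{x:(x,t)\in E\}$. Weak superflow: for $E^0$ closed with compact boundary, a closed set $E\subset\mathbb{R}^N\times[0,\infty)$ is a weak superflow with initial datum $E^0$ if: (a) $E(0)\subseteq E^0$ and either $E(t)$ is bounded for all $t\ge0$ or $\mathbb{R}^N\setminus E(t)$ is bounded for all $t\ge0$; (b) for every $t\ge0$, $\delta>0$ there is $\tau>0$ with $E(s)\subset(E(t))_\delta$ for all $s\in(t,t+\tau)$; (c) $E(s)\xrightarrow{\mathscr K}E(t)$ as $s\nearrow t$, for all $t>0$; (d) with $T^{\rm ext}=\inf\{t>0:E(s)=\emptyset\text{ for }s\ge t\}$ and $d(x,t)=\operatorname{dist}(x,E(t))$ on $\mathbb{R}^N\times(0,T^{\rm ext})$, there is $z\in L^\infty_{\mathbf w}(\mathbb{R}^N\times(0,T^{\rm ext});\mathcal M^+(C_r))$ such that (d1) $\partial_t d\ge\mathfrak{Div}^r z$ as measures in $(\mathbb{R}^N\times(0,T^{\rm ext}))\setminus E$; (d2) for a.e. $(w,t)$, $z_{(w,t)}(C_r)\le1$ and $\int_{C_r}(d(w+x,t)-d(w+y,t))\,dz_{(w,t)}(x,y)=\operatorname{osc}_{B_r(w)}d(\cdot,t)$;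 (d3) for every $\lambda>0$, $(\mathfrak{Div}^r z)^+\in L^\infty(\{(w,t)\in\mathbb{R}^N\times(0,T^{\rm ext}):d(w,t)\ge\lambda\})$. Weak subflow: a relatively open set $A\subset\mathbb{R}^N\times[0,\infty)$ is a weak subflow with initial datum $E^0$ if $(\mathbb{R}^N\times[0,\infty))\setminus A$ is a weak superflow with initial datum $\mathbb{R}^N\setminus\mathrm{Int}_{\mathbb{R}^N}(E^0)$. *)

(* Defs.v *)
From HB Require Import structures.
From mathcomp Require Import all_boot all_order all_algebra.
From mathcomp Require Import all_classical all_reals all_analysis.
From mathcomp Require Import measurable_realfun ess_sup_inf.

Set Implicit Arguments.
Unset Strict Implicit.
Unset Printing Implicit Defensive.

Import Order.TTheory GRing.Theory Num.Theory.
Import numFieldNormedType.Exports.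

Local Open Scope classical_set_scope.
Local Open Scope ring_scope.

(* R^N is 'rV[R]_N.  The library norm on 'rV[R]_N is the sup norm; it induces
   the Euclidean topology, so open, closed, compact, bounded_set and continuous
   are the library's, but distances and balls must use the Euclidean norm. *)

Definition enorm (R : realType) (N : nat) (x : 'rV[R]_N) : R :=
  Num.sqrt (\sum_(i < N) x ord0 i ^+ 2).

Definition eball (R : realType) (N : nat) (w : 'rV[R]_N) (r : R) :
  set 'rV[R]_N := [set x | enorm (x - w) < r].

(* Since ereal_inf set0 = +oo, distances to or from the empty set are +oo. *)
Definition dist_pt (R : realType) (N : nat) (x : 'rV[R]_N) (A : set 'rV[R]_N) :
  \bar R := ereal_inf [set (enorm (x - y))%:E | y in A].

Definition dist_set (R : realType) (N : nat) (A B : set 'rV[R]_N) : \bar R :=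
  ereal_inf [set (enorm (p.1 - p.2))%:E | p in A `*` B].

Definition boundary (T : topologicalType) (A : set T) : set T :=
  closure A `\` A°.

(* The sigma-algebra generated by the coordinates; it is the Borel
   sigma-algebra of 'rV[R]_n (see rV_open_measurable for the inclusion that is
   not obvious). *)

Definition rV_coord (R : realType) (n : nat) (i : 'I_n) (x : 'rV[R]_n) : R :=
  x ord0 i.

Definition rV_display : measure_display. Proof. exact: default_measure_display. Qed.

Definition rV_measurable (R : realType) (n : nat) : set (set 'rV[R]_n) :=
  g_sigma_preimage (@rV_coord R n).

Lemma rV_measurable0 (R : realType) (n : nat) : @rV_measurable R n set0.
Proof. exact: sigma_algebra0. Qed.

Lemma rV_measurableC (R : realType) (n : nat) (A : set 'rV[R]_n) :
  rV_measurable A -> rV_measurable (~` A).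
Proof. exact: sigma_algebraC. Qed.

Lemma rV_measurable_bigcup (R : realType) (n : nat) (F : (set 'rV[R]_n)^nat) :
  (forall i, rV_measurable (F i)) -> rV_measurable (\bigcup_i F i).
Proof. exact: sigma_algebra_bigcup. Qed.

HB.instance Definition _ (R : realType) (n : nat) :=
  @isMeasurable.Build rV_display 'rV[R]_n (@rV_measurable R n)
    (@rV_measurable0 R n) (@rV_measurableC R n) (@rV_measurable_bigcup R n).

Lemma measurable_rV_coord (R : realType) (n : nat) (i : 'I_n) :
  measurable_fun [set: 'rV[R]_n] (@rV_coord R n i).
Proof.
move=> _ Y mY; rewrite setTI; apply: sub_sigma_algebra => /=.
rewrite -bigcup_seq/=; exists i => /=; first by rewrite mem_index_enum.
by exists Y => //; rewrite setTI.
Qed.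

Lemma measurable_fun_rVP d (T : measurableType d) (R : realType) (n : nat)
    (f : T -> 'rV[R]_n) :
  (forall i, measurable_fun [set: T] (fun t => f t ord0 i)) ->
  measurable_fun [set: T] f.
Proof.
move=> mf.
have H : preimage_set_system [set: T] f (@rV_measurable R n) `<=` measurable.
  rewrite /rV_measurable -g_sigma_preimage_comp.
  apply: smallest_sub; first exact: sigma_algebra_measurable.
  rewrite -bigcup_seq => A [/= i _ [B mB <-]].
  exact: (mf i measurableT B mB).
by move=> _ A mA; apply: H; exists A.
Qed.

Lemma rV_open_measurable (R : realType) (n : nat) (U : set 'rV[R]_n) :
  open U -> measurable U.
Proof.
move=> oU.
pose box (c : {ffun 'I_n -> rat} * nat) : set 'rV[R]_n :=
  [set x | forall i, `|x ord0 i - ratr (c.1 i)| < c.2.+1%:R^-1].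
have mbox c : measurable (box c).
  have -> : box c = \big[setI/setT]_(i < n)
      ((@rV_coord R n i) @^-1` ball (ratr (c.1 i) : R) c.2.+1%:R^-1).
    rewrite -bigcap_seq; apply/seteqP; split => x /=.
      by move=> bx i _; rewrite /rV_coord/ball/= distrC; exact: bx.
    move=> bx i; have := bx i; rewrite /rV_coord/ball/= distrC; apply.
    by rewrite mem_index_enum.
  apply: bigsetI_measurable => i _; rewrite -[X in measurable X]setTI.
  by apply: measurable_rV_coord => //; apply: measurable_ball.
pose P c := if pselect (box c `<=` U) then box c else set0.
have mP c : measurable (P c).
  by rewrite /P; case: pselect => ?; [exact: mbox | exact: measurable0].
have -> : U = \bigcup_c P c.
  apply/seteqP; split => [x Ux|x [c _]]; last first.
    by rewrite /P; case: pselect => //; apply.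
  have /nbhs_ballP[e /= e0 be] : nbhs x U by apply: open_nbhs_nbhs.
  have [k ke] : exists k, (k.+1%:R^-1 : R) < e / 2.
    have /ltr_add_invr[k] : (0 : R) < e / 2 by rewrite divr_gt0.
    by rewrite add0r; exists k.
  have /fin_all_exists[q qP] (i : 'I_n) :
      exists q : rat, `|x ord0 i - ratr q| < k.+1%:R^-1.
    have : x ord0 i - k.+1%:R^-1 < x ord0 i + k.+1%:R^-1.
      by rewrite ltrD2l gtrN// invr_gt0.
    move=> /rat_in_itvoo[q]; rewrite in_itv/= => /andP[q1 q2].
    by exists q; rewrite ltr_distlC q1 q2.
  have bU : box ([ffun i => q i], k) `<=` U.
    move=> y yb; apply: be; split=> // i j; rewrite (ord1 i).
    have := yb j; rewrite /= ffunE => yq.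
    rewrite /ball/= (splitr e) (le_lt_trans (ler_distD (ratr (q j)) _ _))//.
    by rewrite ltrD// ?(lt_trans (qP j) ke)// distrC (lt_trans yq ke).
  exists ([ffun i => q i], k) => //; rewrite /P; case: pselect => // ? i /=.
  by rewrite ffunE; exact: qP.
exact: countable_bigcupT_measurable.
Qed.

(* Lebesgue measure on R^n, by recursion on n: the image of the product measure
   under the identification of R x R^n with R^(n+1). *)

Definition rV_cons (R : realType) (n : nat) (p : R * 'rV[R]_n) : 'rV[R]_n.+1 :=
  \row_(i < n.+1) if unlift ord0 i is Some j then p.2 ord0 j else p.1.

Definition rV_uncons (R : realType) (n : nat) (x : 'rV[R]_n.+1) : R * 'rV[R]_n :=
  (x ord0 ord0, \row_(j < n) x ord0 (lift ord0 j)).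

Lemma rV_consK (R : realType) (n : nat) : cancel (@rV_cons R n) (@rV_uncons R n).
Proof.
case=> a v; rewrite /rV_uncons mxE unlift_none; congr pair.
by apply/rowP => j; rewrite !mxE liftK.
Qed.

Lemma measurable_rV_cons (R : realType) (n : nat) :
  measurable_fun [set: R * 'rV[R]_n] (@rV_cons R n).
Proof.
apply: measurable_fun_rVP => i; rewrite /rV_cons.
under eq_fun do rewrite mxE.
case: unliftP => [j _|_]; last exact: measurable_fst.
exact: (measurableT_comp (@measurable_rV_coord R n j) measurable_snd).
Qed.

Lemma measurable_rV_uncons (R : realType) (n : nat) :
  measurable_fun [set: 'rV[R]_n.+1] (@rV_uncons R n).
Proof.
apply/measurable_fun_pair; first exact: measurable_rV_coord.
apply: measurable_fun_rVP => i; under eq_fun do rewrite mxE.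
exact: measurable_rV_coord.
Qed.

(* The library's Lebesgue measure is declared on the alias measurableTypeR R of
   R; lebR is the same measure, on R itself. *)
Definition lebR (R : realType) : set R -> \bar R := @lebesgue_measure R.

Lemma lebR0 (R : realType) : lebR (set0 : set R) = 0%E.
Proof. exact: (measure0 (@lebesgue_measure R)). Qed.

Lemma lebR_ge0 (R : realType) (A : set R) : (0 <= lebR A)%E.
Proof. exact: (measure_ge0 (@lebesgue_measure R)). Qed.

Lemma lebR_sigma_additive (R : realType) : semi_sigma_additive (@lebR R).
Proof. exact: (@measure_semi_sigma_additive _ _ _ (@lebesgue_measure R)). Qed.

HB.instance Definition _ (R : realType) :=
  isMeasure.Build _ _ _ (@lebR R) (lebR0 R) (@lebR_ge0 R)
    (@lebR_sigma_additive R).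

Lemma lebR_sigma_finite (R : realType) : sigma_finite setT (@lebR R).
Proof. exact: (@sigma_finiteT _ _ _ (@lebesgue_measure R)). Qed.

HB.instance Definition _ (R : realType) :=
  Measure_isSigmaFinite.Build _ _ _ (@lebR R) (@lebR_sigma_finite R).

Definition leb_step (R : realType) (n : nat)
    (m : {sigma_finite_measure set 'rV[R]_n -> \bar R}) :
  set 'rV[R]_n.+1 -> \bar R :=
  pushforward (@lebR R \x m)%E (@rV_cons R n).

Lemma leb_step0 (R : realType) (n : nat)
    (m : {sigma_finite_measure set 'rV[R]_n -> \bar R}) :
  leb_step m set0 = 0%E.
Proof. by rewrite /leb_step /pushforward preimage_set0 measure0. Qed.

Lemma leb_step_ge0 (R : realType) (n : nat)
    (m : {sigma_finite_measure set 'rV[R]_n -> \bar R}) (A : set 'rV[R]_n.+1) :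
  (0 <= leb_step m A)%E.
Proof. by rewrite /leb_step /pushforward; exact: measure_ge0. Qed.

Lemma leb_step_sigma_additive (R : realType) (n : nat)
    (m : {sigma_finite_measure set 'rV[R]_n -> \bar R}) :
  semi_sigma_additive (leb_step m).
Proof.
move=> F mF tF mUF; rewrite /leb_step /pushforward preimage_bigcup.
have mc (A : set 'rV[R]_n.+1) : measurable A -> measurable (@rV_cons R n @^-1` A).
  by move=> mA; rewrite -[X in measurable X]setTI; exact: measurable_rV_cons.
apply: measure_semi_sigma_additive => [k||]; first exact: mc.
- apply/trivIsetP => /= i j _ _ ij; rewrite -preimage_setI.
  by move/trivIsetP : tF => /(_ _ _ _ _ ij) ->//; rewrite preimage_set0.
- by rewrite -preimage_bigcup; exact: mc.
Qed.

HB.instance Definition _ (R : realType) (n : nat)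
    (m : {sigma_finite_measure set 'rV[R]_n -> \bar R}) :=
  isMeasure.Build _ _ _ (leb_step m) (leb_step0 m) (leb_step_ge0 m)
    (@leb_step_sigma_additive R n m).

Lemma leb_step_sigma_finite (R : realType) (n : nat)
    (m : {sigma_finite_measure set 'rV[R]_n -> \bar R}) :
  sigma_finite setT (leb_step m).
Proof.
have /sigma_finiteP[F [TF ndF Foo]] := sigma_finiteT (@lebR R).
have /sigma_finiteP[G [TG ndG Goo]] := sigma_finiteT m.
exists (fun k => @rV_uncons R n @^-1` (F k `*` G k)).
  rewrite -preimage_bigcup (_ : \bigcup_i _ = setT) ?preimage_setT//.
  rewrite -setXTT TF TG predeqE => -[x y]; split.
    by move=> [k _ []/= ? ?]; split; exists k.
  move=> [/= [k _ Fkx] [l _ Gly]]; exists (maxn k l) => //; split.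
  - by move: x Fkx; exact/subsetPset/ndF/leq_maxl.
  - by move: y Gly; exact/subsetPset/ndG/leq_maxr.
move=> k; have [mF Fk] := Foo k; have [mG Gk] := Goo k; split.
  rewrite -[X in measurable X]setTI; apply: measurable_rV_uncons => //.
  exact: measurableX.
rewrite /leb_step /pushforward -comp_preimage.
rewrite (_ : _ \o _ = id) ?preimage_id; last by apply/funext => p; exact: rV_consK.
by rewrite product_measure1E// lte_mul_pinfty// ge0_fin_numE.
Qed.

HB.instance Definition _ (R : realType) (n : nat)
    (m : {sigma_finite_measure set 'rV[R]_n -> \bar R}) :=
  Measure_isSigmaFinite.Build _ _ _ (leb_step m) (leb_step_sigma_finite m).

(* 'rV[R]_0 is a single point, of measure 1. *)
Fixpoint lebN (R : realType) (n : nat) :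
    {sigma_finite_measure set 'rV[R]_n -> \bar R} :=
  if n is n'.+1 then leb_step (lebN R n') else @dirac _ 'rV[R]_0 0 R.

Lemma lebN_box (R : realType) (n : nat) (a b : 'rV[R]_n) :
  (forall i, a ord0 i <= b ord0 i) ->
  lebN R n [set x : 'rV[R]_n | forall i, a ord0 i < x ord0 i <= b ord0 i] =
  (\prod_(i < n) (b ord0 i - a ord0 i))%:E.
Proof.
elim: n => [|n IH] in a b *.
  by move=> _; rewrite big_ord0 /= diracE mem_set//= => -[].
move=> ab; rewrite big_ord_recl /= /leb_step /pushforward.
pose a' := (rV_uncons a).2; pose b' := (rV_uncons b).2.
have -> : @rV_cons R n @^-1` [set x | forall i, a ord0 i < x ord0 i <= b ord0 i]
  = `]a ord0 ord0, b ord0 ord0] `*`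
    [set x : 'rV[R]_n | forall i, a' ord0 i < x ord0 i <= b' ord0 i].
  apply/seteqP; split => [[t v] /= h|[t v] /= [h1 h2] i].
    split => [|i]; first by have := h ord0; rewrite mxE unlift_none in_itv.
    by have := h (lift ord0 i); rewrite !mxE liftK.
  rewrite mxE; case: unliftP => [j ->|->]; last by move: h1; rewrite in_itv.
  by have := h2 j; rewrite !mxE.
rewrite product_measure1E//=; last first.
  rewrite (_ : [set x : 'rV[R]_n | _] = \big[setI/setT]_(i < n)
      ((@rV_coord R n i) @^-1` `]a' ord0 i, b' ord0 i])).
    apply: bigsetI_measurable => i _; rewrite -[X in measurable X]setTI.
    by apply: measurable_rV_coord.
  rewrite -bigcap_seq; apply/seteqP; split => x /= h i.
    by move=> _; rewrite /rV_coord /= in_itv/=; exact: h.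
  by have := h i (mem_index_enum i); rewrite /rV_coord /= in_itv.
rewrite IH; last by move=> i; rewrite !mxE.
have := ab ord0; rewrite le_eqVlt => /predU1P[e|lt0].
  by rewrite -e set_itvoc0 measure0 subrr mul0e mul0r.
rewrite /lebR lebesgue_measure_itv/= lte_fin lt0 -EFinD -EFinM; congr (_ * _)%:E.
by apply: eq_bigr => i _; rewrite !mxE.
Qed.

Definition lebST (R : realType) (N : nat) :
  {measure set ('rV[R]_N * R) -> \bar R} := (lebN R N \x @lebR R)%E.

(* Lebesgue measurability (the sigma-algebra on space-time is the Borel one):
   equality almost everywhere on D with a Borel function. *)
Definition lebesgue_measurable (R : realType) (N : nat) (D : set ('rV[R]_N * R))
    (f : 'rV[R]_N * R -> R) : Prop :=
  exists2 g : 'rV[R]_N * R -> R, measurable_fun setT g &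
    {ae lebST R N, forall q, D q -> f q = g q}.

(* v is extended outside A by the neutral value, -oo for ess sup and +oo for
   ess inf. *)
Definition osc (R : realType) (N : nat) (A : set 'rV[R]_N) (v : 'rV[R]_N -> R) :
  \bar R :=
  (ess_sup (lebN R N) (patch (fun=> -oo) A (EFin \o v)) -
   ess_inf (lebN R N) (patch (fun=> +oo) A (EFin \o v)))%E.

Definition Cr (R : realType) (N : nat) (r : R) : set ('rV[R]_N * 'rV[R]_N) :=
  closure (eball 0 r) `*` closure (eball 0 r).

(* Radon measures on a set A are Borel measures finite on the compact subsets of
   A; they are represented by their extension by zero to the ambient space.  As
   Cr is compact, the condition for A = Cr is just finiteness. *)

Definition radon_Cr (R : realType) (N : nat) (r : R)
    (m : {measure set ('rV[R]_N * 'rV[R]_N) -> \bar R}) : Prop :=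
  (m (@Cr R N r) < +oo)%E /\ m (~` @Cr R N r) = 0%E.

Definition radon_on (R : realType) (N : nat) (U : set ('rV[R]_N * R))
    (m : {measure set ('rV[R]_N * R) -> \bar R}) : Prop :=
  (forall K, compact K -> K `<=` U -> (m K < +oo)%E) /\ m (~` U) = 0%E.

(* The signed Radon measure p - n on U, given by its Jordan decomposition: p is
   the positive part and n the negative part.  Both may have infinite mass, so
   p - n need not be a charge in the sense of the library. *)
Definition signed_radon_on (R : realType) (N : nat) (U : set ('rV[R]_N * R))
    (p n : {measure set ('rV[R]_N * R) -> \bar R}) : Prop :=
  [/\ radon_on U p, radon_on U n &
      exists2 P, measurable P & p (~` P) = 0%E /\ n P = 0%E].

(* p1 - n1 <= p2 - n2 as signed measures in U; all terms below are finite, since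
   A is contained in a compact subset of U. *)
Definition signed_le_on (R : realType) (N : nat) (U : set ('rV[R]_N * R))
    (p1 n1 p2 n2 : {measure set ('rV[R]_N * R) -> \bar R}) : Prop :=
  forall A, measurable A -> (exists K, [/\ compact K, K `<=` U & A `<=` K]) ->
    (p1 A - n1 A <= p2 A - n2 A)%E.

(* The restriction of m to S has a density in L^oo(S). *)
Definition in_Linfty (R : realType) (N : nat) (S : set ('rV[R]_N * R))
    (m : {measure set ('rV[R]_N * R) -> \bar R}) : Prop :=
  exists g : 'rV[R]_N * R -> R,
    [/\ measurable_fun setT g,
        exists M : R, {ae lebST R N, forall q, S q -> `|g q| <= M} &
        forall A, measurable A -> A `<=` S ->
          m A = (\int[lebST R N]_(q in A) (g q)%:E)%E].

Definition Cc (R : realType) (N : nat) (U : set ('rV[R]_N * R))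
    (phi : 'rV[R]_N * R -> R) : Prop :=
  continuous phi /\
  exists K, [/\ compact K, K `<=` U & forall q, ~ K q -> phi q = 0].

Definition iter_derive (R : realType) (N : nat) (vs : seq ('rV[R]_N * R))
    (phi : 'rV[R]_N * R -> R) : 'rV[R]_N * R -> R :=
  foldr (fun v f => 'D_v f) phi vs.

Definition smooth (R : realType) (N : nat) (phi : 'rV[R]_N * R -> R) : Prop :=
  forall vs : seq ('rV[R]_N * R),
    continuous (iter_derive vs phi) /\
    forall q v, derivable (iter_derive vs phi) q v.

(* The distributional derivative with respect to time of u, in the open set U,
   is the signed Radon measure p - n. *)
Definition is_dt (R : realType) (N : nat) (U : set ('rV[R]_N * R))
    (u : 'rV[R]_N * R -> R)
    (p n : {measure set ('rV[R]_N * R) -> \bar R}) : Prop :=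
  [/\ signed_radon_on U p n,
      forall K, compact K -> K `<=` U ->
        (lebST R N).-integrable K (EFin \o u) &
      forall phi, Cc U phi -> smooth phi ->
        \int[p]_(q in U) phi q - \int[n]_(q in U) phi q =
        - \int[lebST R N]_(q in U) (u q * 'D_(0, 1) phi q)].

Definition strip (R : realType) (N : nat) (T : \bar R) : set ('rV[R]_N * R) :=
  [set q | 0 < q.2 /\ (q.2%:E < T)%E].

(* The values of z outside the strip are irrelevant. *)
Definition Linfty_w (R : realType) (N : nat) (r : R) (T : \bar R)
    (z : 'rV[R]_N * R -> {measure set ('rV[R]_N * 'rV[R]_N) -> \bar R}) : Prop :=
  [/\ forall q, strip T q -> radon_Cr r (z q),
      forall f : 'rV[R]_N * 'rV[R]_N -> R, {within Cr r, continuous f} ->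
        lebesgue_measurable (strip T) (fun q => \int[z q]_(xy in Cr r) f xy) &
      exists M : R,
        {ae lebST R N, forall q, strip T q -> (z q (Cr r) <= M%:E)%E}].

(* The nonlocal divergence of z is the signed Radon measure p - n. *)
Definition is_Div (R : realType) (N : nat) (r : R) (T : \bar R)
    (z : 'rV[R]_N * R -> {measure set ('rV[R]_N * 'rV[R]_N) -> \bar R})
    (p n : {measure set ('rV[R]_N * R) -> \bar R}) : Prop :=
  signed_radon_on (strip T) p n /\
  forall phi, Cc (strip T) phi ->
    \int[p]_(q in strip T) phi q - \int[n]_(q in strip T) phi q =
    - (2 * r)^-1 *
      \int[@lebR R]_(t in [set t | 0 < t /\ (t%:E < T)%E])
        \int[lebN R N]_w
          \int[z (w, t)]_(xy in Cr r) (phi (w + xy.1, t) - phi (w + xy.2, t)).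

Definition kuratowski (R : realType) (N : nat) (D : nat -> set 'rV[R]_N)
    (D0 : set 'rV[R]_N) : Prop :=
  (forall x : nat -> 'rV[R]_N, (forall n, D n (x n)) ->
     cluster (x @ \oo) `<=` D0) /\
  (forall y, D0 y ->
     exists2 x : nat -> 'rV[R]_N, (forall n, D n (x n)) & x @ \oo --> y).

Definition thicken (R : realType) (N : nat) (F : set 'rV[R]_N) (delta : R) :
  set 'rV[R]_N := \bigcup_(x in F) eball x delta.

Definition slice (R : realType) (N : nat) (E : set ('rV[R]_N * R)) (t : R) :
  set 'rV[R]_N := [set x | E (x, t)].

Definition halfspace (R : realType) (N : nat) : set ('rV[R]_N * R) :=
  [set q | 0 <= q.2].

Definition Text (R : realType) (N : nat) (E : set ('rV[R]_N * R)) : \bar R :=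
  ereal_inf [set t%:E | t in
    [set t : R | 0 < t /\ forall s, t <= s -> slice E s = set0]].

(* The distance d(x, t); in R^N x (0, Text E) the slices of a weak superflow are
   nonempty, hence dist_pt is finite there. *)
Definition dfun (R : realType) (N : nat) (E : set ('rV[R]_N * R))
    (q : 'rV[R]_N * R) : R := fine (dist_pt q.1 (slice E q.2)).

Definition superflow_field (R : realType) (N : nat) (r : R)
    (E : set ('rV[R]_N * R))
    (z : 'rV[R]_N * R -> {measure set ('rV[R]_N * 'rV[R]_N) -> \bar R}) : Prop :=
  let Q := strip (Text E) in
  let d := dfun E in
  Linfty_w r (Text E) z /\
  exists Dp Dn : {measure set ('rV[R]_N * R) -> \bar R},
    [/\ is_Div r (Text E) z Dp Dn,
        exists dp dn : {measure set ('rV[R]_N * R) -> \bar R},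
          is_dt (Q `\` E) d dp dn /\ signed_le_on (Q `\` E) Dp Dn dp dn,
        {ae lebST R N, forall q, Q q ->
          (z q (Cr r) <= 1)%E /\
          (\int[z q]_(xy in Cr r)
             (d (q.1 + xy.1, q.2) - d (q.1 + xy.2, q.2))%:E =
           osc (eball q.1 r) (fun x => d (x, q.2)))%E} &
        forall lambda : R, 0 < lambda ->
          in_Linfty [set q | Q q /\ lambda <= d q] Dp].

Definition weak_superflow (R : realType) (N : nat) (r : R) (E0 : set 'rV[R]_N)
    (E : set ('rV[R]_N * R)) : Prop :=
  closed E /\ E `<=` @halfspace R N /\
  slice E 0 `<=` E0 /\
  ((forall t, 0 <= t -> bounded_set (slice E t)) \/
   (forall t, 0 <= t -> bounded_set (~` slice E t))) /\
  (forall t delta : R, 0 <= t -> 0 < delta -> exists2 tau : R, 0 < tau &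
     forall s, t < s < t + tau -> slice E s `<=` thicken (slice E t) delta) /\
  (forall t : R, 0 < t -> forall s : nat -> R, (forall n, 0 <= s n < t) ->
     s @ \oo --> t -> kuratowski (fun n => slice E (s n)) (slice E t)) /\
  exists z, superflow_field r E z.

Definition weak_subflow (R : realType) (N : nat) (r : R) (E0 : set 'rV[R]_N)
    (A : set ('rV[R]_N * R)) : Prop :=
  (exists2 U : set ('rV[R]_N * R), open U & A = U `&` @halfspace R N) /\
  weak_superflow r (~` E0°) (@halfspace R N `\` A).

(* Main.v *)
Require Import Defs.
From mathcomp Require Import all_boot all_order all_algebra.
From mathcomp Require Import all_classical all_reals all_analysis.
From mathcomp Require Import measurable_realfun ess_sup_inf.
From mathcomp Require Import ring lra.
Set Implicit Arguments.
Unset Strict Implicit.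
Unset Printing Implicit Defensive.
Import Order.TTheory GRing.Theory Num.Theory.
Import numFieldNormedType.Exports.
Local Open Scope classical_set_scope.
Local Open Scope ring_scope.

(** Let G be the complement of F, which is a superflow too, and let d and d' be the
    distances to the slices of E and G. The claim is that d + d' >= D at all times,
    for every D > 0 not above the initial distance of the two flows.

    Both distances satisfy a differential inequality whose right-hand side is the
    nonlocal divergence of a calibrating field, that is, of a subgradient at the
    distance of the functional that integrates over w the oscillation in the ball
    of centre w. The oscillation in a ball is submodular: passing from a pair of
    functions to their maximum and minimum does not increase the sum of their
    oscillations (oscB_submodular). Hence subgradients are monotone with respect
    to positive parts, ball by ball: if the gap g is the positive part of
    D - d - d', the pairing of each field with g is at most the gain of oscillation
    caused by adding g to the distance (pairing_gain), and the two gains have a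
    nonpositive sum (gap_gain_le0). Formally, the integral of g^2 therefore
    decreases, and it vanishes at the initial time.

    Three points have to be settled. The differential inequalities hold only off
    the flows, while g does not vanish there. So d and d' are replaced by their
    truncations from below at a level that moves at a constant speed M. This
    preserves calibrations, which only depend on the order of the values of the
    distance (oscB_trunc), and it preserves the differential inequality at
    positive distance from the flow, if M bounds the positive part of the
    divergence there (flow_lip). For a short time the gap of the truncations is
    supported between the two flows, away from both (local_comparison).

    Distances are only continuous from the left and lower semicontinuous from the
    right in time, and the fields are only weakly measurable. All estimates are
    therefore reduced to increments between two times: the differential inequality
    is tested with products of a function of space and a cutoff in time that tends
    to the indicator function of an interval (flow_test, flow_smooth). Just before
    a time sg the distances are uniformly close to their values at sg, which bounds
    the derivative from the left of the integral of g^2 (flow_left). Induction on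
    the reals then replaces integration in time (comparison_principle).

    Finally, time derivatives are tested with smooth functions only. Lipschitz
    functions of bounded support are approximated by means of a smooth partition
    of unity built from exp(-1/y) (smooth_approx).

    The local statement is propagated to all times by a second induction on the
    reals (superflows_stay_apart). *)

(** * Integrals of functions of unknown measurability, and signed measures *)

Section measure_lemmas.
Context {dd : measure_display} {T : measurableType dd} {R : realType}.
Implicit Types mu : {measure set T -> \bar R}.

Import HBNNSimple.

(** The integral of a nonnegative function is the supremum of the integrals of the
    simple functions below it, and restricting a simple function to the
    complement of a null set does not change its integral. This gives
    monotonicity for functions of unknown measurability, such as the integrals of
    a given test function against a field of measures. *)
Lemma le_integral_off_null mu (f h : T -> \bar R) (Z : set T) :
  measurable Z -> mu Z = 0%E ->
  (forall x, (0 <= f x)%E) -> (forall x, (0 <= h x)%E) ->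
  (forall x, ~ Z x -> (f x <= h x)%E) ->
  (\int[mu]_x f x <= \int[mu]_x h x)%E.
Proof.
move=> mZ Z0 f0 h0 fh; rewrite !ge0_integralTE//.
apply: ge_ereal_sup => _ [k /= kf <-].
have mZc : measurable (~` Z) by exact: measurableC.
apply: le_ereal_sup_tmp; exists (sintegral mu (proj_nnsfun k mZc)).
  exists (proj_nnsfun k mZc) => // x /=; rewrite mindicE.
  case: (boolP (x \in ~` Z)); rewrite ?inE => xZ /=.
    by rewrite mulr1 (le_trans (kf x))//; exact: fh.
  by rewrite mulr0.
rewrite -!integralT_nnsfun.
have mk : measurable_fun setT (EFin \o k).
  exact/measurable_EFinP/measurable_funP.
have -> : (\int[mu]_x (k x)%:E = \int[mu]_(x in ~` Z) (k x)%:E)%E.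
  rewrite (@ge0_negligible_integral _ _ _ mu setT Z)//; first by rewrite setTD.
  by move=> x _; rewrite lee_fin.
rewrite [leLHS]integral_mkcond.
rewrite le_eqVlt; apply/orP; left; apply/eqP; apply: eq_integral => x _.
rewrite /patch/= mindicE; case: (x \in ~` Z) => /=; first by rewrite mulr1.
by rewrite mulr0.
Qed.

(** The lower bound matters even for the upper estimate: the real-valued integral
    of a function whose integral is infinite is 0 by convention, and b1 excludes
    this. *)
Lemma Rintegral_between_ae mu (f b1 b2 : T -> R) :
  mu.-integrable setT (EFin \o b1) -> mu.-integrable setT (EFin \o b2) ->
  {ae mu, forall x, b1 x <= f x <= b2 x} ->
  \int[mu]_x b1 x <= \int[mu]_x f x <= \int[mu]_x b2 x.
Proof.
move=> i1 i2 [Z [mZ Z0 HZ]].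
have pos_le (u v : T -> R) : (forall x, ~ Z x -> u x <= v x) ->
    (\int[mu]_x (EFin \o u)^\+ x <= \int[mu]_x (EFin \o v)^\+ x)%E.
  move=> uv; apply: (@le_integral_off_null _ _ _ Z) => // x nZ.
  by rewrite !funeposE /= ge_max !le_max lexx orbT andbT lee_fin uv.
have neg_le (u v : T -> R) : (forall x, ~ Z x -> u x <= v x) ->
    (\int[mu]_x (EFin \o v)^\- x <= \int[mu]_x (EFin \o u)^\- x)%E.
  move=> uv; apply: (@le_integral_off_null _ _ _ Z) => // x nZ.
  by rewrite !funenegE /= ge_max !le_max lexx orbT andbT ?leeN2 lee_fin ?lerN2 uv.
have h1 x : ~ Z x -> b1 x <= f x.
  by move=> nZ; apply: contrapT => /negP h; apply: nZ; apply: HZ => /andP[] /(negP h).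
have h2 x : ~ Z x -> f x <= b2 x.
  by move=> nZ; apply: contrapT => /negP h; apply: nZ; apply: HZ => /andP[] _ /(negP h).
have fp : (\int[mu]_x (EFin \o f)^\+ x)%E \is a fin_num.
  rewrite ge0_fin_numE ?integral_ge0//.
  by apply: (le_lt_trans (pos_le _ _ h2)); exact: integral_funepos_lt_pinfty.
have fn : (\int[mu]_x (EFin \o f)^\- x)%E \is a fin_num.
  rewrite ge0_fin_numE ?integral_ge0//.
  by apply: (le_lt_trans (neg_le _ _ h1)); exact: integral_funeneg_lt_pinfty.
have ff : (\int[mu]_x (f x)%:E)%E \is a fin_num.
  by rewrite integralE fin_numB; apply/andP; split.
have ffi (b : T -> R) : mu.-integrable setT (EFin \o b) ->
    (\int[mu]_x (b x)%:E)%E \is a fin_num by apply: integrable_fin_num.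
rewrite /Rintegral; apply/andP; split; apply: fine_le; rewrite ?(ffi b1) ?(ffi b2)//.
- rewrite [leLHS]integralE [leRHS]integralE.
  by apply: leeB; [exact: pos_le|exact: neg_le].
- rewrite [leLHS]integralE [leRHS]integralE.
  by apply: leeB; [exact: pos_le|exact: neg_le].
Qed.

(** Integrals over D only see the restriction of the measure to D. *)
Lemma le_measure_integral_on (m1 m2 : {measure set T -> \bar R}) (D : set T)
    (f : T -> \bar R) :
  measurable D -> measurable_fun setT f -> (forall x, (0 <= f x)%E) ->
  (forall A, measurable A -> A `<=` D -> (m1 A <= m2 A)%E) ->
  (\int[m1]_(x in D) f x <= \int[m2]_(x in D) f x)%E.
Proof.
move=> mD mf f0 H.
have e (m : {measure set T -> \bar R}) :
    (\int[m]_(x in D) f x = \int[mrestr m mD]_(x in D) f x)%E.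
  apply: eq_measure_integral => A mA AD.
  by rewrite /= /mrestr (setIidl AD).
rewrite (e m1) (e m2); apply: ge0_le_measure_integral => // A mA.
by apply: H; [exact: measurableI|exact: subIsetr].
Qed.

Lemma integrable_bounded mu (D : set T) (f : T -> R) (M : R) :
  measurable D -> (mu D < +oo)%E -> measurable_fun setT f ->
  (forall x, D x -> `|f x| <= M) -> mu.-integrable D (EFin \o f).
Proof.
move=> mD Doo mf fM; apply: measurable_bounded_integrable => //.
  exact: measurable_funS mf.
exists M; split; first by rewrite num_real.
by move=> y My x /fM /le_trans; apply; exact: ltW.
Qed.

Lemma integrable_indic_lty mu (A : set T) :
  measurable A -> (mu A < +oo)%E -> mu.-integrable setT (EFin \o \1_A).
Proof.
move=> mA Aoo; apply/integrableP; split.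
  by apply/measurable_EFinP; exact: measurable_indic.
rewrite (eq_integral (fun x => (\1_A x)%:E)); last first.
  by move=> t _ /=; rewrite ger0_norm.
by rewrite integral_indic// setIT.
Qed.

(** Moving the negative parts to the other side turns an inequality between
    signed measures into one between positive measures. *)
Lemma le_signed_integral_on (p1 n1 p2 n2 : {measure set T -> \bar R}) (D : set T)
    (f : T -> R) (M : R) :
  measurable D -> measurable_fun setT f -> (forall x, 0 <= f x <= M) ->
  (p1 D < +oo)%E -> (n1 D < +oo)%E -> (p2 D < +oo)%E -> (n2 D < +oo)%E ->
  (forall A, measurable A -> A `<=` D -> (p1 A - n1 A <= p2 A - n2 A)%E) ->
  \int[p1]_(x in D) f x - \int[n1]_(x in D) f x <=
  \int[p2]_(x in D) f x - \int[n2]_(x in D) f x.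
Proof.
move=> mD mf fM f1 f2 f3 f4 H.
have f0 x : 0 <= f x by have /andP[] := fM x.
have fi (m : {measure set T -> \bar R}) : (m D < +oo)%E ->
    (\int[m]_(x in D) (f x)%:E)%E \is a fin_num.
  move=> mDoo; apply: integrable_fin_num => //.
  apply: (@integrable_bounded _ _ _ M) => // x _.
  by have /andP[f0' f1'] := fM x; rewrite ger0_norm.
have mfE : measurable_fun setT (EFin \o f) by exact/measurable_EFinP.
have fin (m : {measure set T -> \bar R}) A : (m D < +oo)%E -> measurable A ->
    A `<=` D -> m A \is a fin_num.
  move=> mDoo mA AD; rewrite ge0_fin_numE//; apply: le_lt_trans mDoo.
  by apply: le_measure => //; rewrite inE.
have : (\int[measure_add p1 n2]_(x in D) (f x)%:E <=
        \int[measure_add p2 n1]_(x in D) (f x)%:E)%E.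
  apply: le_measure_integral_on => // A mA AD.
  rewrite -[leLHS]/(measure_add p1 n2 A) -[leRHS]/(measure_add p2 n1 A) !measure_addE.
  have := H A mA AD.
  have := fin p1 A f1 mA AD; have := fin n1 A f2 mA AD.
  have := fin p2 A f3 mA AD; have := fin n2 A f4 mA AD.
  case: (n2 A) => [c| |]// _; case: (p2 A) => [e| |]// _.
  case: (n1 A) => [g| |]// _; case: (p1 A) => [h| |]// _.
  by rewrite -!EFinB -!EFinD !lee_fin; lra.
rewrite !ge0_integral_measure_add//; last 4 first.
- by move=> x _; rewrite lee_fin.
- exact: measurable_funS mfE.
- by move=> x _; rewrite lee_fin.
- exact: measurable_funS mfE.
rewrite /Rintegral.
have := fi p1 f1; have := fi n1 f2; have := fi p2 f3; have := fi n2 f4.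
case: (\int[n2]_(x in D) _)%E => [c| |]// _.
case: (\int[p2]_(x in D) _)%E => [e| |]// _.
case: (\int[n1]_(x in D) _)%E => [g| |]// _.
case: (\int[p1]_(x in D) _)%E => [h| |]// _.
by rewrite -!EFinD lee_fin /=; lra.
Qed.

End measure_lemmas.

(** * The Euclidean norm on row vectors *)

Section enorm_theory.
Context {R : realType} {N : nat}.
Implicit Types x y z w : 'rV[R]_N.

Lemma enorm_ge0 x : 0 <= enorm x.
Proof. exact: sqrtr_ge0. Qed.

Lemma enormE2 x : enorm x ^+ 2 = \sum_(i < N) x ord0 i ^+ 2.
Proof. by rewrite /enorm sqr_sqrtr// sumr_ge0// => i _; exact: sqr_ge0. Qed.

Lemma enormZ (a : R) x : enorm (a *: x) = `|a| * enorm x.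
Proof.
rewrite /enorm -sqrtr_sqr -sqrtrM ?sqr_ge0// mulr_sumr; congr Num.sqrt.
by apply: eq_bigr => i _; rewrite mxE exprMn.
Qed.

Lemma enormN x : enorm (- x) = enorm x.
Proof. by rewrite -scaleN1r enormZ normrN1 mul1r. Qed.

Lemma enorm0 : enorm (0 : 'rV[R]_N) = 0.
Proof. by rewrite -[0 in LHS](scale0r 0) enormZ normr0 mul0r. Qed.

Lemma enormB_sym x y : enorm (x - y) = enorm (y - x).
Proof. by rewrite -enormN opprB. Qed.

(** Expand the sum of the squares of b x_i - a y_i, where a and b are the norms
    of x and y. *)
Lemma enorm_CS x y : \sum_(i < N) x ord0 i * y ord0 i <= enorm x * enorm y.
Proof.
set a := enorm x; set b := enorm y; set s := \sum_(i < N) _.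
have H : 0 <= 2 * (a * b) * (a * b - s).
  have : 0 <= \sum_(i < N) (b * x ord0 i - a * y ord0 i) ^+ 2.
    by apply: sumr_ge0 => i _; exact: sqr_ge0.
  have -> : \sum_(i < N) (b * x ord0 i - a * y ord0 i) ^+ 2 =
      b ^+ 2 * a ^+ 2 - 2 * (a * b) * s + a ^+ 2 * b ^+ 2.
    rewrite [in X in _ = b ^+ 2 * X - _ + _]enormE2.
    rewrite [in X in _ = _ + _ * X]enormE2 /s !mulr_sumr -sumrB -big_split/=.
    by apply: eq_bigr => i _; ring.
  by have -> : 2 * (a * b) * (a * b - s) =
    b ^+ 2 * a ^+ 2 - 2 * (a * b) * s + a ^+ 2 * b ^+ 2 by ring.
have z0 (v : 'rV[R]_N) : enorm v = 0 -> forall i, v ord0 i = 0.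
  move=> v0 i; have /eqP : \sum_(i < N) v ord0 i ^+ 2 = 0.
    by rewrite -enormE2 v0 expr0n.
  rewrite psumr_eq0; last by move=> j _; exact: sqr_ge0.
  by move=> /allP/(_ i (mem_index_enum i))/=; rewrite sqrf_eq0 => /eqP.
have [a0|a0] := eqVneq a 0.
  rewrite a0 mul0r /s big1// => i _; by rewrite (z0 _ a0) mul0r.
have [b0|b0] := eqVneq b 0.
  rewrite b0 mulr0 /s big1// => i _; by rewrite (z0 _ b0) mulr0.
have ap : 0 < a by rewrite lt_def a0 enorm_ge0.
have bp : 0 < b by rewrite lt_def b0 enorm_ge0.
by move: H; rewrite pmulr_rge0 ?subr_ge0// mulr_gt0// mulr_gt0.
Qed.

Lemma enormD x y : enorm (x + y) <= enorm x + enorm y.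
Proof.
rewrite -(@ler_pXn2r _ 2)// ?nnegrE ?addr_ge0 ?enorm_ge0//.
rewrite sqrrD !enormE2.
have -> : \sum_(i < N) (x + y) ord0 i ^+ 2 = \sum_(i < N) x ord0 i ^+ 2 +
    (\sum_(i < N) x ord0 i * y ord0 i) *+ 2 + \sum_(i < N) y ord0 i ^+ 2.
  by rewrite -sumrMnl -!big_split/=; apply: eq_bigr => i _; rewrite mxE sqrrD.
by rewrite lerD2r lerD2l ler_pMn2r// enorm_CS.
Qed.

Lemma enorm_dist_triangle z x y : enorm (x - y) <= enorm (x - z) + enorm (z - y).
Proof.
rewrite [x - y](_ : _ = (x - z) + (z - y)); first exact: enormD.
by rewrite addrA subrK.
Qed.

Lemma coord_le_enorm x i : `|x ord0 i| <= enorm x.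
Proof.
rewrite -(@ler_pXn2r _ 2)// ?nnegrE ?enorm_ge0// enormE2 real_normK ?num_real//.
by rewrite (bigD1 i)//= lerDl sumr_ge0// => j _; exact: sqr_ge0.
Qed.

Lemma norm_le_bound x (c : R) : 0 <= c -> (forall i, `|x ord0 i| <= c) -> `|x| <= c.
Proof.
move=> c0 H; rewrite /Num.Def.normr /= mx_normrE; apply/bigmax_leP; split=> //.
by move=> [i j] _ /=; rewrite (ord1 i).
Qed.

Lemma coord_le_norm x i : `|x ord0 i| <= `|x|.
Proof.
rewrite [leRHS]/Num.Def.normr /= mx_normrE.
by apply/bigmax_geP; right => /=; exists (ord0, i).
Qed.

Lemma norm_le_enorm x : `|x| <= enorm x.
Proof. by apply: norm_le_bound => [|i]; [exact: enorm_ge0|exact: coord_le_enorm]. Qed.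

Lemma enorm_le_norm x : enorm x <= N%:R * `|x|.
Proof.
rewrite -(@ler_pXn2r _ 2)// ?nnegrE ?mulr_ge0 ?enorm_ge0// enormE2.
have : \sum_(i < N) x ord0 i ^+ 2 <= \sum_(i < N) `|x| ^+ 2.
  apply: ler_sum => i _; rewrite -[leLHS]real_normK ?num_real//.
  by rewrite ler_pXn2r// ?nnegrE// coord_le_norm.
move=> /le_trans; apply; rewrite sumr_const card_ord exprMn -[leLHS]mulr_natl.
rewrite ler_wpM2r ?sqr_ge0// -natrX ler_nat.
by case: (N) => // n; rewrite leq_pmulr.
Qed.

(** Lipschitz continuity for the Euclidean norm; the one-sided inequality suffices
    because x and y can be exchanged. *)
Definition elip (L : R) (f : 'rV[R]_N -> R) :=
  forall x y, f x - f y <= L * enorm (x - y).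

Lemma elip_continuous L f : elip L f -> continuous f.
Proof.
move=> Lf x; apply/(@cvgrPdist_le _ _ _ (nbhs x) _ f (f x)) => e e0.
pose K := `|L| * N%:R + 1.
have K0 : 0 < K by rewrite ltr_wpDl// mulr_ge0.
have Hd y : `|f x - f y| <= K * `|x - y|.
  have h u v : f u - f v <= K * `|u - v|.
    apply: (le_trans (Lf u v)); apply: (@le_trans _ _ (`|L| * enorm (u - v))).
      by rewrite ler_wpM2r ?enorm_ge0// ler_norm.
    apply: (@le_trans _ _ (`|L| * (N%:R * `|u - v|))).
      by rewrite ler_wpM2l// enorm_le_norm.
    by rewrite mulrA ler_wpM2r// lerDl.
  rewrite ler_norml h andbT.
  by have := h y x; rewrite distrC => ?; lra.
apply: (@filterS _ (nbhs x) _ (ball x (e / K))); last first.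
  by apply: nbhsx_ballx; rewrite divr_gt0.
move=> y; rewrite -ball_normE/= => /ltW xy; apply: (le_trans (Hd y)).
by rewrite mulrC -ler_pdivlMr.
Qed.

Lemma elip_enorm : elip 1 (@enorm R N).
Proof. by move=> x y; rewrite mul1r lerBlDr -{1}(subrK y x) enormD. Qed.

Lemma elip_weak L L' f : L <= L' -> elip L f -> elip L' f.
Proof.
by move=> LL H x y; apply: (le_trans (H x y)); rewrite ler_wpM2r ?enorm_ge0.
Qed.

Lemma elipN L f : elip L f -> elip L (fun x => - f x).
Proof. by move=> H x y; rewrite enormB_sym; have := H y x; lra. Qed.

Lemma elip_cst c : elip 0 (fun=> c).
Proof. by move=> x y; rewrite subrr mul0r. Qed.

Lemma elipD L L' f g : elip L f -> elip L' g -> elip (L + L') (fun x => f x + g x).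
Proof. by move=> H K x y; rewrite mulrDl; have := H x y; have := K x y; lra. Qed.

Lemma elip_max L f g : elip L f -> elip L g -> elip L (fun x => Num.max (f x) (g x)).
Proof.
move=> H K x y; rewrite lerBlDr ge_max; apply/andP; split.
  have := H x y; have : f y <= Num.max (f y) (g y) by rewrite le_max lexx.
  by lra.
have := K x y; have : g y <= Num.max (f y) (g y) by rewrite le_max lexx orbT.
by lra.
Qed.

Lemma elip_min L f g : elip L f -> elip L g -> elip L (fun x => Num.min (f x) (g x)).
Proof.
move=> H K.
have -> : (fun x => Num.min (f x) (g x)) = (fun x => - Num.max (- f x) (- g x)).
  by apply/funext => x; rewrite oppr_max !opprK.
exact: (elipN (elip_max (elipN H) (elipN K))).
Qed.

Lemma elip_mul L L' A B f g : elip L f -> elip L' g ->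
  (forall x, `|f x| <= A) -> (forall x, `|g x| <= B) ->
  elip (L * B + L' * A) (fun x => f x * g x).
Proof.
move=> Lf Lg fA gB x y.
have abs_le L0 h : elip L0 h -> `|h x - h y| <= L0 * enorm (x - y).
  move=> Lh; rewrite ler_norml Lh andbT lerNl opprB enormB_sym.
  exact: Lh.
have -> : f x * g x - f y * g y = (f x - f y) * g x + (g x - g y) * f y by ring.
apply: (le_trans (ler_norm _)); apply: (le_trans (ler_normD _ _)).
rewrite !normrM mulrDl ![_ * _ * enorm _]mulrAC; apply: lerD.
  by apply: ler_pM => //; exact: abs_le.
by apply: ler_pM => //; exact: abs_le.
Qed.

Lemma closed_enorm_le (c : R) : closed [set x : 'rV[R]_N | enorm x <= c].
Proof.
apply: (@closed_comp _ _ (@enorm R N) [set t | t <= c]); last exact: closed_le.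
by move=> z _; exact: (elip_continuous elip_enorm).
Qed.

Lemma closure_eball r x : closure (eball 0 r) x -> enorm x <= r.
Proof.
move=> cx; have : closure [set x : 'rV[R]_N | enorm x <= r] x.
  by move: x cx; apply: closure_subset => y; rewrite /eball/= subr0 => /ltW.
by rewrite -((closure_id _).1 (@closed_enorm_le r)).
Qed.

Lemma closure_eball0 r : 0 < r -> closure (eball 0 r) (0 : 'rV[R]_N).
Proof. by move=> r0; apply: subset_closure; rewrite /eball/= subr0 enorm0. Qed.

Lemma open_eball w r : open (eball w r : set 'rV[R]_N).
Proof.
apply: (@open_comp _ _ (fun x => enorm (x - w)) [set t | t < r]); last exact: open_lt.
move=> z _; apply: (@elip_continuous 1) => x y.
by have := elip_enorm (x - w) (y - w); rewrite opprB addrA subrK.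
Qed.

Lemma bounded_enorm (A : set 'rV[R]_N) (M : R) :
  (forall x, A x -> enorm x <= M) -> bounded_set A.
Proof.
move=> H; exists M; split; first exact: num_real.
move=> y My x Ax; apply: (le_trans (norm_le_enorm x)).
by apply: (le_trans (H x Ax)); exact: ltW.
Qed.

Lemma compact_closure_eball r : compact (closure (eball (0 : 'rV[R]_N) r)).
Proof.
apply: bounded_closed_compact; last exact: closed_closure.
by apply: (@bounded_enorm _ r) => x; exact: closure_eball.
Qed.

Lemma rV_continuous_measurable (f : 'rV[R]_N -> R) :
  continuous f -> measurable_fun setT f.
Proof.
move=> cf; apply: (measurability _ (RGenOpens.measurableE R)).
move=> _ [_ [a [b ->]] <-]; rewrite setTI; apply: rV_open_measurable.
by apply: open_comp => [z _|]; [exact: cf|exact: interval_open].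
Qed.

Lemma rV_closed_measurable (A : set 'rV[R]_N) : closed A -> measurable A.
Proof.
move=> cA; rewrite -[X in measurable X]setCK; apply: measurableC.
by apply: rV_open_measurable; exact: closed_openC.
Qed.

Lemma measurable_rV_box (a b : 'rV[R]_N) :
  measurable [set y : 'rV[R]_N | forall i, a ord0 i < y ord0 i <= b ord0 i].
Proof.
set B := (X in measurable X).
have -> : B = \big[setI/setT]_(i < N)
    ((@rV_coord R N i) @^-1` `]a ord0 i, b ord0 i]).
  rewrite -bigcap_seq; apply/seteqP; split => y /= h i.
    by move=> _; rewrite /rV_coord /= in_itv/=; exact: h.
  by have := h i (mem_index_enum i); rewrite /rV_coord /= in_itv.
apply: bigsetI_measurable => i _; rewrite -[X in measurable X]setTI.
by apply: measurable_rV_coord.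
Qed.

Lemma lebN_open_gt0 (U : set 'rV[R]_N) x : open U -> U x -> (0 < lebN R N U)%E.
Proof.
move=> oU Ux.
have /nbhs_ballP[e /= e0 be] : nbhs x U by apply: open_nbhs_nbhs.
pose a : 'rV[R]_N := \row_i (x ord0 i - e / 2).
pose b : 'rV[R]_N := \row_i (x ord0 i + e / 2).
pose B := [set y : 'rV[R]_N | forall i, a ord0 i < y ord0 i <= b ord0 i].
have BU : B `<=` U.
  move=> y By; apply: be; split=> // i j; rewrite (ord1 i).
  have := By j; rewrite !mxE /ball/= => /andP[h1 h2].
  by rewrite ltr_norml; apply/andP; split; lra.
have mB : measurable B by exact: measurable_rV_box.
apply: (@lt_le_trans _ _ (lebN R N B)); last first.
  by apply: le_measure => //; rewrite inE//; exact: rV_open_measurable.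
rewrite lebN_box; last by move=> i; rewrite !mxE; lra.
by rewrite lte_fin prodr_gt0// => i _; rewrite !mxE; lra.
Qed.

End enorm_theory.

(** * Flat functions and a smooth step *)

Section flat_functions.
Context {R : realType}.
Implicit Types y : R.

(** Up to linear combinations, the functions y^-j exp(-1/y), extended by 0, are
    stable under differentiation, which makes exp(-1/y) smooth at 0. *)
Definition flat (j : nat) y : R :=
  if 0 < y then (y^-1) ^+ j * expR (- y^-1) else 0.

Lemma flat_ge0 j y : 0 <= flat j y.
Proof.
rewrite /flat; case: ifP => // y0.
by rewrite mulr_ge0 ?expR_ge0// exprn_ge0// invr_ge0 ltW.
Qed.

(** One term of the exponential series bounds exp(1/y) from below by a multiple of
    y^-(j+2). A quadratic bound at 0 forces the derivative there to vanish. *)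
Lemma flat_le_sqr j y : flat j y <= (j.+2)`!%:R * y ^+ 2.
Proof.
have f0 : (0 : R) < (j.+2)`!%:R by rewrite ltr0n fact_gt0.
rewrite /flat; case: ifP => y0; last by rewrite mulr_ge0 ?sqr_ge0 ?ltW.
have [u u0 ->] : exists2 u, 0 < u & y = u^-1.
  by exists y^-1; rewrite ?invr_gt0// invrK.
rewrite invrK.
have := @expR_ge1Dxn R u j.+1 (ltW u0) => H.
have {}H : u ^+ j.+2 <= (j.+2)`!%:R * expR u.
  rewrite mulrC -ler_pdivrMr//; apply: le_trans H.
  by rewrite lerDr.
rewrite expRN ler_pdivrMr ?expR_gt0// mulrAC exprVn.
by rewrite ler_pdivlMr ?exprn_gt0// -exprD addn2.
Qed.

Lemma is_derive_flat j y : is_derive y 1 (flat j) (flat j.+2 y - j%:R * flat j.+1 y).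
Proof.
have [y0|y0|->] := ltrgt0P y; last 1 first.
- rewrite /flat ltxx mulr0 subr0.
  have cv : (fun h : R => h^-1 *: (flat j (h *: 1 + 0) - flat j 0)) @ 0^' --> (0 : R).
    apply/cvgrPdist_le => e e0.
    pose c : R := (j.+2)`!%:R; have c0 : 0 < c by rewrite ltr0n fact_gt0.
    near=> h.
    have h0 : h != 0 by near: h; exact: nbhs_dnbhs_neq.
    rewrite sub0r normrN /flat ltxx subr0 addr0 -/(flat j (h *: 1)).
    rewrite [h *: 1]mulr1 [h^-1 *: _]/(h^-1 * _) normrM.
    rewrite (ger0_norm (flat_ge0 _ _)) normfV mulrC ler_pdivrMr ?normr_gt0//.
    apply: (le_trans (flat_le_sqr j h)).
    rewrite -/c -real_normK ?num_real// expr2 mulrA ler_pM2r ?normr_gt0//.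
    rewrite mulrC -ler_pdivlMr//.
    near: h; apply: nbhs_dnbhs; apply/nbhs_ballP; exists (e / c) => /=.
      by rewrite divr_gt0.
    by move=> h; rewrite -ball_normE/= sub0r normrN => /ltW.
  apply: DeriveDef; first by apply/cvg_ex; exists 0.
  exact: cvg_lim cv.
- have yn : y != 0 by rewrite gt_eqF.
  have /near_eq_is_derive : \near y, (fun t => t^-1 ^+ j * expR (- t^-1)) y = flat j y.
    near=> t; rewrite /flat ifT//; near: t; exact: lt_nbhsr.
  apply.
  have dV : is_derive y (1 : R) (fun t : R => t^-1) (- y ^- 2).
    have := @is_deriveV R (fun t => t) y 1 1 yn (is_derive_id _ _).
    by move=> h; apply: is_derive_eq; rewrite [_ *: _]mulr1.
  have dN : is_derive y (1 : R) (fun t : R => - t^-1) (y ^- 2).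
    by apply: is_derive_eq; rewrite opprK.
  have dE : is_derive y (1 : R) (fun t : R => expR (- t^-1)) (expR (- y^-1) * y ^- 2).
    exact: (@is_derive1_comp R expR (fun t => - t^-1)).
  have dX : is_derive y (1 : R) (fun t : R => t^-1 ^+ j)
      (j%:R * y^-1 ^+ j.-1 * - y ^- 2).
    have := @is_deriveX R R (fun t => t^-1) j y 1 (- y ^- 2) dV.
    by rewrite exprfctE => h; apply: is_derive_eq.
  apply: (@is_derive_eq _ _ _ _ _ _ _ _ (is_deriveM dX dE)).
  rewrite /flat y0 /= /GRing.scale /=.
  rewrite -!exprVn.
  case: (j) => [|k] /=; first by rewrite !mul0r !mulr0 subr0 addr0 expr0 mul1r mulrC.
  rewrite !exprS; ring.
- have /near_eq_is_derive : \near y, (fun t : R => 0 : R) y = flat j y.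
    near=> t; rewrite /flat ifF//; apply/negbTE; rewrite -leNgt.
    by near: t; exact: lt_le_nbhsl.
  apply; rewrite /flat ltNge (ltW y0)/= mulr0 subr0.
  exact: is_derive_cst.
Unshelve. all: by end_near. Qed.

Lemma flat0_gt0 y : 0 < y -> 0 < flat 0 y.
Proof. by move=> y0; rewrite /flat y0 expr0 mul1r expR_gt0. Qed.

Lemma flat0_mono : {homo flat 0 : x y / x <= y}.
Proof.
move=> x y xy; rewrite {1}/flat; case: ifP => x0; last exact: flat_ge0.
have y0 := lt_le_trans x0 xy.
by rewrite /flat y0 !expr0 !mul1r ler_expR lerN2 lef_pV2.
Qed.

(** The denominator is positive, since y and 1 - y are not both nonpositive. *)
Definition flatw y : R := (flat 0 y + flat 0 (1 - y))^-1.

Lemma flatw_den_gt0 y : 0 < flat 0 y + flat 0 (1 - y).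
Proof.
have [y0|y0] := ltP 0 y; first by rewrite ltr_pwDl ?flat0_gt0 ?flat_ge0.
by rewrite ltr_wpDl ?flat_ge0// flat0_gt0//; lra.
Qed.

Lemma is_derive_flatw y :
  is_derive y 1 flatw (- (flatw y ^+ 2 * (flat 2 y - flat 2 (1 - y)))).
Proof.
have d1 : is_derive y (1 : R) (flat 0) (flat 2 y).
  by have := is_derive_flat 0 y; rewrite mul0r subr0.
have d2 : is_derive y (1 : R) (fun t => flat 0 (1 - t)) (- flat 2 (1 - y)).
  have h : is_derive (1 - y) (1 : R) (flat 0) (flat 2 (1 - y)).
    by have := is_derive_flat 0 (1 - y); rewrite mul0r subr0.
  have k : is_derive y (1 : R) (fun t => 1 - t) (- 1).
    by apply: is_derive_eq; rewrite add0r mul1r.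
  have := @is_derive1_comp R (flat 0) (fun t => 1 - t) y _ _ h k.
  by rewrite mulrN1.
have d3 := is_deriveD d1 d2.
have := @is_deriveV R _ y _ 1 (lt0r_neq0 (flatw_den_gt0 y)) d3.
move=> h; apply: (@is_derive_eq _ _ _ _ _ _ _ _ h).
by rewrite /flatw exprVn /GRing.scale /= mulNr.
Qed.

Definition sstep y : R := flat 0 y * flatw y.

Lemma sstep0 y : y <= 0 -> sstep y = 0.
Proof. by move=> y0; rewrite /sstep /flat ltNge y0 mul0r. Qed.

Lemma sstep1 y : 1 <= y -> sstep y = 1.
Proof.
move=> y1; rewrite /sstep /flatw [flat 0 (1 - y)]/flat ifF; last first.
  by apply/negbTE; rewrite -leNgt; lra.
by rewrite addr0 mulfV// gt_eqF// flat0_gt0//; lra.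
Qed.

Lemma sstep_mono : {homo sstep : x y / x <= y}.
Proof.
move=> x y xy; rewrite /sstep /flatw.
rewrite ler_pdivrMr ?flatw_den_gt0// mulrAC ler_pdivlMr ?flatw_den_gt0//.
have := flat0_mono xy.
have : flat 0 (1 - y) <= flat 0 (1 - x) by apply: flat0_mono; lra.
have := flat_ge0 0 x; have := flat_ge0 0 (1 - y).
have := flat_ge0 0 y; have := flat_ge0 0 (1 - x).
nra.
Qed.

Lemma sstep_itv y : 0 <= sstep y <= 1.
Proof.
apply/andP; split.
  have [y0|y0] := leP y 0; first by rewrite sstep0.
  by rewrite -(@sstep0 0)// sstep_mono// ltW.
have [y0|y0] := leP 1 y; first by rewrite sstep1.
by rewrite -(@sstep1 1)// sstep_mono// ltW.
Qed.

End flat_functions.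

(** * Smooth test functions and time cutoffs *)

Section smooth_class.
Context {R : realType} {N : nat}.
Local Notation X := ('rV[R]_N * R)%type.

Definition affine_along (l m : X -> R) :=
  continuous l /\ forall (h : R) (q v : X), l (h *: v + q) = h * m v + l q.

(** Smoothness quantifies over all iterated directional derivatives. It is proved
    by one induction on this algebra of functions, which is stable under
    directional derivatives and contains all the test functions used below. *)
Inductive smooth_alg : (X -> R) -> Prop :=
| smooth_alg_cst c : smooth_alg (fun=> c)
| smooth_alg_flat j l m : affine_along l m -> smooth_alg (fun q => flat j (l q))
| smooth_alg_flatw l m : affine_along l m -> smooth_alg (fun q => flatw (l q))
| smooth_alg_add f g : smooth_alg f -> smooth_alg g -> smooth_alg (fun q => f q + g q)
| smooth_alg_mul f g : smooth_alg f -> smooth_alg g -> smooth_alg (fun q => f q * g q).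

Lemma is_derive_dir (f : R -> R) (y a df : R) :
  is_derive y 1 f df -> is_derive y a f (a * df).
Proof.
move=> [fd <-].
have dff : differentiable f y by apply/derivable1_diffP.
apply: DeriveDef; first exact: diff_derivable.
rewrite !deriveE//.
by rewrite -[a in LHS]mulr1 -[a * 1]/(a *: (1 : R)) linearZ.
Qed.

(** Along a line an affine function is affine in the parameter, so the difference
    quotient of the composition in a direction v is that of f in the direction
    m v. *)
Lemma is_derive_comp_affine (f : R -> R) df (l m : X -> R) q v :
  affine_along l m -> is_derive (l q) 1 f df ->
  is_derive q v (fun p => f (l p)) (m v * df).
Proof.
move=> [_ lm] /(@is_derive_dir _ _ (m v)) [fd <-].
have e : (fun h : R => h^-1 *: (f (l (h *: v + q)) - f (l q))) =
         (fun h : R => h^-1 *: (f (h *: m v + l q) - f (l q))).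
  by apply/funext => h; rewrite lm.
by apply: DeriveDef; rewrite /derivable ?/derive /= e.
Qed.

Lemma is_derive_continuous (f : R -> R) (df y : R) :
  is_derive y 1 f df -> {for y, continuous f}.
Proof. by move=> [fd _]; apply: differentiable_continuous; exact/derivable1_diffP. Qed.

Lemma smooth_alg_derive f : smooth_alg f -> continuous f /\
  forall v, exists2 g, smooth_alg g & forall q, is_derive q v f (g q).
Proof.
elim=> {f} [c|j l m lm|l m lm|f g nf [cf df] ng [cg dg]|f g nf [cf df] ng [cg dg]].
- split=> [|v]; first exact: cst_continuous.
  by exists (fun=> 0); [exact: smooth_alg_cst|move=> q; exact: is_derive_cst].
- split=> [q|v].
    apply: (@continuous_comp _ _ _ l (flat j)); first exact: lm.1.
    exact: (is_derive_continuous (is_derive_flat j (l q))).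
  exists (fun q => m v * (flat j.+2 (l q) + - j%:R * flat j.+1 (l q))).
    apply: smooth_alg_mul; first exact: smooth_alg_cst.
    apply: smooth_alg_add; first exact: smooth_alg_flat lm.
    by apply: smooth_alg_mul; [exact: smooth_alg_cst|exact: smooth_alg_flat lm].
  move=> q; rewrite mulNr; exact: is_derive_comp_affine (is_derive_flat j (l q)).
- split=> [q|v].
    apply: (@continuous_comp _ _ _ l flatw); first exact: lm.1.
    exact: (is_derive_continuous (is_derive_flatw (l q))).
  have lm' : affine_along (fun q => 1 - l q) (fun v => - m v).
    split=> [q|h q w]; last by rewrite lm.2; ring.
    by apply: continuousB; [exact: cst_continuous|exact: lm.1].
  exists (fun q => m v * ((-1) * ((flatw (l q) * flatw (l q)) *
      (flat 2 (l q) + (-1) * flat 2 (1 - l q))))).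
    apply: smooth_alg_mul; first exact: smooth_alg_cst.
    apply: smooth_alg_mul; first exact: smooth_alg_cst.
    apply: smooth_alg_mul; first by apply: smooth_alg_mul; exact: smooth_alg_flatw lm.
    apply: smooth_alg_add; first exact: smooth_alg_flat lm.
    by apply: smooth_alg_mul; [exact: smooth_alg_cst|exact: smooth_alg_flat lm'].
  move=> q; rewrite !mulN1r -expr2.
  exact: is_derive_comp_affine (is_derive_flatw (l q)).
- split=> [q|v]; first by apply: continuousD; [exact: cf|exact: cg].
  have [f' nf' ff'] := df v; have [g' ng' gg'] := dg v.
  exists (fun q => f' q + g' q); first exact: smooth_alg_add.
  by move=> q; exact: is_deriveD (ff' q) (gg' q).
- split=> [q|v]; first by apply: continuousM; [exact: cf|exact: cg].
  have [f' nf' ff'] := df v; have [g' ng' gg'] := dg v.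
  exists (fun q => f q * g' q + g q * f' q).
    by apply: smooth_alg_add; exact: smooth_alg_mul.
  by move=> q; exact: is_deriveM (ff' q) (gg' q).
Qed.

Lemma smooth_alg_smooth f : smooth_alg f -> smooth f.
Proof.
move=> nf vs.
have H : smooth_alg (iter_derive vs f).
  elim: vs => //= v vs IH; have [_ /(_ v)[g ng dg]] := smooth_alg_derive IH.
  by have -> : 'D_v (iter_derive vs f) = g by apply/funext => q; case: (dg q).
have [c d] := smooth_alg_derive H; split=> // q v.
by have [g _ dg] := d v; case: (dg q).
Qed.

Lemma smooth_alg_sub f g : smooth_alg f -> smooth_alg g -> smooth_alg (fun q => f q - g q).
Proof.
move=> nf ng; have := smooth_alg_add nf (smooth_alg_mul (smooth_alg_cst (-1)) ng).
by under eq_fun do rewrite mulN1r.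
Qed.

Lemma smooth_alg_sum I (r : seq I) (F : I -> X -> R) :
  (forall i, smooth_alg (F i)) -> smooth_alg (fun q => \sum_(i <- r) F i q).
Proof.
move=> nF; elim: r => [|i r IH].
  by under eq_fun do rewrite big_nil; exact: smooth_alg_cst.
by under eq_fun do rewrite big_cons; exact: smooth_alg_add.
Qed.

Lemma smooth_alg_prod I (r : seq I) (F : I -> X -> R) :
  (forall i, smooth_alg (F i)) -> smooth_alg (fun q => \prod_(i <- r) F i q).
Proof.
move=> nF; elim: r => [|i r IH].
  by under eq_fun do rewrite big_nil; exact: smooth_alg_cst.
by under eq_fun do rewrite big_cons; exact: smooth_alg_mul.
Qed.

Lemma smooth_alg_sstep l m : affine_along l m -> smooth_alg (fun q => sstep (l q)).
Proof.
by move=> lm; apply: smooth_alg_mul; [exact: smooth_alg_flat lm|exact: smooth_alg_flatw lm].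
Qed.

Lemma affine_time (k c : R) : affine_along (fun q => k * q.2 + c) (fun v => k * v.2).
Proof.
split=> [q|h q v] /=; last by rewrite /GRing.scale/=; ring.
apply: cvgD; last exact: cvg_cst.
by apply: cvgM; [exact: cvg_cst|exact: cvg_snd].
Qed.

Lemma affine_coord i (k c : R) :
  affine_along (fun q => k * q.1 ord0 i + c) (fun v => k * v.1 ord0 i).
Proof.
split=> [q|h q v] /=; last by rewrite !mxE; ring.
apply: cvgD; last exact: cvg_cst.
apply: cvgM; first exact: cvg_cst.
apply: (@continuous_comp _ _ _ fst (fun x : 'rV[R]_N => x ord0 i)).
  exact: cvg_fst.
exact: coord_continuous.
Qed.

Lemma is_derive_time (f : 'rV[R]_N -> R) (a : R -> R) (da : R) (q : X) :
  is_derive q.2 1 a da ->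
  is_derive q (0, 1) (fun p : X => f p.1 * a p.2) (f q.1 * da).
Proof.
move=> [ad <-].
have e : (fun h : R => h^-1 *: (f (h *: (0, 1) + q).1 * a (h *: (0, 1) + q).2
    - f q.1 * a q.2)) = (fun h : R => f q.1 *: (h^-1 *: (a (h *: 1 + q.2) - a q.2))).
  apply/funext => h /=; rewrite scaler0 add0r -mulrBr /GRing.scale /=; ring.
have cv : (fun h : R => f q.1 *: (h^-1 *: (a (h *: 1 + q.2) - a q.2))) @ 0^' -->
    f q.1 *: 'D_1 a q.2 by apply: cvgZr; exact: ad.
apply: DeriveDef; first by apply/cvg_ex; exists (f q.1 *: 'D_1 a q.2); rewrite /= e.
by rewrite /derive /= e; exact: cvg_lim cv.
Qed.

End smooth_class.

Section time_cutoff.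
Context {R : realType}.
Implicit Types y t k s tau u : R.

(** The derivative of sstep, written so that its sign is visible. *)
Definition dsstep y : R :=
  flatw y * flatw y * (flat 2 y * flat 0 (1 - y) + flat 0 y * flat 2 (1 - y)).

Lemma is_derive_sstep y : is_derive y 1 sstep (dsstep y).
Proof.
have d1 : is_derive y (1 : R) (flat 0) (flat 2 y).
  by have := is_derive_flat 0 y; rewrite mul0r subr0.
have h := is_deriveM d1 (is_derive_flatw y).
apply: (@is_derive_eq _ _ _ _ _ _ _ _ h).
rewrite /dsstep /GRing.scale /= /flatw.
have := lt0r_neq0 (flatw_den_gt0 y).
set A := flat 0 y; set B := flat 0 (1 - y) => AB.
by field.
Qed.

Lemma dsstep_ge0 y : 0 <= dsstep y.
Proof. by rewrite mulr_ge0 -?expr2 ?sqr_ge0// addr_ge0// mulr_ge0 ?flat_ge0. Qed.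

Lemma dsstep0 y : y <= 0 -> dsstep y = 0.
Proof.
by move=> y0; rewrite /dsstep /flat ltNge y0/= !mul0r addr0 mulr0.
Qed.

Lemma dsstep1 y : 1 <= y -> dsstep y = 0.
Proof.
move=> y1; rewrite /dsstep ![flat _ (1 - y)]/flat !ifF; last 2 first.
- by apply/negbTE; rewrite -leNgt; lra.
- by apply/negbTE; rewrite -leNgt; lra.
by rewrite !mulr0 addr0 mulr0.
Qed.

Lemma dsstep_continuous : continuous dsstep.
Proof.
have cf j : continuous (@flat R j).
  by move=> y; exact: (is_derive_continuous (is_derive_flat j y)).
have cw : continuous (@flatw R).
  by move=> y; exact: (is_derive_continuous (is_derive_flatw y)).
have c1 j : continuous (fun y : R => flat j (1 - y)).
  move=> y; apply: (@continuous_comp _ _ _ (fun y => 1 - y) (flat j)); last exact: cf.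
  by apply: cvgB; [exact: cvg_cst|exact: cvg_id].
move=> y; rewrite /dsstep; apply: cvgM; first by apply: cvgM; exact: cw.
by apply: cvgD; apply: cvgM; do ?[exact: cf|exact: c1].
Qed.

(** The step of width 1/k that ends at t. Its derivative kern k t is supported in
    [t - 1/k, t] and tends to the Dirac mass at t from the left, the side from
    which distances to a superflow are continuous in time. *)
Definition ustep k t tau : R := sstep (k * (tau - t) + 1).
Definition kern k t tau : R := k * dsstep (k * (tau - t) + 1).
(** Tends to the indicator function of [s, t) as k grows. *)
Definition trap k s t tau : R := ustep k s tau - ustep k t tau.

Lemma is_derive_ustep k t tau : is_derive tau 1 (ustep k t) (kern k t tau).
Proof.
have h : is_derive tau (1 : R) (fun u => k * (u - t) + 1) k.
  have -> : (fun u => k * (u - t) + 1) = (fun u : R => k *: u + (1 - k * t)).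
    by apply/funext => u; rewrite /GRing.scale /=; ring.
  by apply: is_derive_eq; rewrite addr0 /GRing.scale/= mulr1.
have := @is_derive1_comp R sstep (fun u => k * (u - t) + 1) tau _ _ (is_derive_sstep _) h.
by rewrite mulrC.
Qed.

Lemma is_derive_trap k s t tau :
  is_derive tau 1 (trap k s t) (kern k s tau - kern k t tau).
Proof. exact: is_deriveB (is_derive_ustep k s tau) (is_derive_ustep k t tau). Qed.

Lemma kern_ge0 k t tau : 0 < k -> 0 <= kern k t tau.
Proof. by move=> k0; rewrite mulr_ge0 ?dsstep_ge0// ltW. Qed.

Lemma kern_continuous k t : continuous (kern k t).
Proof.
move=> u; apply: cvgM; first exact: cvg_cst.
apply: (@continuous_comp _ _ _ (fun u => k * (u - t) + 1) dsstep).
  apply: cvgD; last exact: cvg_cst.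
  apply: cvgM; first exact: cvg_cst.
  by apply: cvgB; [exact: cvg_id|exact: cvg_cst].
exact: dsstep_continuous.
Qed.

Lemma kern_out k t tau : 0 < k -> ~~ (t - k^-1 <= tau <= t) -> kern k t tau = 0.
Proof.
move=> k0; rewrite negb_and -!ltNge => /orP[h|h].
  rewrite /kern dsstep0 ?mulr0//.
  have : k * (tau - t) < k * (- k^-1) by rewrite ltr_pM2l//; lra.
  by rewrite mulrN mulfV ?gt_eqF//; lra.
rewrite /kern dsstep1 ?mulr0// lerDr mulr_ge0 ?subr_ge0 1?ltW//.
Qed.

Lemma kern_bounded k t : 0 < k -> exists B, forall tau, `|kern k t tau| <= B.
Proof.
move=> k0.
have /compact_bounded[M [_ HM]] := continuous_compact
  (continuous_subspaceT (@kern_continuous k t)) (@segment_compact R (t - k^-1) t).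
exists (`|M| + 1) => tau; have [h|h] := boolP (t - k^-1 <= tau <= t); last first.
  by rewrite kern_out// normr0 addr_ge0.
apply: HM; first by rewrite ltr_pwDr// ler_norm.
by exists tau => //=; rewrite in_itv.
Qed.

Lemma ustep1 k t tau : 0 < k -> t <= tau -> ustep k t tau = 1.
Proof. by move=> k0 h; rewrite /ustep sstep1// lerDr mulr_ge0 ?subr_ge0// ltW. Qed.

Lemma ustep0 k t tau : 0 < k -> tau <= t - k^-1 -> ustep k t tau = 0.
Proof.
move=> k0 h; rewrite /ustep sstep0//.
have : k * (tau - t) <= k * (- k^-1) by rewrite ler_pM2l//; lra.
by rewrite mulrN mulfV ?gt_eqF//; lra.
Qed.

Lemma trap_itv k s t tau : 0 < k -> s <= t -> 0 <= trap k s t tau <= 1.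
Proof.
move=> k0 st; rewrite /trap /ustep.
have := sstep_itv (k * (tau - s) + 1); have := sstep_itv (k * (tau - t) + 1).
have : sstep (k * (tau - t) + 1) <= sstep (k * (tau - s) + 1).
  by apply: sstep_mono; rewrite lerD2r ler_pM2l//; lra.
by move=> h /andP[h1 h2] /andP[h3 h4]; apply/andP; split; lra.
Qed.

Lemma trap_out k s t tau : 0 < k -> s <= t ->
  ~~ (s - k^-1 <= tau <= t) -> trap k s t tau = 0.
Proof.
move=> k0 st; rewrite negb_and -!ltNge => /orP[h|h].
  by rewrite /trap !ustep0 ?subrr//; lra.
by rewrite /trap !ustep1 ?subrr//; lra.
Qed.

Lemma trap_in k s t tau : 0 < k -> s <= tau <= t - k^-1 -> trap k s t tau = 1.
Proof. by move=> k0 /andP[h1 h2]; rewrite /trap ustep1// ustep0// subr0. Qed.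

Lemma ustep_continuous k t : continuous (ustep k t).
Proof. by move=> u; exact: (is_derive_continuous (is_derive_ustep k t u)). Qed.

Lemma trap_continuous k s t : continuous (trap k s t).
Proof. by move=> u; apply: cvgB; exact: ustep_continuous. Qed.

Lemma lebR_continuous_measurable (f : R -> R) :
  continuous f -> measurable_fun setT f.
Proof. exact: continuous_measurable_fun. Qed.

(** lebR and lebesgue_measure are the same set function on two copies of R, whose
    measurable structures have different displays; the identity between the two
    copies transports the integral. *)
Lemma integral_lebR (D : set R) (f : R -> \bar R) :
  measurable D -> measurable_fun D f -> (forall x, D x -> 0 <= f x)%E ->
  (\int[@lebR R]_(x in D) f x = \int[@lebesgue_measure R]_(x in D) f x)%E.
Proof.
move=> mD mf f0.
have mid : measurable_fun (setT : set (measurableTypeR R)) (id : measurableTypeR R -> R).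
  by move=> _ Y mY; rewrite setTI.
transitivity (
  \int[pushforward (@lebesgue_measure R) (id : measurableTypeR R -> R)]_(x in D) f x)%E.
  exact: eq_measure_integral.
rewrite ge0_integral_pushforward//.
by move=> y /[!inE]; exact: f0.
Qed.

Lemma integral_kern k t : 0 < k -> (\int[@lebR R]_u (kern k t u)%:E = 1)%E.
Proof.
move=> k0; have k'0 : 0 < k^-1 by rewrite invr_gt0.
have [a ak] : exists a, a = t - k^-1 by exists (t - k^-1).
have lt' : a < t by rewrite ak; lra.
have -> : (\int[@lebR R]_u (kern k t u)%:E =
    \int[@lebR R]_(u in `[a, t]) (kern k t u)%:E)%E.
  rewrite [RHS]integral_mkcond; apply: eq_integral => u _.
  rewrite patchE; case: ifPn => //; rewrite notin_setE/= in_itv/= => /negP h.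
  by rewrite kern_out// -ak.
rewrite integral_lebR//; last 2 first.
- apply: measurable_funTS; apply/measurable_EFinP.
  by apply: lebR_continuous_measurable; exact: kern_continuous.
- by move=> u _; rewrite lee_fin kern_ge0.
rewrite (@continuous_FTC2 _ (kern k t) (ustep k t))//.
- by rewrite ustep1// ustep0 ?ak// sube0.
- by apply: continuous_subspaceT; exact: kern_continuous.
- split.
  + by move=> u _; case: (is_derive_ustep k t u).
  + by apply: cvg_at_right_filter; exact: ustep_continuous.
  + by apply: cvg_at_left_filter; exact: ustep_continuous.
- by move=> u _; rewrite derive1E; case: (is_derive_ustep k t u).
Qed.

Lemma lebR_itv (a b : R) : @lebR R `[a, b] = (Num.max 0 (b - a))%:E.
Proof.
rewrite /lebR lebesgue_measure_itv/= lte_fin; case: ltP => ab.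
  by rewrite -EFinD (max_idPr _)// subr_ge0 ltW.
by rewrite (max_idPl _)// subr_le0.
Qed.

Lemma integrable_lebR_itv (a b : R) : (@lebR R).-integrable setT (EFin \o \1_`[a, b]).
Proof.
apply: integrable_indic_lty; first exact: measurable_itv.
by rewrite [ltLHS](lebR_itv a b) ltry.
Qed.

Lemma trap_integrable k s t : 0 < k -> s <= t ->
  (@lebR R).-integrable setT (EFin \o trap k s t).
Proof.
move=> k0 st; apply: (le_integrable _ _ _ (integrable_lebR_itv (s - k^-1) t)) => //.
  by apply/measurable_EFinP; apply: lebR_continuous_measurable; exact: trap_continuous.
move=> u _ /=; rewrite lee_fin; have /andP[h1 h2] := trap_itv u k0 st.
rewrite ger0_norm// ger0_norm// indicE mem_setE in_itv/=.
by case: (boolP (s - k^-1 <= u <= t)) => // /(trap_out k0 st) ->.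
Qed.

Lemma integral_trap k s t : 0 < k -> s <= t ->
  t - s - k^-1 <= \int[@lebR R]_u trap k s t u <= t - s + k^-1.
Proof.
move=> k0 st; have k'0 : 0 < k^-1 by rewrite invr_gt0.
have ii := integrable_lebR_itv; have ti := trap_integrable k0 st.
have vi (a b : R) : \int[@lebR R]_u (\1_`[a, b] u : R) = Num.max 0 (b - a).
  by rewrite /Rintegral integral_indic// setIT [X in fine X](lebR_itv a b).
apply/andP; split.
  apply: (@le_trans _ _ (\int[@lebR R]_u (\1_`[s, t - k^-1] u : R))).
    by rewrite vi le_max; apply/orP; right; lra.
  apply: le_Rintegral => // u _; rewrite indicE mem_setE in_itv/=.
  case: (boolP (s <= u <= t - k^-1)) => [/(trap_in k0) -> //|_].
  by have /andP[] := trap_itv u k0 st.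
apply: (@le_trans _ _ (\int[@lebR R]_u (\1_`[s - k^-1, t] u : R))); last first.
  by rewrite vi ge_max; apply/andP; split; lra.
apply: le_Rintegral => // u _; rewrite indicE mem_setE in_itv/=.
have /andP[h1 h2] := trap_itv u k0 st.
by case: (boolP (s - k^-1 <= u <= t)) => // /(trap_out k0 st) ->.
Qed.

End time_cutoff.

(** * Smooth approximation of Lipschitz functions *)

Section partition_of_unity.
Context {R : realType} {N : nat}.
Local Notation X := ('rV[R]_N * R)%type.
Implicit Types (x : 'rV[R]_N) (k : R) (m : nat).

(** Integer translates of hat add up to 1, because the sum telescopes. *)
Definition hat (y : R) : R := sstep (y + 1) - sstep y.

Lemma hat_ge0 y : 0 <= hat y.
Proof. by rewrite subr_ge0 sstep_mono// lerDl. Qed.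

Lemma hat_out y : 1 <= `|y| -> hat y = 0.
Proof.
rewrite ler_normr => /orP[y1|y1]; rewrite /hat.
  by rewrite !sstep1 ?subrr//; lra.
by rewrite !sstep0 ?subrr//; lra.
Qed.

Definition node m (j : 'I_(m.*2.+1)) : R := j%:R - m%:R.

Lemma sum_hat m (y : R) : `|y| <= m%:R -> \sum_(j < m.*2.+1) hat (y - node j) = 1.
Proof.
move=> ym; pose u (j : nat) : R := - sstep (y - j%:R + m%:R + 1).
rewrite -(big_mkord xpredT (fun j : nat => hat (y - (j%:R - m%:R)))).
rewrite (telescope_sumr_eq u)//; last first.
  move=> j _; rewrite /hat /u opprK addrC -natr1; congr (- sstep _ + sstep _); lra.
have m2 : m.*2.+1%:R = 2 * m%:R + 1 :> R by rewrite -muln2 -natr1 natrM mulrC.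
move: ym; rewrite ler_norml => /andP[h1 h2].
by rewrite /u opprK subr0 sstep0 ?sstep1 ?oppr0 ?add0r// ?m2; lra.
Qed.

Definition gnode k m (J : {ffun 'I_N -> 'I_(m.*2.+1)}) : 'rV[R]_N :=
  \row_i (k^-1 * node (J i)).

Definition gweight k m (J : {ffun 'I_N -> 'I_(m.*2.+1)}) x : R :=
  \prod_(i < N) hat (k * x ord0 i - node (J i)).

(** The interpolation of g on a grid of mesh 1/k given by the partition of unity
    made of products of hats. *)
Definition gsmooth k m (g : 'rV[R]_N -> R) x : R :=
  \sum_(J : {ffun 'I_N -> 'I_(m.*2.+1)}) g (gnode k J) * gweight k J x.

Lemma gweight_ge0 k m (J : {ffun 'I_N -> 'I_(m.*2.+1)}) x : 0 <= gweight k J x.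
Proof. by apply: prodr_ge0 => i _; exact: hat_ge0. Qed.

Lemma gweight_sum k m x : 0 < k -> `|x| <= k^-1 * m%:R ->
  \sum_(J : {ffun 'I_N -> 'I_(m.*2.+1)}) gweight k J x = 1.
Proof.
move=> k0 xm; rewrite /gweight.
rewrite -(bigA_distr_bigA (fun i j => hat (k * x ord0 i - node j))).
rewrite big1// => i _; apply: sum_hat.
rewrite normrM (gtr0_norm k0).
apply: (@le_trans _ _ (k * `|x|)); first by rewrite ler_pM2l// coord_le_norm.
by rewrite -ler_pdivlMl.
Qed.

Lemma gweight_neq0 k m (J : {ffun 'I_N -> 'I_(m.*2.+1)}) x : 0 < k ->
  gweight k J x != 0 -> `|x - gnode k J| <= k^-1.
Proof.
move=> k0 /prodf_neq0 H; apply: norm_le_bound => [|i].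
  by rewrite invr_ge0 ltW.
have := H i isT; rewrite !mxE => {}H.
have : `|k * x ord0 i - node (J i)| < 1.
  by rewrite ltNge; apply: contra H => /hat_out ->.
have -> : k * x ord0 i - node (J i) = k * (x ord0 i - k^-1 * node (J i)).
  by rewrite mulrBr mulrA mulfV ?gt_eqF// mul1r.
by rewrite normrM (gtr0_norm k0) -ltr_pdivlMl// mulr1 => /ltW.
Qed.

Lemma smooth_alg_gsmooth k m g (a : R -> R) : smooth_alg (fun q : X => a q.2) ->
  smooth_alg (fun q : X => gsmooth k m g q.1 * a q.2).
Proof.
move=> na; apply: smooth_alg_mul => //; apply: smooth_alg_sum => J.
apply: smooth_alg_mul; first exact: smooth_alg_cst.
apply: smooth_alg_prod => i; apply: smooth_alg_sub.
  under eq_fun do rewrite -addrA [- _ + 1]addrC.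
  exact: smooth_alg_sstep (affine_coord i k (1 - node (J i))).
exact: smooth_alg_sstep (affine_coord i k (- node (J i))).
Qed.

Lemma smooth_alg_trap k s t : smooth_alg (fun q : X => trap k s t q.2).
Proof.
have ns c : smooth_alg (fun q : X => ustep k c q.2).
  rewrite /ustep; under eq_fun do rewrite mulrBr -addrA.
  exact: smooth_alg_sstep (affine_time k (- (k * c) + 1)).
exact: smooth_alg_sub.
Qed.

Lemma gsmooth_continuous k m g : continuous (gsmooth k m g).
Proof.
have h := (smooth_alg_derive (@smooth_alg_gsmooth k m g (fun=> 1) (smooth_alg_cst 1))).1.
have -> : gsmooth k m g = (fun q : X => gsmooth k m g q.1 * 1) \o (fun x => (x, 0)).
  by apply/funext => x /=; rewrite mulr1.
move=> x; apply: continuous_comp; last exact: h.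
exact: (@cvg_pair _ _ _ (nbhs x) (nbhs x) (nbhs (0 : R)) _ _ _ id (fun=> 0)
  cvg_id (cvg_cst 0)).
Qed.

(** On the support of the weight of a node, g differs from its value at the node by
    at most its Lipschitz constant times the diameter of the cell. Since the
    weights add up to 1 near the support of g, so does the interpolation. *)
Lemma smooth_approx (g : 'rV[R]_N -> R) (L B e : R) : 0 < e ->
  elip L g -> (forall x, 0 <= g x) -> (forall x, g x != 0 -> `|x| <= B) ->
  exists G : 'rV[R]_N -> R,
    [/\ forall a : R -> R, smooth_alg (fun q : X => a q.2) ->
          smooth_alg (fun q : X => G q.1 * a q.2),
        continuous G, forall x, 0 <= G x, forall x, `|G x - g x| <= e &
        forall x, G x != 0 -> exists2 y, g y != 0 & `|x - y| <= e].
Proof.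
move=> e0 Lg g0 gB.
(* k is large enough for the cells to have diameter at most e and for g to vary by
   at most e on a cell. *)
have [k k0 [ke kL]] : exists2 k : R, 0 < k & k^-1 <= e /\ `|L| * (N%:R * k^-1) <= e.
  exists (e^-1 * (1 + `|L| * N%:R)).
    by rewrite mulr_gt0 ?invr_gt0// ltr_pwDl// mulr_ge0.
  have p0 : 0 < 1 + `|L| * N%:R by rewrite ltr_pwDl// mulr_ge0.
  have LN : 0 <= `|L| * N%:R by rewrite mulr_ge0.
  rewrite invfM invrK; split.
    by rewrite ler_pdivrMr// -[leLHS]mulr1 ler_pM2l// lerDl.
  by rewrite !mulrA ler_pdivrMr// [leLHS]mulrC ler_pM2l// lerDr.
pose m := (Num.truncn (k * (`|B| + e))).+1.
have mB : `|B| + e <= k^-1 * m%:R.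
  by rewrite ler_pdivlMl// ltW// truncnS_gt.
have near x J : gweight k J x != 0 -> `|g (@gnode k m J) - g x| <= e.
  move=> /(gweight_neq0 k0) h.
  have hn (u v : 'rV[R]_N) : `|u - v| <= k^-1 -> g u - g v <= e.
    move=> uv; apply: (le_trans (Lg u v)); apply: le_trans kL.
    apply: (@le_trans _ _ (`|L| * enorm (u - v))).
      by rewrite ler_wpM2r ?enorm_ge0// ler_norm.
    rewrite ler_wpM2l//; apply: (le_trans (enorm_le_norm _)).
    by rewrite ler_wpM2l.
  rewrite ler_norml (hn (gnode k J) x) ?andbT 1?distrC//.
  by have := hn _ _ h; lra.
exists (gsmooth k m g); split.
- by move=> a; exact: smooth_alg_gsmooth.
- exact: gsmooth_continuous.
- by move=> x; apply: sumr_ge0 => J _; rewrite mulr_ge0// gweight_ge0.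
- move=> x; have [xm|xm] := leP `|x| (k^-1 * m%:R).
    rewrite -[g x]mulr1 -(gweight_sum k0 xm) mulr_sumr -sumrB.
    apply: (le_trans (ler_norm_sum _ _ _)).
    rewrite -[leRHS]mulr1 -(gweight_sum k0 xm) mulr_sumr; apply: ler_sum => J _.
    rewrite -mulrBl normrM (ger0_norm (gweight_ge0 _ _ _)).
    have [->|wn] := eqVneq (gweight k J x) 0; first by rewrite !mulr0.
    by rewrite ler_wpM2r ?gweight_ge0// near.
  have gx : g x = 0.
    apply/eqP/negPn/negP => /gB xB; have := ler_norm B; lra.
  rewrite gx subr0 /gsmooth big1 ?normr0 ?ltW// => J _.
  have [->|wn] := eqVneq (gweight k J x) 0; first by rewrite mulr0.
  have [->|gn] := eqVneq (g (gnode k J)) 0; first by rewrite mul0r.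
  have := gB _ gn; have := gweight_neq0 k0 wn => h1 h2.
  have : `|x| <= `|x - gnode k J| + `|gnode k J|.
    by rewrite -{1}(subrK (gnode k J) x) ler_normD.
  have := ler_norm B; lra.
- move=> x; rewrite /gsmooth => /eqP h; apply: contrapT => H; apply: h.
  apply: big1 => J _; have [->|wn] := eqVneq (gweight k J x) 0; first by rewrite mulr0.
  have [->|gn] := eqVneq (g (gnode k J)) 0; first by rewrite mul0r.
  exfalso; apply: H; exists (gnode k J) => //.
  exact: le_trans (gweight_neq0 k0 wn) ke.
Qed.

End partition_of_unity.

(** * Oscillation in a ball and its calibrations *)

Section oscillation.
Context {R : realType} {N : nat}.
Implicit Types (w x y : 'rV[R]_N) (f g : 'rV[R]_N -> R).

(** Closed balls make the supremum attained; for continuous functions it agrees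
    with the essential supremum over the open ball. *)
Definition supB (r : R) w f : R := sup [set f (w + x) | x in closure (eball 0 r)].

Definition oscB (r : R) w f : R := supB r w f + supB r w (fun x => - f x).

Variables (r : R) (r0 : 0 < r).

Lemma supB_ub L f w x : elip L f -> closure (eball 0 r) x -> f (w + x) <= supB r w f.
Proof.
move=> Lf Bx; apply: ub_le_sup; last by exists x.
exists (f w + `|L| * r) => _ [y By <-].
have h := Lf (w + y) w.
have wy : w + y - w = y by rewrite addrC addKr.
rewrite wy in h.
have : L * enorm y <= `|L| * r.
  apply: (@le_trans _ _ (`|L| * enorm y)).
    by rewrite ler_wpM2r ?enorm_ge0// ler_norm.
  by rewrite ler_wpM2l// closure_eball.
by lra.
Qed.

Lemma supB_le f w c : (forall x, closure (eball 0 r) x -> f (w + x) <= c) ->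
  supB r w f <= c.
Proof.
move=> H; apply: ge_sup; first by exists (f (w + 0)), 0 => //; exact: closure_eball0.
by move=> _ [x Bx <-]; exact: H.
Qed.

Lemma oscB_ge L f w x y : elip L f -> closure (eball 0 r) x ->
  closure (eball 0 r) y -> f (w + x) - f (w + y) <= oscB r w f.
Proof.
move=> Lf Bx By; have := supB_ub w Lf Bx; have := supB_ub w (elipN Lf) By.
by rewrite /oscB; lra.
Qed.

Lemma oscB_ge0 L f w : elip L f -> 0 <= oscB r w f.
Proof.
move=> Lf; have := oscB_ge w Lf (closure_eball0 r0) (closure_eball0 r0).
by rewrite subrr.
Qed.

Lemma supB_perturb L f g w e : elip L g ->
  (forall x, closure (eball 0 r) x -> f (w + x) <= g (w + x) + e) ->
  supB r w f <= supB r w g + e.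
Proof.
move=> Lg H; apply: supB_le => x Bx; have := supB_ub w Lg Bx.
by have := H x Bx; lra.
Qed.

Lemma oscB_perturb L f g w e : elip L g ->
  (forall x, closure (eball 0 r) x -> `|f (w + x) - g (w + x)| <= e) ->
  oscB r w f <= oscB r w g + 2 * e.
Proof.
move=> Lg H.
have h1 : supB r w f <= supB r w g + e.
  apply: supB_perturb Lg _ => x /H; rewrite ler_norml => /andP[]; lra.
have h2 : supB r w (fun x => - f x) <= supB r w (fun x => - g x) + e.
  apply: (supB_perturb (elipN Lg)) => x /H; rewrite ler_norml => /andP[]; lra.
by rewrite /oscB; lra.
Qed.

Lemma elip_supB L f : elip L f -> elip L (fun w => supB r w f).
Proof.
move=> Lf w w'; rewrite lerBlDl; apply: supB_le => x Bx.
have := supB_ub w' Lf Bx; have := Lf (w + x) (w' + x).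
have -> : w + x - (w' + x) = w - w' by rewrite opprD addrACA subrr addr0.
by lra.
Qed.

Lemma elip_oscB L f : elip L f -> elip (L + L) (fun w => oscB r w f).
Proof. by move=> Lf; exact: elipD (elip_supB Lf) (elip_supB (elipN Lf)). Qed.

(** Over any set, the supremum of a maximum is the maximum of the suprema, while
    the supremum of a minimum is at most the minimum of the suprema. This lattice
    property is what makes the flow satisfy a comparison principle. *)
Lemma oscB_submodular L f g w : elip L f -> elip L g ->
  oscB r w (fun x => Num.max (f x) (g x)) + oscB r w (fun x => Num.min (f x) (g x))
  <= oscB r w f + oscB r w g.
Proof.
have supmaxmin (u v : 'rV[R]_N -> R) : elip L u -> elip L v ->
    supB r w (fun x => Num.max (u x) (v x)) + supB r w (fun x => Num.min (u x) (v x))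
    <= supB r w u + supB r w v.
  move=> Lu Lv.
  have h1 : supB r w (fun x => Num.max (u x) (v x)) <= Num.max (supB r w u) (supB r w v).
    apply: supB_le => x Bx; rewrite ge_max !le_max.
    by rewrite (supB_ub w Lu Bx) (supB_ub w Lv Bx) orbT.
  have h2 : supB r w (fun x => Num.min (u x) (v x)) <= Num.min (supB r w u) (supB r w v).
    apply: supB_le => x Bx; rewrite le_min !ge_min.
    by rewrite (supB_ub w Lu Bx) (supB_ub w Lv Bx) orbT.
  by apply: (le_trans (lerD h1 h2)); rewrite addr_max_min.
move=> Lf Lg; have h1 := supmaxmin _ _ Lf Lg.
have h2 := supmaxmin _ _ (elipN Lf) (elipN Lg).
have e1 : (fun x => - Num.max (f x) (g x)) = (fun x => Num.min (- f x) (- g x)).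
  by apply/funext => x; rewrite oppr_max.
have e2 : (fun x => - Num.min (f x) (g x)) = (fun x => Num.max (- f x) (- g x)).
  by apply/funext => x; rewrite oppr_min.
by rewrite /oscB e1 e2; lra.
Qed.

(** Both max (f, a) and f - max (f, a) are nondecreasing functions of f, so they
    are extremal at the same points and their oscillations add up. *)
Lemma oscB_trunc L f w a : elip L f ->
  oscB r w (fun x => Num.max (f x) a) + oscB r w (fun x => f x - Num.max (f x) a)
  <= oscB r w f.
Proof.
move=> Lf.
have h1 : supB r w (fun x => Num.max (f x) a) <= Num.max (supB r w f) a.
  apply: supB_le => x Bx; rewrite ge_max !le_max lexx orbT andbT.
  by rewrite (supB_ub w Lf Bx).
have h2 : supB r w (fun x => f x - Num.max (f x) a) <= supB r w f - Num.max (supB r w f) a.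
  apply: supB_le => x Bx; have := supB_ub w Lf Bx.
  rewrite /Num.max; case: ltP => ?; case: ltP => ?; lra.
have h3 : supB r w (fun x => - Num.max (f x) a) <=
    - Num.max (- supB r w (fun x => - f x)) a.
  apply: supB_le => x Bx; have := supB_ub w (elipN Lf) Bx.
  rewrite /Num.max; case: ltP => ?; case: ltP => ?; lra.
have h4 : supB r w (fun x => - (f x - Num.max (f x) a)) <=
    supB r w (fun x => - f x) + Num.max (- supB r w (fun x => - f x)) a.
  apply: supB_le => x Bx; have := supB_ub w (elipN Lf) Bx.
  rewrite /Num.max; case: ltP => ?; case: ltP => ?; lra.
by rewrite /oscB; lra.
Qed.

End oscillation.

Section pairing.
Context {R : realType} {N : nat}.
Implicit Types (w x y : 'rV[R]_N) (f g : 'rV[R]_N -> R).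
Variables (r : R) (r0 : 0 < r) (m : {measure set ('rV[R]_N * 'rV[R]_N) -> \bar R}).
Hypothesis m1 : (m (@Cr R N r) <= 1)%E.

(** The pairing of a field of measures with f at w; the nonlocal divergence
    integrates it, up to the factor -1/(2r), over w and t. *)
Definition pairing w f : R := \int[m]_(xy in @Cr R N r) (f (w + xy.1) - f (w + xy.2)).

Lemma measurable_Cr : measurable (@Cr R N r).
Proof.
have mB : measurable (closure (eball (0 : 'rV[R]_N) r)).
  by apply: rV_closed_measurable; exact: closed_closure.
exact: measurableX.
Qed.

Lemma pairing_measurable w f : continuous f ->
  measurable_fun setT (fun xy : 'rV[R]_N * 'rV[R]_N => f (w + xy.1) - f (w + xy.2)).
Proof.
move=> cf; have mf : measurable_fun setT (fun x => f (w + x)).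
  apply: rV_continuous_measurable => x.
  apply: (@continuous_comp _ _ _ (fun x => w + x) f); last exact: cf.
  by apply: (@cvgD _ _ _ (nbhs x)); [exact: cvg_cst|exact: cvg_id].
apply: measurable_funB.
  exact: (measurableT_comp mf measurable_fst).
exact: (measurableT_comp mf measurable_snd).
Qed.

Lemma continuous_bounded_ball w f : continuous f ->
  exists M, forall x, closure (eball 0 r) x -> `|f (w + x)| <= M.
Proof.
move=> cf; pose g x := f (w + x).
have cg : continuous g.
  move=> x; apply: (@continuous_comp _ _ _ (fun x => w + x) f); last exact: cf.
  by apply: (@cvgD _ _ _ (nbhs x)); [exact: cvg_cst|exact: cvg_id].
have /compact_bounded[M [_ HM]] := continuous_compact (continuous_subspaceT cg)
  (@compact_closure_eball R N r).
exists (M + 1) => x Bx; apply: (HM (M + 1)); first by rewrite ltrDl.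
by exists x.
Qed.

Lemma pairing_integrable w f : continuous f ->
  m.-integrable (@Cr R N r) (EFin \o (fun xy => f (w + xy.1) - f (w + xy.2))).
Proof.
move=> cf; have [M HM] := continuous_bounded_ball w cf.
apply: (@integrable_bounded _ _ _ _ _ _ (M + M)).
- exact: measurable_Cr.
- by apply: (le_lt_trans m1); rewrite ltry.
- exact: pairing_measurable.
- move=> [x y] [/= Bx By]; apply: (le_trans (ler_normB _ _)).
  by rewrite lerD ?HM.
Qed.

Lemma pairingD w f g : continuous f -> continuous g ->
  pairing w (fun x => f x + g x) = pairing w f + pairing w g.
Proof.
move=> cf cg; rewrite /pairing -RintegralD//.
- by apply: eq_Rintegral => xy _; rewrite /=; lra.
- exact: measurable_Cr.
- exact: pairing_integrable.
- exact: pairing_integrable.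
Qed.

Lemma pairingN w f : continuous f -> pairing w (fun x => - f x) = - pairing w f.
Proof.
move=> cf; rewrite /pairing -mulN1r -RintegralZl//.
- by apply: eq_Rintegral => xy _; rewrite /=; lra.
- exact: measurable_Cr.
- exact: pairing_integrable.
Qed.

Lemma pairing_le w f c : continuous f -> 0 <= c ->
  (forall x y, closure (eball 0 r) x -> closure (eball 0 r) y ->
    f (w + x) - f (w + y) <= c) -> pairing w f <= c.
Proof.
move=> cf c0 H; have mC := measurable_Cr.
have fC : (m (@Cr R N r) < +oo)%E by apply: (le_lt_trans m1); rewrite ltry.
apply: (@le_trans _ _ (\int[m]_(xy in @Cr R N r) c)).
  apply: le_Rintegral => //.
  - exact: pairing_integrable.
  - by apply: (@integrable_bounded _ _ _ _ _ _ `|c|).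
  - by move=> [x y] [/= Bx By]; exact: H.
rewrite Rintegral_cst//.
rewrite -[leRHS]mulr1 ler_wpM2l//.
by rewrite -lee_fin fineK// ge0_fin_numE.
Qed.

Lemma pairing_abs_le w f c : continuous f -> 0 <= c ->
  (forall x, closure (eball 0 r) x -> `|f (w + x)| <= c) -> `|pairing w f| <= 2 * c.
Proof.
move=> cf c0 H.
have K g : continuous g -> (forall x, closure (eball 0 r) x -> `|g (w + x)| <= c) ->
    pairing w g <= 2 * c.
  move=> cg Hg; apply: pairing_le => //; first by rewrite mulr_ge0.
  move=> x y /Hg + /Hg; rewrite !ler_norml => /andP[? ?] /andP[? ?]; lra.
rewrite ler_norml K// andbT.
have := K (fun x => - f x); rewrite pairingN// => h.
rewrite lerNl; apply: h; first by move=> x; apply: (@cvgN _ _ _ (nbhs x)); exact: cf.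
by move=> x /H; rewrite normrN.
Qed.

Lemma pairing_le_oscB L w f : elip L f -> pairing w f <= oscB r w f.
Proof.
move=> Lf; apply: pairing_le; first exact: elip_continuous Lf.
  exact: oscB_ge0 Lf.
by move=> x y; exact: oscB_ge Lf.
Qed.

(** A value in the closed ball above the essential supremum would, by continuity,
    be exceeded on a nonempty open subset of the open ball, and such a set has
    positive measure. *)
Lemma oscB_le_osc L w f : elip L f -> ((oscB r w f)%:E <= osc (eball w r) f)%E.
Proof.
move=> Lf.
have sup_le (g : 'rV[R]_N -> R) : elip L g ->
    ((supB r w g)%:E <= ess_sup (lebN R N) (patch (fun=> -oo) (eball w r) (EFin \o g)))%E.
  move=> Lg; set S := ess_sup _ _.
  have H x : closure (eball 0 r) x -> ((g (w + x))%:E <= S)%E.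
    move=> Bx; rewrite leNgt; apply/negP => Slt.
    have [c [Sc cg]] : exists c : R, (S <= c%:E)%E /\ c < g (w + x).
      move: Slt; case: (S) => [s| |]; rewrite ?lte_fin => sl.
      - by exists s.
      - by [].
      - by exists (g (w + x) - 1); split; [rewrite leNye|lra].
    pose U := [set y | c < g y] `&` eball w r.
    have oU : open U.
      apply: openI; last exact: open_eball.
      apply: (@open_comp _ _ g [set t | c < t]); last exact: open_gt.
      by move=> z _; exact: (elip_continuous Lg).
    have [y Uy] : U !=set0.
      pose V := [set z | c < g (w + z)].
      have oV : open V.
        apply: (@open_comp _ _ (fun z => g (w + z)) [set t | c < t]); last exact: open_gt.
        move=> z _; apply: (@elip_continuous _ _ L) => u v.
        have := Lg (w + u) (w + v).
        by rewrite opprD addrACA subrr add0r.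
      have /Bx[z [zB Vz]] : nbhs x V by apply: open_nbhs_nbhs.
      exists (w + z); split => //=; move: zB.
      by rewrite /eball/= subr0 addrC addKr.
    have [Z [mZ Z0 ZH]] := ess_sup_ge (lebN R N) (patch (fun=> -oo) (eball w r) (EFin \o g))%E.
    have : (lebN R N U <= lebN R N Z)%E.
      apply: le_measure; rewrite ?inE//; first exact: rV_open_measurable.
      move=> u [cu wu]; apply: ZH => /=; rewrite /patch mem_set//= => h.
      have := le_trans h Sc; rewrite lee_fin leNgt.
      by move: cu; rewrite /= => ->.
    rewrite Z0 => /(lt_le_trans (lebN_open_gt0 oU Uy)).
    by rewrite ltxx.
  have H0 := H _ (closure_eball0 r0).
  move: H H0; case: (S) => [s| |] H H0 //; last by rewrite leey.
  by rewrite lee_fin; exact: supB_le.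
rewrite /osc /oscB EFinD; apply: leeD; first exact: sup_le.
rewrite ess_infEN oppeK; apply: (le_trans (sup_le _ (elipN Lf))).
apply: le_ess_sup; apply: nearW => x; rewrite /patch /=.
by case: ifPn.
Qed.

Variables (d : 'rV[R]_N -> R) (w : 'rV[R]_N).
Hypothesis Ld : elip 1 d.
Hypothesis pd : (\int[m]_(xy in @Cr R N r) (d (w + xy.1) - d (w + xy.2))%:E =
  osc (eball w r) d)%E.

Lemma pairing_ge_oscB : oscB r w d <= pairing w d.
Proof.
have fi : (\int[m]_(xy in @Cr R N r) (d (w + xy.1) - d (w + xy.2))%:E)%E \is a fin_num.
  apply: integrable_fin_num; first exact: measurable_Cr.
  exact: pairing_integrable (elip_continuous Ld).
by rewrite -lee_fin /pairing /Rintegral fineK// pd; exact: oscB_le_osc Ld.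
Qed.

(** Let t be the truncation of d. Then g = (t + g) + (d - t) - d, where the
    pairings of the first two terms are at most their oscillations and that of d
    equals its oscillation. The oscillation of d splits into those of t and d - t,
    hence the field pairs with g as if it belonged to t. *)
Lemma pairing_gain L g a : elip L g ->
  pairing w g <= oscB r w (fun x => Num.max (d x) a + g x) -
                 oscB r w (fun x => Num.max (d x) a).
Proof.
move=> Lg; pose t x := Num.max (d x) a.
have Lt : elip 1 t by apply: elip_max => //; exact: elip_weak (elip_cst a).
have Lu : elip (1 + 1) (fun x => d x - t x) by exact: elipD Ld (elipN Lt).
have Ls : elip (1 + L) (fun x => t x + g x) by exact: elipD Lt Lg.
have cc L' f : elip L' f -> continuous f by exact: elip_continuous.
have e : pairing w (fun x => t x + g x) + pairing w (fun x => d x - t x) =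
    pairing w d + pairing w g.
  rewrite -!pairingD; do ?[exact: cc Ls|exact: cc Lu|exact: cc Ld|exact: cc Lg].
  by congr (pairing w _); apply/funext => x; lra.
have h1 := pairing_le_oscB w Ls; have h2 := pairing_le_oscB w Lu.
have h3 := pairing_ge_oscB; have h4 := oscB_trunc r0 w a Ld.
by rewrite -/t in h4 *; lra.
Qed.

End pairing.

(** * Lebesgue measure on space-time *)

Section spacetime_measure.
Context {R : realType} {N : nat}.
Local Notation X := ('rV[R]_N * R)%type.

Lemma lebN_bounded_lty (A : set 'rV[R]_N) (c : R) : measurable A ->
  (forall x, A x -> enorm x <= c) -> (lebN R N A < +oo)%E.
Proof.
move=> mA Ac; pose e := `|c| + 1.
pose a : 'rV[R]_N := \row_i (- e); pose b : 'rV[R]_N := \row_i e.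
have e0 : 0 <= e by rewrite addr_ge0.
pose B := [set y : 'rV[R]_N | forall i, a ord0 i < y ord0 i <= b ord0 i].
have mB : measurable B by exact: measurable_rV_box.
apply: (@le_lt_trans _ _ (lebN R N B)).
  apply: le_measure; rewrite ?inE// => x /Ac xc i; rewrite !mxE.
  have := coord_le_enorm x i; have := ler_norm c.
  rewrite ler_norml /e => h1 /andP[h2 h3]; apply/andP; split; lra.
by rewrite lebN_box ?ltry// => i; rewrite !mxE; lra.
Qed.

Lemma integral_prod (f : 'rV[R]_N -> R) (a : R -> R) :
  measurable_fun setT f -> measurable_fun setT a ->
  (forall x, 0 <= f x) -> (forall t, 0 <= a t) ->
  (\int[lebST R N]_q (f q.1 * a q.2)%:E =
   (\int[lebN R N]_x (f x)%:E) * (\int[@lebR R]_t (a t)%:E))%E.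
Proof.
move=> mf ma f0 a0.
have mfa : measurable_fun setT (fun q : X => (f q.1 * a q.2)%:E).
  apply/measurable_EFinP; apply: measurable_funM.
    exact: (measurableT_comp mf measurable_fst).
  exact: (measurableT_comp ma measurable_snd).
rewrite fubini_tonelli1//; last by move=> q; rewrite lee_fin mulr_ge0.
rewrite /fubini_F /=.
have ia0 : (0 <= \int[@lebR R]_t (a t)%:E)%E.
  by apply: integral_ge0 => t _; rewrite lee_fin.
rewrite -ge0_integralZr//; last 2 first.
- exact/measurable_EFinP.
- by move=> x _; rewrite lee_fin.
apply: eq_integral => x _.
under eq_integral do rewrite EFinM.
rewrite ge0_integralZl//; first exact/measurable_EFinP.
- by move=> t _; rewrite lee_fin.
- by rewrite lee_fin.
Qed.

Lemma integrable_prod (f : 'rV[R]_N -> R) (a : R -> R) :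
  measurable_fun setT a -> (forall x, 0 <= f x) -> (forall t, 0 <= a t) ->
  (lebN R N).-integrable setT (EFin \o f) -> (@lebR R).-integrable setT (EFin \o a) ->
  (lebST R N).-integrable setT (fun q : X => (f q.1 * a q.2)%:E) /\
  \int[lebST R N]_q (f q.1 * a q.2) =
  (\int[lebN R N]_x f x) * (\int[@lebR R]_t a t).
Proof.
move=> ma f0 a0 fi ai.
have mf : measurable_fun setT f.
  by apply/measurable_EFinP; exact: measurable_int fi.
have e := integral_prod mf ma f0 a0.
have ff : (\int[lebN R N]_x (f x)%:E)%E \is a fin_num by exact: integrable_fin_num fi.
have fa : (\int[@lebR R]_t (a t)%:E)%E \is a fin_num by exact: integrable_fin_num ai.
split; last by rewrite /Rintegral e fineM.
apply/integrableP; split.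
  apply/measurable_EFinP; apply: measurable_funM.
    exact: (measurableT_comp mf measurable_fst).
  exact: (measurableT_comp ma measurable_snd).
under eq_integral do rewrite /= ger0_norm ?mulr_ge0//.
by rewrite e -ge0_fin_numE ?fin_numM// mule_ge0// integral_ge0// => *; rewrite lee_fin.
Qed.

(** By Tonelli, the measures of the time sections of a null set integrate to 0. *)
Lemma ae_ysection (P : X -> Prop) : {ae lebST R N, forall q, P q} ->
  {ae @lebR R, forall t, {ae lebN R N, forall x, P (x, t)}}.
Proof.
move=> [Z [mZ Z0 HZ]].
have mI : measurable_fun setT (EFin \o \1_Z : X -> \bar R).
  by apply/measurable_EFinP; exact: measurable_indic.
have i0 x : (0 <= (EFin \o \1_Z : X -> \bar R) x)%E by rewrite lee_fin.
have h := @fubini_tonelli2 _ _ _ _ R (lebN R N) (@lebR R) _ mI i0.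
pose G := fubini_G (lebN R N) (EFin \o \1_Z : X -> \bar R).
have mG : measurable_fun setT G by exact: measurable_fun_fubini_tonelli_G.
have GE t : G t = lebN R N (ysection Z t).
  rewrite -[ysection Z t]setIT -integral_indic//; last exact: measurable_ysection.
  rewrite /G /fubini_G.
  apply: eq_integral => x _ /=; rewrite !indicE; congr ((_ : bool)%:R%:E).
  by rewrite mem_ysection.
have G0 : (\int[@lebR R]_t `|G t| = 0)%E.
  under eq_integral do rewrite GE gee0_abs//.
  under eq_integral do rewrite -GE.
  by rewrite /G -h integral_indic// setIT.
have /(ae_eq_integral_abs _ measurableT mG) [Y [mY Y0 HY]] := G0.
exists Y; split => // t /= nt; apply: HY => /= Gt; apply: nt.
exists (ysection Z t); split; first exact: measurable_ysection.
  by rewrite -GE Gt.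
by move=> x /= nx; rewrite /ysection/= inE; exact: HZ.
Qed.

Lemma Rintegral_supp dd (T : measurableType dd) (mu : {measure set T -> \bar R})
    (D U : set T) (f : T -> R) :
  D `<=` U -> (forall q, ~ D q -> f q = 0) ->
  \int[mu]_(q in U) f q = \int[mu]_(q in D) f q.
Proof.
move=> DU f0; rewrite Rintegral_mkcond [RHS]Rintegral_mkcond.
congr (Rintegral _ _ _); apply/funext => q; rewrite !patchE.
case: ifPn => [qU|qU]; case: ifPn => [qD|qD] //.
  by rewrite f0//; move: qD; rewrite notin_setE.
by move: qU; rewrite notin_setE; case; apply: DU; rewrite -in_setE.
Qed.

Lemma Rintegral_suppT dd (T : measurableType dd) (mu : {measure set T -> \bar R})
    (D : set T) (f : T -> R) :
  (forall q, ~ D q -> f q = 0) -> \int[mu]_q f q = \int[mu]_(q in D) f q.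
Proof. exact: Rintegral_supp. Qed.

End spacetime_measure.

(** * Testing the differential inequality of a flow *)

Lemma dist_pt_ge0 (R : realType) (N : nat) (x : 'rV[R]_N) A : (0 <= dist_pt x A)%E.
Proof. by apply: le_ereal_inf_tmp => _ [y Ay <-]; rewrite lee_fin enorm_ge0. Qed.

Lemma dfun_in (R : realType) (N : nat) (E : set ('rV[R]_N * R)) q : E q -> dfun E q = 0.
Proof.
case: q => x t Ext; rewrite /dfun /=.
suff -> : dist_pt x (slice E t) = 0%E by [].
apply/eqP; rewrite eq_le dist_pt_ge0 andbT; apply: ge_ereal_inf.
by exists (enorm (x - x))%:E; [exists x|rewrite subrr enorm0].
Qed.

Lemma in_Linfty_le (R : realType) (N : nat) (S : set ('rV[R]_N * R))
    (m : {measure set ('rV[R]_N * R) -> \bar R}) :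
  in_Linfty S m -> exists2 M : R, 0 <= M &
    forall A, measurable A -> A `<=` S -> (m A <= M%:E * lebST R N A)%E.
Proof.
move=> [g [mg [M hM] H]]; exists `|M| => // A mA AS; rewrite H//.
have mgA : measurable_fun A (EFin \o g).
  by apply/measurable_EFinP; exact: measurable_funTS.
rewrite -integral_cst// [leLHS]integralE.
apply: (@le_trans _ _ (\int[lebST R N]_(q in A) ((EFin \o g)^\+ q))%E).
  by rewrite geeDl// leeNl oppe0 integral_ge0.
apply: ae_ge0_le_integral => //.
- exact: measurable_funepos.
- by move=> q _; rewrite lee_fin.
- case: hM => Z [mZ Z0 HZ]; exists Z; split => // q /= nq; apply: HZ => /= h.
  apply: nq => Aq; rewrite funeposE /= ge_max !lee_fin normr_ge0 andbT.
  apply: (le_trans (ler_norm _)); apply: (le_trans (h (AS _ Aq))); exact: ler_norm.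
Qed.

Lemma signed_test_arith (R : realType) (p1 p2 n1 n2 kI kA c G : R) :
  p1 - n1 <= G -> p2 <= c -> 0 <= n2 -> kA <= kI ->
  p1 + p2 - (n1 + n2) = kI -> kA - c <= G.
Proof. by lra. Qed.

Section flow_test.
Context {R : realType} {N : nat} (r : R) (r0 : 0 < r) (E : set ('rV[R]_N * R)).
Local Notation X := ('rV[R]_N * R)%type.
Variable z : X -> {measure set ('rV[R]_N * 'rV[R]_N) -> \bar R}.
Variables Dp Dn dp dn : {measure set X -> \bar R}.
Local Notation Q := (@strip R N (Text E)).
Local Notation d := (dfun E).
Hypothesis hDiv : is_Div r (Text E) z Dp Dn.
Hypothesis hdt : is_dt (Q `\` E) d dp dn.
Hypothesis hle : signed_le_on (Q `\` E) Dp Dn dp dn.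

(** The measure z q realizes the oscillation of the distance: it lives on pairs of
    a maximum and a minimum point of the distance in the ball. *)
Definition calibrated (q : X) : Prop :=
  (z q (@Cr R N r) <= 1)%E /\
  (\int[z q]_(xy in @Cr R N r) (d (q.1 + xy.1, q.2) - d (q.1 + xy.2, q.2))%:E =
   osc (eball q.1 r) (fun x => d (x, q.2)))%E.

Hypothesis hcal : {ae lebST R N, forall q, Q q -> calibrated q}.

Variables (K : set 'rV[R]_N) (rho al be lam M : R).
Hypothesis cK : compact K.
Hypothesis Krho : forall x, K x -> enorm x <= rho.
Hypotheses (al0 : 0 < al) (beT : (be%:E < Text E)%E).
Hypothesis lam0 : 0 < lam.
Hypothesis hK : forall x t, K x -> al <= t <= be -> lam <= d (x, t).
Hypothesis M0 : 0 <= M.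
Hypothesis hM : forall A, measurable A -> A `<=` K `*` `[al, be] ->
  (Dp A <= M%:E * lebST R N A)%E.

Variables (a da : R -> R).
Hypothesis a01 : forall t, 0 <= a t <= 1.
Hypothesis aout : forall t, ~~ (al <= t <= be) -> a t = 0.
Hypothesis ada : forall t : R, is_derive t 1 a (da t).
Hypothesis ai : (@lebR R).-integrable setT (EFin \o a).

Variables (g1 g2 : 'rV[R]_N -> R) (B : R).
Hypothesis cg1 : continuous g1.
Hypothesis cg2 : continuous g2.
Hypothesis g1B : forall x, 0 <= g1 x <= B.
Hypothesis g2B : forall x, 0 <= g2 x <= B.
Hypothesis g1K : forall x, ~ K x -> g1 x = 0.
Hypothesis g2K : forall x, ~ K x -> g2 x = 0.
Hypothesis alg1 : smooth_alg (fun q : X => g1 q.1 * a q.2).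

Let D := K `*` `[al, be].

Let ca : continuous a.
Proof. by move=> t; exact: (is_derive_continuous (ada t)). Qed.

Let mK : measurable K.
Proof.
by apply: rV_closed_measurable; apply: compact_closed.
Qed.

Let mD : measurable D.
Proof. by apply: measurableX => //. Qed.

Let cD : compact D.
Proof. by apply: compact_setX => //; exact: segment_compact. Qed.

Let DQ : D `<=` Q.
Proof.
move=> [x t] [/= Kx]; rewrite in_itv/= => /andP[t1 t2]; split => /=.
  exact: lt_le_trans t1.
by apply: le_lt_trans beT; rewrite lee_fin.
Qed.

Let DU : D `<=` Q `\` E.
Proof.
move=> q Dq; split; first exact: DQ.
case: q Dq => x t [/= Kx]; rewrite in_itv/= => t1 /dfun_in e.
by have := hK Kx t1; rewrite e leNgt lam0.
Qed.

Let phi (g : 'rV[R]_N -> R) (q : X) := g q.1 * a q.2.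

Let phi_out (g : 'rV[R]_N -> R) : (forall x, ~ K x -> g x = 0) ->
  forall q, ~ D q -> phi g q = 0.
Proof.
move=> gK [x t] nD; rewrite /phi /=.
have [Kx|nKx] := pselect (K x); last by rewrite gK// mul0r.
rewrite aout ?mulr0//; by apply/negP => h; apply: nD; split => //=; rewrite in_itv.
Qed.

Let phi_cont (g : 'rV[R]_N -> R) : continuous g -> continuous (phi g).
Proof.
move=> cg q; apply: cvgM.
  by apply: (@continuous_comp _ _ _ fst g); [exact: cvg_fst|exact: cg].
by apply: (@continuous_comp _ _ _ snd a); [exact: cvg_snd|exact: ca].
Qed.

Let phi_meas (g : 'rV[R]_N -> R) : continuous g -> measurable_fun setT (phi g).
Proof.
move=> cg; apply: measurable_funM.
  exact: (measurableT_comp (rV_continuous_measurable cg) measurable_fst).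
exact: (measurableT_comp (lebR_continuous_measurable ca) measurable_snd).
Qed.

Let phi_Cc (g : 'rV[R]_N -> R) U :
  continuous g -> (forall x, ~ K x -> g x = 0) -> D `<=` U -> Cc U (phi g).
Proof.
move=> cg gK DU'; split; first exact: phi_cont.
by exists D; split => //; exact: phi_out.
Qed.

Let phi_bd (g : 'rV[R]_N -> R) : (forall x, 0 <= g x <= B) -> forall q, 0 <= phi g q <= B.
Proof.
move=> gB q; rewrite /phi; have /andP[a0 a1] := a01 q.2; have /andP[h0 h1] := gB q.1.
apply/andP; split; first exact: mulr_ge0.
by rewrite -[leRHS]mulr1 ler_pM.
Qed.

Let dpD : (dp D < +oo)%E. Proof. by have [[[h _] _ _] _ _] := hdt; exact: h. Qed.
Let dnD : (dn D < +oo)%E. Proof. by have [[_ [h _] _] _ _] := hdt; exact: h. Qed.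
Let DpD : (Dp D < +oo)%E. Proof. by have [[[h _] _ _] _] := hDiv; exact: h. Qed.
Let DnD : (Dn D < +oo)%E. Proof. by have [[_ [h _] _] _] := hDiv; exact: h. Qed.

Let phi_int (m : {measure set X -> \bar R}) (g : 'rV[R]_N -> R) :
  (m D < +oo)%E -> continuous g ->
  (forall x, 0 <= g x <= B) -> m.-integrable D (EFin \o phi g).
Proof.
move=> mDoo cg gB; apply: (@integrable_bounded _ _ _ _ _ _ B) => //.
  exact: phi_meas.
by move=> q _; have /andP[h0 h1] := phi_bd gB q; rewrite ger0_norm.
Qed.

Let step_dt : \int[Dp]_(q in D) phi g1 q - \int[Dn]_(q in D) phi g1 q <=
  - \int[lebST R N]_(q in D) (d q * (g1 q.1 * da q.2)).
Proof.
have [_ _ H] := hdt.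
have := H (phi g1) (phi_Cc cg1 g1K DU) (smooth_alg_smooth alg1).
rewrite !(Rintegral_supp _ DU (phi_out g1K)).
have -> : \int[lebST R N]_(q in Q `\` E) (d q * 'D_(0, 1) (phi g1) q) =
    \int[lebST R N]_(q in D) (d q * (g1 q.1 * da q.2)).
  have e q : 'D_(0, 1) (phi g1) q = g1 q.1 * da q.2.
    by have [_ ->] := is_derive_time g1 (ada q.2).
  under eq_Rintegral do rewrite e.
  apply: Rintegral_supp => // q nD.
  suff -> : g1 q.1 * da q.2 = 0 by rewrite mulr0.
  have [Kx|nKx] := pselect (K q.1); last by rewrite g1K// mul0r.
  have nt : ~~ (al <= q.2 <= be).
    by apply/negP => h; apply: nD; split => //=; rewrite in_itv.
  suff -> : da q.2 = 0 by rewrite mulr0.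
  have [_ <-] := ada q.2.
  have near0 : \forall u \near q.2, (cst (0 : R) : R -> R) u = a u.
    move: nt; rewrite negb_and -!ltNge => /orP[h|h]; near=> t; rewrite aout//.
      by rewrite negb_and -!ltNge; apply/orP; left; near: t; exact: lt_nbhsl.
    by rewrite negb_and -!ltNge; apply/orP; right; near: t; exact: lt_nbhsr.
  have [_ ->] := @near_eq_is_derive R _ _ (cst 0) a q.2 1 0 near0 (is_derive_cst _ _ _).
  by [].
move=> <-; apply: (@le_signed_integral_on _ _ _ _ _ _ _ _ _ B) => //.
- exact: phi_meas.
- exact: phi_bd.
- by move=> A mA AD; apply: hle => //; exists D.
Unshelve. all: by end_near. Qed.

Let step_Linfty : \int[Dp]_(q in D) phi g2 q <=
  M * ((\int[lebN R N]_x g2 x) * \int[@lebR R]_t a t).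
Proof.
have mphi := phi_meas cg2.
have b2 := phi_bd g2B.
have p0 q : (0 <= (EFin \o phi g2) q)%E by rewrite lee_fin; have /andP[] := b2 q.
have mE : measurable_fun setT (EFin \o phi g2) by exact/measurable_EFinP.
have h := @le_measure_integral_on _ _ _ Dp (mscale (NngNum M0) (lebST R N)) D
  (EFin \o phi g2) mD mE p0 hM.
have Koo : (lebN R N K < +oo)%E by exact: (lebN_bounded_lty mK Krho).
have gi : (lebN R N).-integrable setT (EFin \o g2).
  rewrite (_ : EFin \o g2 = (EFin \o g2) \_ K).
    apply/(integrable_mkcond _ mK).
    apply: (@integrable_bounded _ _ _ _ _ _ B) => //.
      exact: rV_continuous_measurable.
    by move=> x _; have /andP[? ?] := g2B x; rewrite ger0_norm.
  apply/funext => x; rewrite patchE; case: ifPn => //.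
  by rewrite notin_setE => /g2K /= ->.
have [ip <-] := @integrable_prod R N g2 a (lebR_continuous_measurable ca)
  (fun x => proj1 (andP (g2B x))) (fun t => proj1 (andP (a01 t))) gi ai.
rewrite (Rintegral_suppT _ (phi_out g2K)).
rewrite /Rintegral -[M]/(fine M%:E) -fineM//; last first.
  apply: integrable_fin_num => //; apply: integrableS ip => //.
apply: fine_le.
- by apply: integrable_fin_num => //; exact: phi_int.
- rewrite fin_numM//; apply: integrable_fin_num => //; exact: integrableS ip.
- apply: (le_trans h); rewrite ge0_integral_mscale//.
  exact: measurable_funTS.
Qed.

Variable (Qf : 'rV[R]_N -> R).
Hypothesis Qi : (lebN R N).-integrable setT (EFin \o Qf).
Hypothesis hQ : forall w t, al <= t <= be -> calibrated (w, t) ->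
  pairing r (z (w, t)) w (fun x => g1 x + g2 x) <= Qf w.

Let cg w : {for w, continuous (fun x => g1 x + g2 x)}.
Proof. by apply: (@cvgD _ _ _ (nbhs w)); [exact: cg1|exact: cg2]. Qed.

Let Int (q : X) : R := \int[z q]_(xy in @Cr R N r)
  (phi (fun x => g1 x + g2 x) (q.1 + xy.1, q.2) -
   phi (fun x => g1 x + g2 x) (q.1 + xy.2, q.2)).

Let W : set 'rV[R]_N := [set w | enorm w <= rho + r].

Let Int_bounds w t : al <= t <= be -> calibrated (w, t) ->
  - (4 * B) * a t * \1_W w <= Int (w, t) <= a t * Qf w.
Proof.
move=> tab cal; have [z1 _] := cal.
have g0 : (fun x => g1 x + g2 x) = (fun x => g1 x + g2 x) by [].
have e : Int (w, t) = a t * pairing r (z (w, t)) w (fun x => g1 x + g2 x).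
  rewrite /Int /pairing -RintegralZl//.
  - by apply: eq_Rintegral => xy _; rewrite /phi /=; ring.
  - exact: measurable_Cr.
  - exact: (pairing_integrable z1 w cg).
have /andP[a0 _] := a01 t.
rewrite e ler_wpM2l ?hQ// andbT.
have [wW|wW] := pselect (W w).
  rewrite indicE mem_set//= mulr1.
  have B0 : 0 <= B by have /andP[+ h] := g1B 0; move=> /le_trans; exact.
  have := @pairing_abs_le _ _ r (z (w, t)) z1 w _ (2 * B) cg.
  rewrite mulr_ge0// => /(_ isT) h.
  have {}h : `|pairing r (z (w, t)) w (fun x => g1 x + g2 x)| <= 2 * (2 * B).
    apply: h => x Bx; have /andP[? ?] := g1B (w + x); have /andP[? ?] := g2B (w + x).
    by rewrite ger0_norm ?addr_ge0//; lra.
  move: h; rewrite ler_norml => /andP[h _].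
  have -> : - (4 * B) * a t = a t * - (4 * B) by ring.
  by rewrite ler_wpM2l//; lra.
rewrite indicE memNset//= mulr0 mulr_ge0//.
suff -> : pairing r (z (w, t)) w (fun x => g1 x + g2 x) = 0 by [].
have out x : closure (eball 0 r) x -> g1 (w + x) + g2 (w + x) = 0.
  move=> Bx; have nK : ~ K (w + x).
    move=> /Krho h; apply: wW; rewrite /W /=.
    have -> : w = (w + x) + - x by rewrite addrK.
    apply: (le_trans (enormD _ _)); rewrite enormN lerD//.
    exact: closure_eball.
  by rewrite g1K// g2K// addr0.
apply/eqP; rewrite -normr_le0 -(mulr0 2).
by apply: (pairing_abs_le z1 cg) => // x /out ->; rewrite normr0.
Qed.

(** The differential inequality tested with (g1 + g2)(x) a(t). Only the smooth
    part g1 is tested against the time derivative of d; on g2 the density bound M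
    for the positive part of the divergence is used. In this way the divergence is
    tested with the whole sum g1 + g2, for which Qf bounds the pairings. *)
Lemma flow_test :
  - (2 * r)^-1 * ((\int[@lebR R]_t a t) * \int[lebN R N]_x Qf x) -
    M * ((\int[lebN R N]_x g2 x) * \int[@lebR R]_t a t) <=
  - \int[lebST R N]_(q in D) (d q * (g1 q.1 * da q.2)).
Proof.
pose g x := g1 x + g2 x.
have gK x : ~ K x -> g x = 0 by move=> nK; rewrite /g g1K// g2K// addr0.
have [_ HD] := hDiv.
have := HD (phi g) (phi_Cc cg gK DQ).
rewrite !(Rintegral_supp _ DQ (phi_out gK)).
set I := \int[@lebR R]_(t in _) _ => eI.
have Ile : I <= (\int[@lebR R]_t a t) * \int[lebN R N]_x Qf x.
  (* The pairings vanish for w outside W, and are at least - 4 B a(t). *)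
  pose c1 := - (4 * B) * fine (lebN R N W).
  have mW : measurable W by apply: rV_closed_measurable; exact: closed_enorm_le.
  have Woo : (lebN R N W < +oo)%E by exact: (lebN_bounded_lty mW (c := rho + r)).
  have Zi (m : {measure set R -> \bar R}) (c : R) : m.-integrable setT (EFin \o a) ->
      m.-integrable setT (EFin \o (fun t => c * a t)).
    by move=> h; exact: (integrableZl measurableT c h).
  have Wi : (lebN R N).-integrable setT (EFin \o \1_W) by exact: integrable_indic_lty.
  have Wv : \int[lebN R N]_w (\1_W w : R) = fine (lebN R N W).
    by rewrite /Rintegral integral_indic// setIT.
  have bounds t : {ae lebN R N, forall w, Q (w, t) -> calibrated (w, t)} ->
      c1 * a t <= ((fun t => \int[lebN R N]_w Int (w, t))
        \_ [set t | 0 < t /\ (t%:E < Text E)%E]) t <= (\int[lebN R N]_x Qf x) * a t.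
    move=> cal; have [tab|tab] := boolP (al <= t <= be); last first.
      have Int0 w : Int (w, t) = 0.
        rewrite /Int /phi /= aout//; under eq_Rintegral do rewrite !mulr0 subrr.
        by rewrite /Rintegral integral0.
      rewrite aout// !mulr0 patchE; case: ifPn => _; last by rewrite lexx.
      under eq_Rintegral do rewrite Int0.
      by rewrite /Rintegral integral0 lexx.
    have /andP[t1 t2] := tab.
    have tQ w : Q (w, t).
      split => /=; first exact: lt_le_trans t1.
      by apply: le_lt_trans beT; rewrite lee_fin.
    rewrite patchE mem_set; last exact: (tQ 0).
    have -> : c1 * a t = \int[lebN R N]_w (- (4 * B) * a t * \1_W w).
      by rewrite RintegralZl// Wv /c1; ring.
    have -> : (\int[lebN R N]_x Qf x) * a t = \int[lebN R N]_w (a t * Qf w).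
      by rewrite RintegralZl// mulrC.
    apply: Rintegral_between_ae.
    - exact: (integrableZl measurableT (- (4 * B) * a t) Wi).
    - exact: (integrableZl measurableT (a t) Qi).
    - by apply: filterS cal => w /(_ (tQ w)); exact: Int_bounds.
  rewrite /I Rintegral_mkcond mulrC -RintegralZl//.
  have ib := integrableZl measurableT c1 ai.
  have ib2 := integrableZl measurableT (\int[lebN R N]_x Qf x) ai.
  have hae : {ae @lebR R, forall t, c1 * a t <=
      ((fun t => \int[lebN R N]_w Int (w, t))
        \_ [set t | 0 < t /\ (t%:E < Text E)%E]) t <= (\int[lebN R N]_x Qf x) * a t}.
    by apply: filterS (ae_ysection hcal) => t; exact: bounds.
  have := Rintegral_between_ae ib ib2 hae.
  by case/andP.
have De (m : {measure set X -> \bar R}) : (m D < +oo)%E ->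
    \int[m]_(q in D) phi g q = \int[m]_(q in D) phi g1 q + \int[m]_(q in D) phi g2 q.
  move=> moo; rewrite -RintegralD//; do ?exact: phi_int.
  by apply: eq_Rintegral => q _; rewrite /phi /g mulrDl.
move: eI; rewrite !De// => eI.
have h1 := step_dt; have h2 := step_Linfty.
have h3 : 0 <= \int[Dn]_(q in D) phi g2 q.
  by apply: Rintegral_ge0 => q _; have /andP[] := phi_bd g2B q.
have h4 : - (2 * r)^-1 * ((\int[@lebR R]_t a t) * \int[lebN R N]_x Qf x) <=
    - (2 * r)^-1 * I.
  by rewrite ler_wnM2l// oppr_le0 invr_ge0 mulr_ge0// ltW.
exact: signed_test_arith h1 h2 h3 h4 eI.
Qed.

End flow_test.

(** * Increments of the distance between two times *)

Section compact_support.
Context {R : realType} {N : nat}.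

Lemma Cc_bounded (K : set 'rV[R]_N) (f : 'rV[R]_N -> R) :
  compact K -> continuous f -> (forall x, ~ K x -> f x = 0) ->
  exists2 B, 0 <= B & forall x, `|f x| <= B.
Proof.
move=> cK cf f0.
have /compact_bounded[M [_ HM]] := continuous_compact (continuous_subspaceT cf) cK.
exists (`|M| + 1); first by rewrite addr_ge0.
move=> x; have [Kx|/f0 ->] := pselect (K x); last by rewrite normr0 addr_ge0.
apply: HM; last by exists x.
by rewrite ltr_pwDr// ler_norm.
Qed.

Lemma compact_enorm_bounded (K : set 'rV[R]_N) : compact K ->
  exists rho, forall x, K x -> enorm x <= rho.
Proof.
move=> /compact_bounded[M [_ HM]]; exists (N%:R * (M + 1)) => x Kx.
apply: (le_trans (enorm_le_norm x)); rewrite ler_wpM2l//.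
by apply: HM => //; rewrite ltrDl.
Qed.

Lemma Cc_integrable (K : set 'rV[R]_N) (f : 'rV[R]_N -> R) :
  compact K -> continuous f -> (forall x, ~ K x -> f x = 0) ->
  (lebN R N).-integrable setT (EFin \o f).
Proof.
move=> cK cf f0; have [B B0 fB] := Cc_bounded cK cf f0.
have [rho Krho] := compact_enorm_bounded cK.
have mK : measurable K by apply: rV_closed_measurable; exact: compact_closed.
rewrite (_ : EFin \o f = (EFin \o f) \_ K).
  apply/(integrable_mkcond _ mK); apply: (@integrable_bounded _ _ _ _ _ _ B) => //.
    exact: (lebN_bounded_lty mK Krho).
  exact: rV_continuous_measurable.
apply/funext => x; rewrite patchE; case: ifPn => //.
by rewrite notin_setE => /f0 /= ->.
Qed.

Lemma kern_integrable (k t : R) : 0 < k -> (@lebR R).-integrable setT (EFin \o kern k t).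
Proof.
move=> k0; apply/integrableP; split.
  by apply/measurable_EFinP; apply: lebR_continuous_measurable; exact: kern_continuous.
under eq_integral do rewrite /= ger0_norm ?kern_ge0//.
by rewrite integral_kern// ltry.
Qed.

Lemma dfun_ge0 (E : set ('rV[R]_N * R)) q : 0 <= dfun E q.
Proof. by rewrite /dfun fine_ge0// dist_pt_ge0. Qed.

End compact_support.

Lemma kernel_bound_arith (R : realType) (d us ut e g ks kt : R) : 0 <= g ->
  (us - e) * ks <= d * ks -> d * kt <= (ut + e) * kt ->
  g * us * ks - e * (g * ks) - (g * ut * kt + e * (g * kt)) <= d * (g * (ks - kt)).
Proof. by move=> g0 /(ler_wpM2l g0) h1 /(ler_wpM2l g0) h2; lra. Qed.

Lemma flow_limit_arith (R : realType) (A q G1 G2 M ir e eps c ts V : R) :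
  0 <= M -> 0 <= G2 -> 0 <= ir -> ts - c <= A -> A <= ts + c ->
  - ir * (A * q) - M * (G2 * A) <= V + 2 * eps * G1 ->
  2 * eps * G1 <= e / 2 -> c * (ir * `|q| + M * G2) <= e / 2 ->
  - ir * (ts * q) - M * (ts * G2) <= V + e.
Proof.
move=> M0 G20 ir0 h1 h2 h3 h4 h5.
have MG : 0 <= M * G2 by exact: mulr_ge0.
have k1 : - ir * (ts * q) <= - ir * (A * q) + ir * (c * `|q|).
  have : (A - ts) * q <= c * `|q|.
    apply: (le_trans (ler_norm _)); rewrite normrM ler_wpM2r//.
    by rewrite ler_norml; apply/andP; split; lra.
  by move=> /(ler_wpM2l ir0); lra.
have k2 : M * (G2 * A) <= M * (ts * G2) + c * (M * G2).
  have -> : M * (ts * G2) + c * (M * G2) = (M * G2) * (ts + c) by ring.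
  have -> : M * (G2 * A) = (M * G2) * A by ring.
  exact: ler_wpM2l.
have e2 : e = e / 2 + e / 2 by lra.
lra.
Qed.

Lemma flow_lip_arith (R : realType) (ir ts q eps mW M G2 V T Bg Dm mK e : R) :
  - ir * (ts * (q + 2 * eps * mW)) - M * (ts * G2) <= V ->
  V + M * ts * G2 <= T + eps * (Bg + Dm) * mK ->
  eps * (Bg * mK + Dm * mK + ir * (ts * (2 * mW))) <= e ->
  - ir * (ts * q) <= T + e.
Proof. by lra. Qed.

Section testing_one_flow.
Context {R : realType} {N : nat} (r : R) (r0 : 0 < r) (E : set ('rV[R]_N * R)).
Local Notation X := ('rV[R]_N * R)%type.
Variable z : X -> {measure set ('rV[R]_N * 'rV[R]_N) -> \bar R}.
Variables Dp Dn dp dn : {measure set X -> \bar R}.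
Local Notation Q := (@strip R N (Text E)).
Local Notation d := (dfun E).
Hypothesis hDiv : is_Div r (Text E) z Dp Dn.
Hypothesis hdt : is_dt (Q `\` E) d dp dn.
Hypothesis hle : signed_le_on (Q `\` E) Dp Dn dp dn.
Hypothesis hcal : {ae lebST R N, forall q, Q q -> calibrated r E z q}.
Variables (K : set 'rV[R]_N) (t0 t1 lam M : R).
Hypothesis cK : compact K.
Hypotheses (t00 : 0 <= t0) (t1T : (t1%:E <= Text E)%E).
Hypothesis lam0 : 0 < lam.
Hypothesis hK : forall x t, K x -> t0 < t < t1 -> lam <= d (x, t).
Hypothesis M0 : 0 <= M.
Hypothesis hM : forall A, measurable A -> A `<=` [set q | Q q /\ lam <= d q] ->
  (Dp A <= M%:E * lebST R N A)%E.
Hypothesis Ld : forall t, t0 < t < t1 -> elip 1 (fun x => d (x, t)).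
Hypothesis lcd : forall t eps, t0 < t < t1 -> 0 < eps -> exists2 eta : R, 0 < eta &
  forall tau x, t - eta <= tau <= t -> t0 < tau -> K x ->
    `|d (x, tau) - d (x, t)| <= eps.

Variables (s t h0 : R).
Hypotheses (t0s : t0 < s) (st : s < t) (tt1 : t < t1) (h00 : 0 < h0).
Section smooth_pair.
Variables (g1 g2 : 'rV[R]_N -> R).
Hypothesis cg1 : continuous g1.
Hypothesis cg2 : continuous g2.
Hypothesis g10 : forall x, 0 <= g1 x.
Hypothesis g20 : forall x, 0 <= g2 x.
Hypothesis g1K : forall x, ~ K x -> g1 x = 0.
Hypothesis g2K : forall x, ~ K x -> g2 x = 0.
Hypothesis alg1 : forall a : R -> R, smooth_alg (fun q : X => a q.2) ->
  smooth_alg (fun q : X => g1 q.1 * a q.2).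
Variable (Qf : 'rV[R]_N -> R).
Hypothesis Qi : (lebN R N).-integrable setT (EFin \o Qf).
Hypothesis hQ : forall w tau, s - h0 <= tau <= t -> t0 < tau ->
  calibrated r E z (w, tau) ->
  pairing r (z (w, tau)) w (fun x => g1 x + g2 x) <= Qf w.

Let kernel_bound (k eps : R) : 0 < k -> 0 < eps -> t0 < s - k^-1 ->
  (forall tau x, s - k^-1 <= tau <= s -> K x -> `|d (x, tau) - d (x, s)| <= eps) ->
  (forall tau x, t - k^-1 <= tau <= t -> K x -> `|d (x, tau) - d (x, t)| <= eps) ->
  - (\int[lebST R N]_(q in K `*` `[s - k^-1, t])
      (d q * (g1 q.1 * (kern k s q.2 - kern k t q.2)))) <=
  \int[lebN R N]_x (g1 x * (d (x, t) - d (x, s))) +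
    2 * eps * \int[lebN R N]_x g1 x.
Proof.
move=> k0 e0 k1 ls lt'; have k'0 : 0 < k^-1 by rewrite invr_gt0.
pose D := K `*` `[s - k^-1, t].
have mK : measurable K by apply: rV_closed_measurable; exact: compact_closed.
have mD : measurable D by exact: measurableX.
have cD : compact D by apply: compact_setX => //; exact: segment_compact.
have DU : D `<=` Q `\` E.
  move=> [x u] [/= Kx]; rewrite in_itv/= => /andP[u1 u2].
  have u0 : t0 < u < t1 by rewrite (lt_le_trans k1 u1) (le_lt_trans u2 tt1).
  have /andP[u3 u4] := u0.
  split.
    split => /=; first exact: le_lt_trans u3.
    by apply: (lt_le_trans _ t1T); rewrite lte_fin.
  by move=> /dfun_in e; have := hK Kx u0; rewrite e leNgt lam0.
pose us x := d (x, s); pose ut x := d (x, t).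
have cu v : t0 < v < t1 -> continuous (fun x => d (x, v)).
  by move=> v01; exact: elip_continuous (Ld v01).
have cus : continuous us by apply: (cu s); rewrite t0s (lt_trans st tt1).
have cut : continuous ut by apply: (cu t); rewrite tt1 (lt_trans t0s st).
have cg (u : 'rV[R]_N -> R) : continuous u -> continuous (fun x => g1 x * u x).
  by move=> cu' x; apply: (@cvgM _ _ (nbhs x)); [exact: cg1|exact: cu'].
have gK (u : 'rV[R]_N -> R) x : ~ K x -> g1 x * u x = 0.
  by move=> /g1K ->; rewrite mul0r.
have ig : (lebN R N).-integrable setT (EFin \o g1) by exact: (Cc_integrable cK cg1 g1K).
have igs : (lebN R N).-integrable setT (EFin \o (fun x => g1 x * us x)).
  exact: (Cc_integrable cK (cg us cus) (gK us)).
have igt : (lebN R N).-integrable setT (EFin \o (fun x => g1 x * ut x)).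
  exact: (Cc_integrable cK (cg ut cut) (gK ut)).
have km v : measurable_fun setT (kern k v).
  by apply: lebR_continuous_measurable; exact: kern_continuous.
have kv v : \int[@lebR R]_u kern k v u = 1 by rewrite /Rintegral integral_kern.
have pr (f : 'rV[R]_N -> R) v : (forall x, 0 <= f x) ->
    (lebN R N).-integrable setT (EFin \o f) ->
    (lebST R N).-integrable setT (EFin \o (fun q : X => f q.1 * kern k v q.2)) /\
    \int[lebST R N]_q (f q.1 * kern k v q.2) = \int[lebN R N]_x f x.
  move=> f0 fi; have [h1 ->] := integrable_prod (km v) f0
    (fun u => kern_ge0 v u k0) fi (kern_integrable v k0).
  by rewrite kv mulr1.
have gus x : 0 <= g1 x * us x by rewrite mulr_ge0 ?dfun_ge0.
have gut x : 0 <= g1 x * ut x by rewrite mulr_ge0 ?dfun_ge0.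
have [i1 e1] := pr _ s gus igs; have [i2 e2] := pr _ t gut igt.
have [i3 e3] := pr _ s g10 ig; have [i4 e4] := pr _ t g10 ig.
pose F1 (q : X) := (g1 q.1 * us q.1) * kern k s q.2.
pose F2 (q : X) := (g1 q.1 * ut q.1) * kern k t q.2.
pose F3 (q : X) := g1 q.1 * kern k s q.2.
pose F4 (q : X) := g1 q.1 * kern k t q.2.
pose H1 (q : X) := F1 q - eps * F3 q.
pose H2 (q : X) := F2 q + eps * F4 q.
have iH1 : (lebST R N).-integrable setT (EFin \o H1).
  exact: (integrableB measurableT i1 (integrableZl measurableT eps i3)).
have iH2 : (lebST R N).-integrable setT (EFin \o H2).
  exact: (integrableD measurableT i2 (integrableZl measurableT eps i4)).
have vH : \int[lebST R N]_q (H1 q - H2 q) =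
    \int[lebN R N]_x (g1 x * us x) - \int[lebN R N]_x (g1 x * ut x) -
    2 * eps * \int[lebN R N]_x g1 x.
  rewrite RintegralB// /H1 /H2 RintegralB//; last exact: (integrableZl measurableT eps i3).
  rewrite RintegralD//; last exact: (integrableZl measurableT eps i4).
  by rewrite !RintegralZl// /F1 /F2 /F3 /F4 e1 e2 e3 e4; ring.
have Hout q : ~ D q -> H1 q - H2 q = 0.
  case: q => x u nD; rewrite /H1 /H2 /F1 /F2 /F3 /F4 /=.
  have [Kx|nKx] := pselect (K x); last by rewrite g1K//; ring.
  have nu : ~~ (s - k^-1 <= u <= t).
    by apply/negP => h; apply: nD; split => //=; rewrite in_itv.
  rewrite !kern_out//; first by ring.
  - apply: contra nu => /andP[u1 ->]; rewrite andbT.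
    by apply: le_trans u1; rewrite lerD2r ltW.
  - by apply: contra nu => /andP[-> u1] /=; rewrite (le_trans u1)// ltW.
have iD : (lebST R N).-integrable D
    (EFin \o (fun q => d q * (g1 q.1 * (kern k s q.2 - kern k t q.2)))).
  have [_ /(_ D cD DU) di _] := hdt.
  have [B1 B10 gB] := Cc_bounded cK cg1 g1K.
  have [Bs kBs] := kern_bounded s k0; have [Bt kBt] := kern_bounded t k0.
  have mh : measurable_fun D (fun q : X => g1 q.1 * (kern k s q.2 - kern k t q.2)).
    apply: measurable_funTS; apply: measurable_funM.
      exact: (measurableT_comp (rV_continuous_measurable cg1) measurable_fst).
    have mk : measurable_fun setT (fun u => kern k s u - kern k t u) by exact: measurable_funB.
    exact: (measurableT_comp mk measurable_snd).
  have bh : [bounded (g1 q.1 * (kern k s q.2 - kern k t q.2) : R^o) | q in D].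
    exists (B1 * (Bs + Bt)); split; first exact: num_real.
    move=> y By q _ /=; apply: le_trans (ltW By).
    by rewrite normrM ler_pM// (le_trans (ler_normB _ _))// lerD.
  exact: (integrableMl mD di mh bh).
have : \int[lebST R N]_(q in D) (H1 q - H2 q) <=
    \int[lebST R N]_(q in D) (d q * (g1 q.1 * (kern k s q.2 - kern k t q.2))).
  apply: le_Rintegral => //.
    apply: (@integrableS _ _ _ _ setT) => //.
    exact: (integrableB measurableT iH1 iH2).
  move=> [x u] [/= Kx _]; rewrite /H1 /H2 /F1 /F2 /F3 /F4 /=.
  have a1 : (us x - eps) * kern k s u <= d (x, u) * kern k s u.
    have [h|h] := boolP (s - k^-1 <= u <= s); last by rewrite (kern_out k0 h) !mulr0.
    rewrite ler_wpM2r ?kern_ge0//; have := ls u x h Kx.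
    by rewrite ler_distl => /andP[].
  have a2 : d (x, u) * kern k t u <= (ut x + eps) * kern k t u.
    have [h|h] := boolP (t - k^-1 <= u <= t); last by rewrite (kern_out k0 h) !mulr0.
    rewrite ler_wpM2r ?kern_ge0//; have := lt' u x h Kx.
    by rewrite ler_distl => /andP[].
  exact: kernel_bound_arith (g10 x) a1 a2.
rewrite -(Rintegral_suppT _ Hout) vH => hh.
have -> : \int[lebN R N]_x (g1 x * (d (x, t) - d (x, s))) =
    \int[lebN R N]_x (g1 x * ut x) - \int[lebN R N]_x (g1 x * us x).
  by rewrite -RintegralB//; apply: eq_Rintegral => x _; rewrite mulrBr.
rewrite lerNl; apply: (le_trans _ hh).
by rewrite le_eqVlt; apply/orP; left; apply/eqP; ring.
Qed.

(** With the time cutoff trap k s t, the right-hand side of flow_test tends to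
    the increment of d from s to t, by left continuity of d in time. *)
Lemma flow_smooth :
  - (2 * r)^-1 * ((t - s) * \int[lebN R N]_x Qf x) -
    M * ((t - s) * \int[lebN R N]_x g2 x) <=
  \int[lebN R N]_x (g1 x * (d (x, t) - d (x, s))).
Proof.
set q := \int[lebN R N]_x Qf x; set G2 := \int[lebN R N]_x g2 x.
set V := \int[lebN R N]_x _; pose G1 := \int[lebN R N]_x g1 x.
have G10 : 0 <= G1 by apply: Rintegral_ge0.
have G20 : 0 <= G2 by apply: Rintegral_ge0.
have ir0 : 0 <= (2 * r)^-1 by rewrite invr_ge0 mulr_ge0// ltW.
apply/ler_addgt0Pr => e e0.
pose C := (2 * r)^-1 * `|q| + M * G2.
have C0 : 0 <= C by rewrite addr_ge0// mulr_ge0.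
pose eps := e / (4 * (G1 + 1)).
have eps0 : 0 < eps by rewrite divr_gt0// mulr_gt0// ltr_wpDl.
have epsG : 2 * eps * G1 <= e / 2.
  have -> : 2 * eps * G1 = e / 2 * (G1 / (G1 + 1)).
    by rewrite /eps; field; rewrite gt_eqF// ltr_wpDl.
  apply: ler_piMr; first by rewrite divr_ge0 ?ltW.
  by rewrite ler_pdivrMr ?ltr_wpDl// mul1r lerDl.
have s01 : t0 < s < t1 by rewrite t0s (lt_trans st tt1).
have t01 : t0 < t < t1 by rewrite tt1 (lt_trans t0s st).
have [es es0 hes] := lcd s01 eps0; have [et et0 het] := lcd t01 eps0.
pose c := Num.min (Num.min es et) (Num.min (Num.min h0 ((s - t0) / 2)) (e / (2 * (C + 1)))).
have c0 : 0 < c.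
  rewrite !lt_min es0 et0 h00/= divr_gt0 ?subr_gt0//=.
  by rewrite divr_gt0// mulr_gt0// ltr_wpDl.
have ces : c <= es by rewrite !ge_min lexx.
have cet : c <= et by rewrite !ge_min lexx !orbT.
have ch : c <= h0 by rewrite !ge_min lexx !orbT.
have cst : c <= (s - t0) / 2 by rewrite !ge_min lexx !orbT.
have cC : c * C <= e / 2.
  have : c <= e / (2 * (C + 1)) by rewrite !ge_min lexx !orbT.
  move=> /(ler_wpM2r C0) /le_trans; apply.
  have -> : e / (2 * (C + 1)) * C = e / 2 * (C / (C + 1)).
    by field; rewrite gt_eqF// ltr_wpDl.
  apply: ler_piMr; first by rewrite divr_ge0 ?ltW.
  by rewrite ler_pdivrMr ?ltr_wpDl// mul1r lerDl.
pose k := c^-1; have k0 : 0 < k by rewrite invr_gt0.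
have kc : k^-1 = c by rewrite /k invrK.
have st0 : t0 < s - k^-1.
  by rewrite kc ltrBrDr -ltrBrDl (le_lt_trans cst)// gtr_pMr ?subr_gt0// invf_lt1// ltr1n.
have ls tau x : s - k^-1 <= tau <= s -> K x -> `|d (x, tau) - d (x, s)| <= eps.
  move=> /andP[u1 u2] Kx; apply: hes => //; last exact: lt_le_trans u1.
  by rewrite u2 andbT (le_trans _ u1)// kc lerB.
have lt' tau x : t - k^-1 <= tau <= t -> K x -> `|d (x, tau) - d (x, t)| <= eps.
  move=> /andP[u1 u2] Kx; apply: het => //.
    by rewrite u2 andbT (le_trans _ u1)// kc lerB.
  by apply: (lt_le_trans st0); apply: le_trans u1; rewrite lerD2r ltW.
have [rho Krho] := compact_enorm_bounded cK.
have [B1 B10 gB1] := Cc_bounded cK cg1 g1K.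
have [B2 B20 gB2] := Cc_bounded cK cg2 g2K.
have gB1' x : 0 <= g1 x <= B1 + B2.
  by rewrite g10/= (le_trans (ler_norm _))// (le_trans (gB1 x))// lerDl.
have gB2' x : 0 <= g2 x <= B1 + B2.
  by rewrite g20/= (le_trans (ler_norm _))// (le_trans (gB2 x))// lerDr.
have al0 : 0 < s - k^-1 by exact: le_lt_trans st0.
have beT : (t%:E < Text E)%E by apply: (lt_le_trans _ t1T); rewrite lte_fin.
have hK' x u : K x -> s - k^-1 <= u <= t -> lam <= d (x, u).
  move=> Kx /andP[u1 u2]; apply: hK => //.
  by rewrite (lt_le_trans st0 u1) (le_lt_trans u2 tt1).
have hM' A : measurable A -> A `<=` K `*` `[s - k^-1, t] ->
    (Dp A <= M%:E * lebST R N A)%E.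
  move=> mA AD; apply: hM => // -[x u] /AD[/= Kx]; rewrite in_itv/= => u12.
  split; last exact: hK'.
  have /andP[u1 u2] := u12; split => /=; first exact: lt_le_trans u1.
  by apply: le_lt_trans beT; rewrite lee_fin.
have hQ' w u : s - k^-1 <= u <= t -> calibrated r E z (w, u) ->
    pairing r (z (w, u)) w (fun x => g1 x + g2 x) <= Qf w.
  move=> /andP[u1 u2]; apply: hQ; last exact: lt_le_trans u1.
  by rewrite u2 andbT (le_trans _ u1)// kc lerB.
have := @flow_test R N r r0 E z Dp Dn dp dn hDiv hdt hle hcal K rho (s - k^-1) t lam M
  cK Krho al0 beT lam0 hK' M0 hM' (trap k s t) (fun u => kern k s u - kern k t u)
  (fun u => trap_itv u k0 (ltW st)) (fun u => trap_out k0 (ltW st))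
  (is_derive_trap k s t) (trap_integrable k0 (ltW st)) g1 g2 (B1 + B2)
  cg1 cg2 gB1' gB2' g1K g2K (alg1 (smooth_alg_trap k s t)) Qf Qi hQ'.
move=> /le_trans /(_ (kernel_bound k0 eps0 st0 ls lt')) h3.
have /andP[h1 h2] := integral_trap k0 (ltW st).
rewrite kc in h1 h2.
exact: (flow_limit_arith M0 G20 ir0 h1 h2 h3 epsG cC).
Qed.

End smooth_pair.

Variables (K0 : set 'rV[R]_N) (rho0 : R).
Hypothesis rho00 : 0 < rho0.
Hypothesis K0K : forall x y, K0 y -> `|x - y| <= rho0 -> K x.
Variables (g : 'rV[R]_N -> R) (Lg Bg : R).
Hypothesis Lipg : elip Lg g.
Hypothesis gB : forall x, 0 <= g x <= Bg.
Hypothesis gK0 : forall x, g x != 0 -> K0 x.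
Variable (Qf : 'rV[R]_N -> R).
Hypothesis Qi : (lebN R N).-integrable setT (EFin \o Qf).
Hypothesis hQ : forall w tau, s - h0 <= tau <= t -> t0 < tau ->
  calibrated r E z (w, tau) -> pairing r (z (w, tau)) w g <= Qf w.
Variable c0 : R.

Let lev (u : R) := c0 + M * u.
Let dt (u : R) (x : 'rV[R]_N) := Num.max (d (x, u)) (lev u).

(** Where d exceeds the level at time s, its truncation increases at least as much
    as d. Elsewhere it increases at least as much as the level, whose speed M
    dominates the divergence. The cutoff th passes from one region to the other:
    g th is tested with the time derivative, and g (1 - th) is estimated with M. *)
Lemma flow_lip :
  - (2 * r)^-1 * ((t - s) * \int[lebN R N]_x Qf x) <=
  \int[lebN R N]_x (g x * (dt t x - dt s x)).
Proof.
have s01 : t0 < s < t1 by rewrite t0s (lt_trans st tt1).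
have t01 : t0 < t < t1 by rewrite tt1 (lt_trans t0s st).
have K0K' x : K0 x -> K x by move=> Kx; apply: (K0K Kx); rewrite subrr normr0 ltW.
have mK : measurable K by apply: rV_closed_measurable; exact: compact_closed.
have [rho Krho] := compact_enorm_bounded cK.
have Koo : (lebN R N K < +oo)%E by exact: (lebN_bounded_lty mK Krho).
pose W : set 'rV[R]_N := [set w | enorm w <= rho + r].
have mW : measurable W by apply: rV_closed_measurable; exact: closed_enorm_le.
have Woo : (lebN R N W < +oo)%E by exact: (lebN_bounded_lty mW (c := rho + r)).
have iW : (lebN R N).-integrable setT (EFin \o \1_W) by exact: integrable_indic_lty.
have iK : (lebN R N).-integrable setT (EFin \o \1_K) by exact: integrable_indic_lty.
pose mu_K := \int[lebN R N]_x (\1_K x : R); pose mu_W := \int[lebN R N]_x (\1_W x : R).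
have K0' : 0 <= mu_K by apply: Rintegral_ge0.
have W0' : 0 <= mu_W by apply: Rintegral_ge0.
have Bg0 : 0 <= Bg by have /andP[+ h] := gB 0; move=> /le_trans; exact.
have ir0 : 0 <= (2 * r)^-1 by rewrite invr_ge0 mulr_ge0// ltW.
have cd v : t0 < v < t1 -> continuous (fun x => d (x, v)).
  by move=> v01; exact: elip_continuous (Ld v01).
(* A bound on K for the increment of d, from the Lipschitz bound in space. *)
pose Dm := d (0, t) + d (0, s) + 2 * `|rho|.
have Dm0 : 0 <= Dm by rewrite !addr_ge0 ?dfun_ge0// mulr_ge0.
have dDm x : K x -> `|d (x, t) - d (x, s)| <= Dm.
  move=> Kx; have rx : enorm x <= `|rho| by apply: (le_trans (Krho x Kx)); exact: ler_norm.
  have h v : t0 < v < t1 -> d (x, v) <= d (0, v) + `|rho|.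
    by move=> v01; have := Ld v01 x 0; rewrite subr0 mul1r; lra.
  have := h _ s01; have := h _ t01.
  have := dfun_ge0 E (x, s); have := dfun_ge0 E (x, t).
  have := dfun_ge0 E (0 : 'rV[R]_N, s); have := dfun_ge0 E (0 : 'rV[R]_N, t).
  by rewrite ler_norml /Dm => *; apply/andP; split; lra.
pose C := Bg * mu_K + Dm * mu_K + (2 * r)^-1 * ((t - s) * (2 * mu_W)).
have C0 : 0 <= C.
  by rewrite !addr_ge0 ?mulr_ge0// subr_ge0 ltW.
apply/ler_addgt0Pr => e e0.
pose eps := Num.min rho0 (e / (C + 1)).
have eps0 : 0 < eps by rewrite lt_min rho00 divr_gt0// ltr_wpDl.
have eps_rho : eps <= rho0 by rewrite ge_min lexx.
have epsC : eps * C <= e.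
  have : eps <= e / (C + 1) by rewrite ge_min lexx orbT.
  move=> /(ler_wpM2r C0) /le_trans; apply.
  by rewrite mulrAC ler_pdivrMr ?ltr_wpDl// ler_pM2l// lerDl.
(* The cutoff vanishes where d is below the level at time s, and is 1 where d
   exceeds it by eps. *)
pose th x := Num.min 1 (Num.max 0 (eps^-1 * (d (x, s) - lev s))).
have th01 x : 0 <= th x <= 1.
  by rewrite /th le_min ler01/= le_max lexx/= ge_min lexx.
have Lth : elip eps^-1 th.
  have i0 : 0 <= eps^-1 by rewrite invr_ge0 ltW.
  apply: elip_min; first exact: elip_weak (elip_cst 1).
  apply: elip_max; first exact: elip_weak (elip_cst 0).
  move=> x y; rewrite -mulrBr ler_wpM2l//.
  by have := Ld s01 x y; rewrite mul1r; lra.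
pose gt x := g x * th x; pose g2 x := g x * (1 - th x).
have g0 x : 0 <= g x by have /andP[] := gB x.
have cg : continuous g by exact: elip_continuous Lipg.
have cth : continuous th by exact: elip_continuous Lth.
have gBn x : `|g x| <= Bg by rewrite ger0_norm//; have /andP[] := gB x.
have thn x : `|th x| <= 1 by have /andP[? ?] := th01 x; rewrite ger0_norm.
have Lgt := elip_mul Lipg Lth gBn thn.
have gK x : ~ K x -> g x = 0.
  by move=> nK; apply/eqP/negPn/negP => /gK0/K0K'.
have gt0 x : 0 <= gt x by have /andP[? ?] := th01 x; exact: mulr_ge0.
have gtB x : gt x != 0 -> `|x| <= rho.
  rewrite mulf_eq0 negb_or => /andP[/gK0/K0K'/Krho h _].
  exact: le_trans (norm_le_enorm x) h.
have [G [nG cG G0 Gg GK']] := smooth_approx eps0 Lgt gt0 gtB.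
have GK x : ~ K x -> G x = 0.
  move=> nK; apply/eqP/negPn/negP => /GK'[y].
  rewrite mulf_eq0 negb_or => /andP[/gK0 Ky _] xy; apply: nK.
  exact: K0K Ky (le_trans xy eps_rho).
have cg2 : continuous g2.
  move=> x; apply: (@cvgM _ _ (nbhs x)); first exact: cg.
  by apply: (@cvgB _ _ _ (nbhs x)); [exact: cvg_cst|exact: cth].
have g20 x : 0 <= g2 x.
  by have /andP[? ?] := th01 x; rewrite mulr_ge0// subr_ge0.
have g2K x : ~ K x -> g2 x = 0 by move=> /gK; rewrite /g2 => ->; rewrite mul0r.
pose Q2 w := Qf w + 2 * eps * \1_W w.
have iW2 : (lebN R N).-integrable setT (EFin \o (fun w => 2 * eps * \1_W w)).
  exact: (integrableZl measurableT (2 * eps) iW).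
have iQ2 : (lebN R N).-integrable setT (EFin \o Q2).
  exact: (integrableD measurableT Qi iW2).
have vQ2 : \int[lebN R N]_x Q2 x = \int[lebN R N]_x Qf x + 2 * eps * mu_W.
  by rewrite /Q2 RintegralD// RintegralZl.
have cgt : continuous gt by exact: elip_continuous Lgt.
have cD : continuous (fun x => G x - gt x).
  by move=> x; apply: (@cvgB _ _ _ (nbhs x)); [exact: cG|exact: cgt].
have hQ2 w tau : s - h0 <= tau <= t -> t0 < tau -> calibrated r E z (w, tau) ->
    pairing r (z (w, tau)) w (fun x => G x + g2 x) <= Q2 w.
  move=> h1 h2 cal; have [z1 _] := cal.
  have -> : (fun x => G x + g2 x) = (fun x => g x + (G x - gt x)).
    by apply/funext => x; rewrite /g2 /gt; ring.
  rewrite (pairingD z1 w cg cD) /Q2; apply: lerD; first exact: hQ.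
  apply: (le_trans (ler_norm _)).
  have [wW|wW] := pselect (W w).
    rewrite indicE mem_set//= mulr1; apply: (pairing_abs_le z1 cD); first exact: ltW.
    by move=> x _; exact: Gg.
  rewrite indicE memNset//= mulr0 -(mulr0 2).
  apply: (pairing_abs_le z1 cD) => // x Bx.
  have nK : ~ K (w + x).
    move=> /Krho h; apply: wW; rewrite /W /=.
    have -> : w = (w + x) + - x by rewrite addrK.
    apply: (le_trans (enormD _ _)); rewrite enormN lerD//.
    exact: closure_eball.
  by rewrite /gt GK// gK// mul0r subr0 normr0.
have := flow_smooth cG cg2 G0 g20 GK g2K nG iQ2 hQ2.
rewrite vQ2.
set V := \int[lebN R N]_x (G x * _); set G2 := \int[lebN R N]_x g2 x.
set q := \int[lebN R N]_x Qf x; set T := \int[lebN R N]_x _ => hfl.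
have cdd : continuous (fun x => d (x, t) - d (x, s)).
  by move=> x; apply: (@cvgB _ _ _ (nbhs x)); exact: cd.
have Ldt v : t0 < v < t1 -> elip 1 (dt v).
  by move=> v01; apply: elip_max; [exact: Ld|exact: elip_weak (elip_cst _)].
have cdt : continuous (fun x => dt t x - dt s x).
  by move=> x; apply: (@cvgB _ _ _ (nbhs x)); exact: elip_continuous (Ldt _ _) _.
have iV : (lebN R N).-integrable setT (EFin \o (fun x => G x * (d (x, t) - d (x, s)))).
  apply: (Cc_integrable cK); last by move=> x /GK ->; rewrite mul0r.
  by move=> x; apply: (@cvgM _ _ (nbhs x)); [exact: cG|exact: cdd].
have iT : (lebN R N).-integrable setT (EFin \o (fun x => g x * (dt t x - dt s x))).
  apply: (Cc_integrable cK); last by move=> x /gK ->; rewrite mul0r.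
  by move=> x; apply: (@cvgM _ _ (nbhs x)); [exact: cg|exact: cdt].
have i2 : (lebN R N).-integrable setT (EFin \o g2) by exact: (Cc_integrable cK cg2 g2K).
have i2M := integrableZl measurableT (M * (t - s)) i2.
have iKe := integrableZl measurableT (eps * (Bg + Dm)) iK.
have hVT : V + M * (t - s) * G2 <= T + eps * (Bg + Dm) * mu_K.
  rewrite /V /G2 /T /mu_K -(RintegralZl _ measurableT i2) -(RintegralZl _ measurableT iK).
  rewrite -RintegralD// -RintegralD//.
  apply: le_Rintegral => //.
  - exact: (integrableD measurableT iV i2M).
  - exact: (integrableD measurableT iT iKe).
  move=> x _; rewrite indicE.
  have [Kx|nK] := pselect (K x); last first.
    by rewrite memNset//= GK// g2K// gK// !mul0r !mulr0.
  rewrite mem_set//= mulr1.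
  have h1 : G x * (d (x, t) - d (x, s)) <= gt x * (d (x, t) - d (x, s)) + eps * Dm.
    rewrite -lerBlDl -mulrBl; apply: (le_trans (ler_norm _)).
    by rewrite normrM ler_pM// dDm.
  have h2 : th x * (d (x, t) - d (x, s)) + (1 - th x) * (M * (t - s)) <=
      dt t x - dt s x + eps.
    have /andP[th0 th1] := th01 x.
    have k1 : th x * (d (x, t) - d (x, s)) <= th x * (dt t x - dt s x).
      have [thp|h] := ltP 0 (th x); last first.
        have -> : th x = 0 by apply/le_anti; rewrite h th0.
        by rewrite !mul0r.
      rewrite ler_pM2l//.
      have ls : lev s < d (x, s).
          move: thp; rewrite /th lt_min ltr01/= lt_max ltxx/=.
          by rewrite pmulr_rgt0 ?invr_gt0// subr_gt0.
      have -> : dt s x = d (x, s) by rewrite /dt; apply/max_idPl; exact: ltW.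
      by rewrite lerD2r /dt le_max lexx.
    have k2 : (1 - th x) * (M * (t - s)) <= (1 - th x) * (dt t x - dt s x + eps).
      have [thp|h] := ltP (th x) 1; last first.
        have -> : th x = 1 by apply/le_anti; rewrite h th1.
        by rewrite subrr !mul0r.
      rewrite ler_pM2l ?subr_gt0//.
      have ls : d (x, s) < lev s + eps.
        move: thp; rewrite /th gt_min ltxx/= gt_max ltr01/=.
        by rewrite mulrC ltr_pdivrMr// mul1r ltrBlDl.
      have u1 : dt s x <= lev s + eps.
        by rewrite /dt ge_max (ltW ls) lerDl ltW.
      have u2 : lev t <= dt t x by rewrite /dt le_max lexx orbT.
      move: u1 u2; rewrite /lev; lra.
    have k3 : (1 - th x) * eps <= eps by rewrite ler_piMl ?(ltW eps0)// gerBl.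
    lra.
  have h3 := ler_wpM2l (g0 x) h2.
  have h4 : g x * eps <= Bg * eps.
    by apply: ler_wpM2r; [exact: ltW|have /andP[] := gB x].
  move: h1 h3 h4; rewrite /gt /g2; lra.
move: hfl hVT epsC; rewrite /C.
exact: flow_lip_arith.
Qed.

End testing_one_flow.

(** * Real induction and the time regularity of superflows *)

Section real_induction.
Context {R : realType}.

Lemma real_induction (P : R -> Prop) (a : R) :
  P a -> (forall t, a < t -> (forall s, a <= s < t -> P s) -> P t) ->
  (forall t, a <= t -> P t -> exists2 tau, 0 < tau & forall s, t < s < t + tau -> P s) ->
  forall t, a <= t -> P t.
Proof.
move=> Pa Pl Pr t at_; apply: contrapT => nP.
pose S := [set s | a <= s /\ ~ P s].
have St : S t by [].
have Slb : has_lbound S by exists a => s [].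
have Si : has_inf S by split; [exists t|].
pose m := inf S.
have am : a <= m by apply: lb_le_inf; [exists t|move=> s []].
have below s : a <= s < m -> P s.
  move=> /andP[as_ sm]; apply: contrapT => nPs.
  by have := ge_inf Slb (conj as_ nPs : S s); rewrite leNgt sm.
have Pm : P m.
  have := am; rewrite le_eqVlt => /predU1P[<-//|am'].
  exact: Pl.
have [tau tau0 Ptau] := Pr m am Pm.
have [s [as_ nPs] sm] : exists2 s, S s & s < m + tau by exact: (inf_adherent tau0 Si).
have ms : m <= s by exact: (ge_inf Slb (conj as_ nPs : S s)).
apply: nPs.
move: ms; rewrite le_eqVlt => /predU1P[<-//|ms].
by apply: Ptau; rewrite ms.
Qed.

Lemma real_induction_down (P : R -> Prop) (a b : R) : a <= b ->
  P b -> (forall t, a <= t < b -> (forall s, t < s <= b -> P s) -> P t) ->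
  (forall t, a < t <= b -> P t ->
    exists2 tau, 0 < tau & forall s, t - tau < s < t -> a <= s -> P s) ->
  P a.
Proof.
move=> ab Pb Pl Pr.
pose P' (x : R) := a <= b - x -> P (b - x).
suff /(_ (b - a)) H : forall x, 0 <= x -> P' x.
  by move: H; rewrite /P' subKr subr_ge0; apply.
apply: real_induction => [|x x0 H|x x0 Px].
- by rewrite /P' subr0.
- move=> ax; apply: Pl; first by rewrite ax ltrBlDr ltrDl.
  move=> s /andP[s1 s2]; have := H (b - s); rewrite /P' subKr; apply.
    by rewrite subr_ge0 s2/= ltrBlDl -ltrBlDr.
  by apply: (le_trans ax); exact: ltW.
- have [h|h] := ltP a (b - x); last first.
    exists 1 => // s /andP[s1 _] as_; exfalso.
    have : b - s < b - x by rewrite ltrD2l ltrN2.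
    by move=> /(le_lt_trans as_) /lt_le_trans/(_ h); rewrite ltxx.
  have [|tau tau0 Ptau] := Pr (b - x) _ (Px (ltW h)).
    by rewrite h/= lerBlDr lerDl.
  exists tau => // s /andP[s1 s2] as_; apply: Ptau => //.
  by rewrite ltrD2l ltrN2 s1 andbT -addrA -opprD ltrD2l ltrN2.
Qed.

Lemma left_seq (a t : R) : a < t -> exists s : nat -> R,
  (forall n, a <= s n < t) /\ s @ \oo --> t.
Proof.
move=> at_; exists (fun n => t - (t - a) / n.+2%:R); split=> [n|].
  rewrite lerBrDr -lerBrDl ler_pdivrMr// -[leLHS]mulr1.
  by rewrite ler_pM2l ?subr_gt0// ler1n/= ltrBlDr ltrDl divr_gt0// subr_gt0.
rewrite -[X in _ --> X]subr0; apply: cvgB; first exact: cvg_cst.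
rewrite -(mulr0 (t - a)); apply: cvgM; first exact: cvg_cst.
apply/cvgrPdist_le => e e0; near=> n.
rewrite sub0r normrN ger0_norm ?invr_ge0//.
apply: (@le_trans _ _ n.+1%:R^-1); first by rewrite lef_pV2 ?posrE// ler_nat.
by apply: ltW; near: n; exact: near_infty_natSinv_lt (PosNum e0).
Unshelve. all: by end_near. Qed.

End real_induction.

Section distance.
Context {R : realType} {N : nat}.
Implicit Types (A : set 'rV[R]_N) (x y : 'rV[R]_N).

Lemma dist_pt_fin x A : A !=set0 -> dist_pt x A \is a fin_num.
Proof.
move=> [y Ay]; rewrite ge0_fin_numE ?dist_pt_ge0//.
apply: (@le_lt_trans _ _ (enorm (x - y))%:E); last by rewrite ltry.
by apply: ge_ereal_inf; exists (enorm (x - y))%:E => //; exists y.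
Qed.

Lemma dist_pt_le x y A : A y -> fine (dist_pt x A) <= enorm (x - y).
Proof.
move=> Ay; rewrite -lee_fin fineK; last by apply: dist_pt_fin; exists y.
by apply: ge_ereal_inf; exists (enorm (x - y))%:E => //; exists y.
Qed.

Lemma dist_pt_ge x A (c : R) : A !=set0 -> (forall y, A y -> c <= enorm (x - y)) ->
  c <= fine (dist_pt x A).
Proof.
move=> A0 H; rewrite -lee_fin fineK ?dist_pt_fin//.
by apply: le_ereal_inf_tmp => _ [y Ay <-]; rewrite lee_fin H.
Qed.

Lemma dist_pt_adherent x A (e : R) : A !=set0 -> 0 < e ->
  exists2 y, A y & enorm (x - y) < fine (dist_pt x A) + e.
Proof.
move=> A0 e0; apply: contrapT => H.
have : fine (dist_pt x A) + e <= fine (dist_pt x A).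
  apply: dist_pt_ge => // y Ay; rewrite leNgt; apply/negP => h.
  by apply: H; exists y.
by rewrite leNgt ltrDl e0.
Qed.

Lemma elip_dist_pt A : A !=set0 -> elip 1 (fun x => fine (dist_pt x A)).
Proof.
move=> A0 x y; rewrite mul1r lerBlDr; apply/ler_addgt0Pr => e e0.
have [w Aw h] := dist_pt_adherent y A0 e0.
apply: (le_trans (dist_pt_le x Aw)).
have := enorm_dist_triangle y x w; lra.
Qed.

End distance.

Section superflow_geometry.
Context {R : realType} {N : nat} (r : R) (E0 : set 'rV[R]_N) (E : set ('rV[R]_N * R)).
Hypothesis hE : weak_superflow r E0 E.
Local Notation d := (dfun E).

Let hb := (hE.2.2.2.2).1.
Let hc := (hE.2.2.2.2).2.1.

Lemma kuratowski_left_seq (a t : R) : 0 <= a < t -> exists s : nat -> R,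
  (forall n, a <= s n < t) /\ kuratowski (fun n => slice E (s n)) (slice E t).
Proof.
move=> /andP[a0 at_]; have [s [s1 s2]] := left_seq at_.
exists s; split => //; apply: hc => [|n|//]; first exact: le_lt_trans at_.
by have /andP[h1 ->] := s1 n; rewrite (le_trans a0 h1).
Qed.

(** The empty set has empty neighbourhoods, so emptiness propagates to the right by
    the one-sided continuity (b), and across limits from the left by the Kuratowski
    continuity (c). *)
Lemma slice_empty_after s : 0 <= s -> slice E s = set0 ->
  forall u, s <= u -> slice E u = set0.
Proof.
move=> s0 Es; apply: real_induction => // [t st H|t st Et].
- have s0t : 0 <= s < t by rewrite s0.
  have [S [S1 [_ S2]]] := kuratowski_left_seq s0t.
  apply/seteqP; split => // y /S2[x Ex _].
  by have := Ex 0%N; rewrite (H _ (S1 0%N)).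
- have [tau tau0 Htau] := @hb t 1 (le_trans s0 st) ltr01.
  exists tau => // v tv; apply/seteqP; split => // y /(Htau v tv).
  by rewrite Et => -[].
Qed.

Lemma slice_nonempty s : 0 <= s -> (s%:E < Text E)%E -> slice E s !=set0.
Proof.
move=> s0 sT; apply/set0P/negP => /eqP Es.
have H := slice_empty_after s0 Es.
have [e0 es] : exists2 e, 0 < e & ((s + e)%:E < Text E)%E.
  move: sT; case: (Text E) => [T| |]//; rewrite ?lte_fin => sT.
    by exists ((T - s) / 2); rewrite ?lte_fin ?divr_gt0 ?subr_gt0//; lra.
  by exists 1; rewrite ?ltry.
rewrite ltNge; apply/negP/negPn; apply: ge_ereal_inf.
exists (s + e0)%:E => //; exists (s + e0) => //; split; first by rewrite ltr_wpDl.
by move=> u su; apply: H; apply: le_trans su; rewrite lerDl ltW.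
Qed.

Lemma slice_empty_Text t0 s : 0 <= t0 -> (Text E <= t0%:E)%E -> t0 < s -> slice E s = set0.
Proof.
move=> t00 Tt ts; have Ts : (Text E < s%:E)%E by apply: (le_lt_trans Tt); rewrite lte_fin.
have [_ [u [u0 Hu] <-] us] := ereal_inf_lt Ts.
by apply: Hu; move: us; rewrite lte_fin => /ltW.
Qed.

Lemma elip_dfun s : 0 <= s -> (s%:E < Text E)%E -> elip 1 (fun x => d (x, s)).
Proof. by move=> s0 sT; exact: (elip_dist_pt (slice_nonempty s0 sT)). Qed.

Lemma dfun_right_lsc (t e : R) : 0 <= t -> 0 < e -> exists2 tau, 0 < tau &
  forall s x, t < s < t + tau -> (s%:E < Text E)%E -> d (x, t) - e <= d (x, s).
Proof.
move=> t0 e0; have [tau tau0 H] := hb t0 e0; exists tau => // s x ts sT.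
have s0 : 0 <= s by have /andP[h _] := ts; apply: (le_trans t0); exact: ltW.
apply: dist_pt_ge; first exact: slice_nonempty.
move=> y /(H s ts)[y' Ey']; rewrite /eball/= => yy'.
have := dist_pt_le x Ey'; have := enorm_dist_triangle y x y'.
by rewrite /dfun /=; lra.
Qed.

(** Kuratowski continuity is a statement on sequences; this extracts from a failing
    property the sequence to which it applies. *)
Lemma left_near_or_seq (t : R) (P : R -> Prop) : 0 < t ->
  (exists2 eta, 0 < eta & forall tau, t - eta <= tau < t -> 0 <= tau -> P tau) \/
  exists s : nat -> R, [/\ forall n, 0 <= s n < t, s @ \oo --> t & forall n, ~ P (s n)].
Proof.
move=> t0; have [h|h] := pselect (exists2 eta, 0 < eta &
  forall tau, t - eta <= tau < t -> 0 <= tau -> P tau); [by left|right].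
have H (n : nat) : exists s : R, [/\ t - n.+1%:R^-1 <= s < t, 0 <= s & ~ P s].
  apply: contrapT => Hn; apply: h; exists n.+1%:R^-1 => // tau h1 h2.
  by apply: contrapT => nP; apply: Hn; exists tau.
have [s Hs] := choice H; exists s; split.
- by move=> n; have [/andP[_ ->] -> _] := Hs n.
- apply/cvgrPdist_le => e e0; near=> n; have [/andP[h1 h2] _ _] := Hs n.
  rewrite ger0_norm; last by rewrite subr_ge0 ltW.
  rewrite lerBlDr -lerBlDl.
  apply: (le_trans _ h1); rewrite lerD2l lerN2.
  by apply: ltW; near: n; exact: near_infty_natSinv_lt (PosNum e0).
- by move=> n; have [] := Hs n.
Unshelve. all: by end_near. Qed.

(** One half of Kuratowski convergence provides points of E(tau) near the projection
    of x on E(t), hence an upper bound. If the lower bound failed along a sequence,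
    almost nearest points would stay in a compact set and cluster at a point of
    E(t) that is too close to x. *)
Lemma dfun_left_cont (t e : R) (x : 'rV[R]_N) : 0 < t -> (t%:E < Text E)%E -> 0 < e ->
  exists2 eta, 0 < eta & forall tau, t - eta <= tau <= t -> 0 <= tau ->
    `|d (x, tau) - d (x, t)| <= e.
Proof.
move=> t0 tT e0; have Et := slice_nonempty (ltW t0) tT.
suff [eta eta0 H] : exists2 eta, 0 < eta & forall tau, t - eta <= tau < t -> 0 <= tau ->
    `|d (x, tau) - d (x, t)| <= e.
  exists eta => // tau /andP[h1]; rewrite le_eqVlt => /predU1P[->|h2] h3.
    by rewrite subrr normr0 ltW.
  by apply: H => //; rewrite h1.
have [//|[s [s1 s2 s3]]] := left_near_or_seq
  (fun tau => `|d (x, tau) - d (x, t)| <= e) t0.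
have sT n : ((s n)%:E < Text E)%E.
  by apply: lt_trans tT; rewrite lte_fin; have /andP[] := s1 n.
have s0 n : 0 <= s n by have /andP[] := s1 n.
have [K1 K2] := hc t0 s1 s2; exfalso.
have e20 : 0 < e / 2 by rewrite divr_gt0.
have [y Ey xy] := dist_pt_adherent x Et e20.
have [y_ Ey_ yy] := K2 y Ey.
have cl (u : 'rV[R]_N) : continuous (fun v : 'rV[R]_N => enorm (u - v)).
  apply: (@elip_continuous _ _ 1) => v v'; rewrite (enormB_sym v).
  have -> : v' - v = (u - v) - (u - v') by rewrite opprB [RHS]addrC addrA subrK.
  exact: elip_enorm.
have upper : \forall n \near \oo, d (x, s n) <= d (x, t) + e.
  have cxy : (fun n => enorm (x - y_ n)) @ \oo --> enorm (x - y).
    exact: (@cvg_comp _ _ _ y_ (fun v => enorm (x - v)) \oo (nbhs y) _ yy (cl x y)).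
  have /cvgrPdist_lt /(_ _ e20) := cxy.
  apply: filterS => n; rewrite ltr_distlC => /andP[_ h].
  apply: (le_trans (dist_pt_le x (Ey_ n))).
  by move: xy h; rewrite /dfun /=; lra.
have [m _ Hm] := upper.
pose S n := s (n + m)%N.
have lower n : d (x, S n) < d (x, t) - e.
  have := s3 (n + m)%N => /negP; rewrite -ltNge ltr_normr => /orP[h|h].
    by have := Hm (n + m)%N (leq_addl _ _); rewrite /S; lra.
  by rewrite /S; lra.
have S1 n : 0 <= S n < t by exact: s1.
have S2 : S @ \oo --> t by have := s2; rewrite -(cvg_shiftn m).
have [K3 _] := hc t0 S1 S2.
have near_pt n : exists v, slice E (S n) v /\ enorm (x - v) <= d (x, t) - e / 2.
  have [v Ev vx] := dist_pt_adherent x (slice_nonempty (s0 _) (sT (n + m)%N)) e20.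
  exists v; split => //; have := lower n; rewrite /S /dfun /= => h.
  by move: vx h; rewrite /dfun/=; lra.
have [w Hw] := choice near_pt.
pose C := [set v : 'rV[R]_N | enorm (x - v) <= d (x, t) - e / 2].
have cC : compact C.
  apply: bounded_closed_compact.
    apply: (@bounded_enorm _ _ _ (enorm x + (d (x, t) - e / 2))) => v Cv.
    have -> : v = x - (x - v) by rewrite opprB addrC subrK.
    by apply: (le_trans (enormD _ _)); rewrite enormN lerD2l.
  apply: (@closed_comp _ _ (fun v : 'rV[R]_N => enorm (x - v))
    [set c | c <= d (x, t) - e / 2]).
    by move=> v _; exact: cl.
  exact: closed_le.
have [v [Cv clv]] : C `&` cluster (w @ \oo) !=set0.
  by apply: cC; exists 0 => // n _; exact: (Hw n).2.
have Ev := K3 w (fun n => (Hw n).1) v clv.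
by have := dist_pt_le x Ev; move: Cv; rewrite /C /dfun /=; lra.
Unshelve. all: by end_near. Qed.

(** Distances are 1-Lipschitz in space, so pointwise convergence is uniform on
    compact sets. *)
Lemma dfun_left_unif_cont (K : set 'rV[R]_N) (t e : R) : compact K ->
  0 < t -> (t%:E < Text E)%E -> 0 < e ->
  exists2 eta, 0 < eta & forall tau x, t - eta <= tau <= t -> 0 <= tau -> K x ->
    `|d (x, tau) - d (x, t)| <= e.
Proof.
move=> cK t0 tT e0.
pose P eta x := forall tau, t - eta <= tau <= t -> 0 <= tau -> `|d (x, tau) - d (x, t)| <= e.
have nc := (compact_near_coveringP K).1 cK R (0 : R)^'+ P _.
have e30 : 0 < e / 3 by rewrite divr_gt0.
have H x : K x -> \forall x' \near x & eta \near (0 : R)^'+, P eta x'.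
  move=> Kx; have [eta eta0 He] := dfun_left_cont x t0 tT e30.
  exists (eball x (e / 3), [set u | u <= eta]); first split => /=.
  - apply: open_nbhs_nbhs; split; first exact: open_eball.
    by rewrite /eball/= subrr enorm0.
  - exact: nbhs_right_le.
  move=> [x' u] /= [xx' ue] tau /andP[h1 h2] h3.
  have ta : t - eta <= tau <= t.
    by rewrite h2 andbT; apply: le_trans h1; rewrite lerD2l lerN2.
  have tauT : (tau%:E < Text E)%E by apply: le_lt_trans tT; rewrite lee_fin.
  have Lip v : 0 <= v -> (v%:E < Text E)%E -> `|d (x', v) - d (x, v)| <= e / 3.
    move=> v0 vT; have L := elip_dfun v0 vT.
    have := L x' x; have := L x x'; rewrite (enormB_sym x) !mul1r.
    move: xx'; rewrite /eball/= ler_norml => h4 h5 h6.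
    by apply/andP; split; lra.
  have := He tau ta h3; have := Lip _ (ltW t0) tT; have := Lip _ h3 tauT.
  rewrite !ler_norml => /andP[a1 a2] /andP[a3 a4] /andP[a5 a6].
  by apply/andP; split; lra.
have {}nc : \forall eta \near (0 : R)^'+, K `<=` P eta by exact: nc.
near (0 : R)^'+ => eta; exists eta; first by near: eta; exact: nbhs_right_gt.
have KP : K `<=` P eta by near: eta.
by move=> tau x h1 h2 /KP; exact.
Unshelve. all: by end_near. Qed.

End superflow_geometry.

(** * Derivative from the left of the truncated distance *)

Lemma max_dist_le (R : realType) (a b c e : R) :
  `|a - b| <= e -> `|Num.max a c - Num.max b c| <= e.
Proof.
rewrite !ler_norml => /andP[h1 h2].
by apply/andP; split; rewrite /Num.max; case: ltP => ?; case: ltP => ?; lra.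
Qed.

Section osc_reflect.
Context {R : realType} {N : nat} (r : R) (r0 : 0 < r).

Lemma oscB_reflect L (f : 'rV[R]_N -> R) w c : elip L f ->
  oscB r w (fun x => c - f x) <= oscB r w f.
Proof.
move=> Lf.
have h1 : supB r w (fun x => c - f x) <= c + supB r w (fun x => - f x).
  by apply: supB_le => // x Bx; rewrite lerD2l; exact: (supB_ub w (elipN Lf) Bx).
have h2 : supB r w (fun x => - (c - f x)) <= supB r w f - c.
  by apply: supB_le => // x Bx; rewrite opprB lerD2r; exact: (supB_ub w Lf Bx).
by rewrite /oscB; lra.
Qed.

Definition gain (f g : 'rV[R]_N -> R) (w : 'rV[R]_N) : R :=
  oscB r w (fun x => f x + g x) - oscB r w f.

End osc_reflect.

Section flow_left.
Context {R : realType} {N : nat} (r : R) (r0 : 0 < r).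
Variables (E0 : set 'rV[R]_N) (E : set ('rV[R]_N * R)).
Hypothesis hE : weak_superflow r E0 E.
Local Notation X := ('rV[R]_N * R)%type.
Variable z : X -> {measure set ('rV[R]_N * 'rV[R]_N) -> \bar R}.
Variables Dp Dn dp dn : {measure set X -> \bar R}.
Local Notation Q := (@strip R N (Text E)).
Local Notation d := (dfun E).
Hypothesis hDiv : is_Div r (Text E) z Dp Dn.
Hypothesis hdt : is_dt (Q `\` E) d dp dn.
Hypothesis hle : signed_le_on (Q `\` E) Dp Dn dp dn.
Hypothesis hcal : {ae lebST R N, forall q, Q q -> calibrated r E z q}.
Variables (K : set 'rV[R]_N) (rho t0 t1 lam M : R).
Hypothesis cK : compact K.
Hypothesis Krho : forall x, K x -> enorm x <= rho.
Hypotheses (t00 : 0 <= t0) (t1T : (t1%:E <= Text E)%E).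
Hypothesis lam0 : 0 < lam.
Hypothesis hK : forall x t, K x -> t0 < t < t1 -> lam <= d (x, t).
Hypothesis M0 : 0 <= M.
Hypothesis hM : forall A, measurable A -> A `<=` [set q | Q q /\ lam <= d q] ->
  (Dp A <= M%:E * lebST R N A)%E.
Variables (K0 : set 'rV[R]_N) (rho0 : R).
Hypothesis rho00 : 0 < rho0.
Hypothesis K0K : forall x y, K0 y -> `|x - y| <= rho0 -> K x.
Variable c0 : R.

(** The distance, truncated from below at a level that rises at the constant
    speed M. *)
Definition dtrunc (u : R) (x : 'rV[R]_N) : R := Num.max (d (x, u)) (c0 + M * u).

Variables (sg : R) (g : 'rV[R]_N -> R) (Lg Bg : R).
Hypothesis sg01 : t0 < sg < t1.
Hypothesis Lipg : elip Lg g.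
Hypothesis gB : forall x, 0 <= g x <= Bg.
Hypothesis gK0 : forall x, g x != 0 -> K0 x.

Let W : set 'rV[R]_N := [set w | enorm w <= rho + r].

Let time_ok u : t0 < u < t1 -> 0 < u /\ (u%:E < Text E)%E.
Proof.
move=> /andP[u0 u1]; split; first exact: le_lt_trans u0.
by apply: (lt_le_trans _ t1T); rewrite lte_fin.
Qed.

Lemma elip_dtrunc u : t0 < u < t1 -> elip 1 (dtrunc u).
Proof.
move=> /time_ok[u0 uT]; apply: elip_max; last exact: elip_weak (elip_cst _).
exact: (elip_dfun hE (ltW u0) uT).
Qed.

Let g_out w x : ~ W w -> closure (eball 0 r) x -> g (w + x) = 0.
Proof.
move=> wW Bx; apply/eqP/negPn/negP => /gK0 Kx; apply: wW.
have Kwx : K (w + x) by apply: (K0K Kx); rewrite subrr normr0 ltW.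
rewrite /W /= -(addrK x w).
by apply: (le_trans (enormD _ _)); rewrite enormN lerD ?Krho// closure_eball.
Qed.

Lemma gain_out w : ~ W w -> gain r (dtrunc sg) g w = 0.
Proof.
move=> wW; have Lt := elip_dtrunc sg01; have Ls := elipD Lt Lipg.
apply/eqP; rewrite subr_eq0 eq_le; apply/andP; split.
  rewrite -[leRHS]addr0 -(mulr0 2); apply: (oscB_perturb _ Lt) => // x Bx.
  by rewrite g_out// addr0 subrr normr0.
rewrite -[leRHS]addr0 -(mulr0 2); apply: (oscB_perturb _ Ls) => // x Bx.
by rewrite g_out// addr0 subrr normr0.
Qed.

Lemma gain_integrable : (lebN R N).-integrable setT (EFin \o gain r (dtrunc sg) g).
Proof.
have Lt := elip_dtrunc sg01; have Ls := elipD Lt Lipg.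
have Lo := elipD (elip_oscB r0 Ls) (elipN (elip_oscB r0 Lt)).
have cW : compact W.
  apply: bounded_closed_compact; last exact: closed_enorm_le.
  exact: (@bounded_enorm _ _ _ (rho + r)).
apply: (Cc_integrable cW); first exact: elip_continuous Lo.
exact: gain_out.
Qed.

(** Shortly before sg the distance is uniformly close to its value at sg, so that
    at those times the field pairs with g by at most the gain at sg, up to 4 e on
    the set of the w whose ball meets the support of g. *)
Lemma flow_left (e : R) : 0 < e -> exists2 eta, 0 < eta &
  forall s, sg - eta < s < sg -> t0 < s ->
  - (2 * r)^-1 * ((sg - s) * (\int[lebN R N]_w gain r (dtrunc sg) g w +
      4 * e * \int[lebN R N]_w \1_W w)) <=
  \int[lebN R N]_x (g x * (dtrunc sg x - dtrunc s x)).
Proof.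
move=> e0; have [sg0 sgT] := time_ok sg01.
pose KK : set 'rV[R]_N := [set y | enorm y <= rho + r + r].
have cKK : compact KK.
  apply: bounded_closed_compact; last exact: closed_enorm_le.
  exact: (@bounded_enorm _ _ _ (rho + r + r)).
have [eta eta0 Heta] := dfun_left_unif_cont hE cKK sg0 sgT e0.
(* Half of eta is left for the time cutoff, which starts before s. *)
exists (eta / 2); first by rewrite divr_gt0.
move=> s /andP[s1 s2] t0s.
have mW : measurable W by apply: rV_closed_measurable; exact: closed_enorm_le.
have iW : (lebN R N).-integrable setT (EFin \o \1_W).
  by apply: integrable_indic_lty => //; exact: (lebN_bounded_lty mW (c := rho + r)).
pose Qf w := gain r (dtrunc sg) g w + 4 * e * \1_W w.
have iW4 : (lebN R N).-integrable setT (EFin \o (fun w => 4 * e * \1_W w)).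
  exact: (integrableZl measurableT (4 * e) iW).
have iQ : (lebN R N).-integrable setT (EFin \o Qf).
  exact: (integrableD measurableT gain_integrable iW4).
have vQ : \int[lebN R N]_w Qf w = \int[lebN R N]_w gain r (dtrunc sg) g w +
    4 * e * \int[lebN R N]_w \1_W w.
  by rewrite /Qf RintegralD//; [rewrite RintegralZl|exact: gain_integrable].
have Lt := elip_dtrunc sg01; have Ls := elipD Lt Lipg.
have hQ w tau : s - eta / 2 <= tau <= sg -> t0 < tau -> calibrated r E z (w, tau) ->
    pairing r (z (w, tau)) w g <= Qf w.
  move=> /andP[u1 u2] u3 [z1 z2].
  have u01 : t0 < tau < t1 by rewrite u3 (le_lt_trans u2)//; case/andP: sg01.
  have [u0 uT] := time_ok u01.
  have [wW|wW] := pselect (W w); last first.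
    rewrite /Qf gain_out// indicE memNset//= mulr0 addr0.
    apply: (pairing_le z1 (elip_continuous Lipg)) => // x y Bx By.
    by rewrite !g_out// subrr.
  rewrite /Qf indicE mem_set//= mulr1.
  (* A calibration tests all truncations alike, so the level may be taken at time
     sg, although the distance is taken at time tau. *)
  pose dh x := Num.max (d (x, tau)) (c0 + M * sg).
  have Ldu := elip_dfun hE (ltW u0) uT.
  have Ldh : elip 1 dh.
    by apply: elip_max => //; exact: elip_weak (elip_cst _).
  have close x : closure (eball 0 r) x -> `|dh (w + x) - dtrunc sg (w + x)| <= e.
    move=> Bx; have KKx : KK (w + x).
      by apply: (le_trans (enormD _ _)); rewrite lerD// closure_eball.
    have : sg - eta <= tau <= sg.
      by rewrite u2 andbT; apply: le_trans u1; lra.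
    by move=> /Heta /(_ (ltW u0) KKx); exact: max_dist_le.
  have h1 := pairing_gain r0 z1 Ldu z2 (c0 + M * sg) Lipg.
  have h2 : oscB r w (fun x => dh x + g x) <=
      oscB r w (fun x => dtrunc sg x + g x) + 2 * e.
    apply: (oscB_perturb _ Ls) => // x Bx.
    by rewrite opprD addrACA subrr addr0; exact: close.
  have h3 : oscB r w (dtrunc sg) <= oscB r w dh + 2 * e.
    by apply: (oscB_perturb _ Ldh) => // x Bx; rewrite distrC; exact: close.
  apply: (le_trans h1); rewrite /gain -/dh; lra.
rewrite -vQ.
have Ld u : t0 < u < t1 -> elip 1 (fun x => d (x, u)).
  by move=> /time_ok[u0 uT]; exact: (elip_dfun hE (ltW u0) uT).
have lcd u eps : t0 < u < t1 -> 0 < eps -> exists2 eta : R, 0 < eta &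
    forall tau x, u - eta <= tau <= u -> t0 < tau -> K x ->
    `|d (x, tau) - d (x, u)| <= eps.
  move=> /time_ok[u0 uT] eps0.
  have [v v0 Hv] := dfun_left_unif_cont hE cK u0 uT eps0; exists v => // tau x h1 h2.
  by apply: Hv => //; apply: (le_trans t00); exact: ltW.
have sgt1 : sg < t1 by case/andP: sg01.
have eta20 : 0 < eta / 2 by rewrite divr_gt0.
exact: (@flow_lip R N r r0 E z Dp Dn dp dn hDiv hdt hle hcal K t0 t1 lam M cK t00 t1T
  lam0 hK M0 hM Ld lcd s sg (eta / 2) t0s s2 sgt1 eta20 K0 rho0 rho00 K0K g Lg Bg
  Lipg gB gK0 Qf iQ hQ c0).
Qed.

End flow_left.

(** * The comparison principle *)

Lemma left_estimate_arith (R : realType) (ir ts P P' e2 mW Ia Ib e : R) :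
  0 <= ir -> 0 <= ts -> P + P' <= 0 -> ir * (16 * e2 * mW) <= e ->
  - ir * (ts * (P + 4 * e2 * mW)) <= Ia ->
  - ir * (ts * (P' + 4 * e2 * mW)) <= Ib -> - 2 * (Ia + Ib) <= e * ts.
Proof.
move=> ir0 ts0 PP he h1 h2.
have a1 : ir * ts * (P + P') <= 0 by rewrite mulr_ge0_le0// mulr_ge0.
have a2 : ts * (ir * (16 * e2 * mW)) <= ts * e by rewrite ler_wpM2l.
lra.
Qed.

Section comparison_principle.
Context {R : realType} {N : nat} (r : R) (r0 : 0 < r).
Variables (dE dG : R -> 'rV[R]_N -> R) (K K0 : set 'rV[R]_N) (rho t0 t1 D : R).
Hypothesis cK : compact K.
Hypothesis Krho : forall x, K x -> enorm x <= rho.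
Hypothesis K0K : K0 `<=` K.
Hypothesis D0 : 0 < D.
Hypothesis dE0 : forall u x, t0 <= u -> 0 <= dE u x.
Hypothesis dG0 : forall u x, t0 <= u -> 0 <= dG u x.
Hypothesis LE : forall u, t0 < u < t1 -> elip 1 (dE u).
Hypothesis LG : forall u, t0 < u < t1 -> elip 1 (dG u).

(** Heuristically: the derivative from the left of f, tested with g, is at least
    minus the gain divided by 2r. The radius rho + r contains all the centres of
    balls that meet the support of g. *)
Definition left_gain_bound (f : R -> 'rV[R]_N -> R) :=
  forall sg g Lg Bg, t0 < sg < t1 -> elip Lg g -> (forall x, 0 <= g x <= Bg) ->
    (forall x, g x != 0 -> K0 x) ->
    (lebN R N).-integrable setT (EFin \o gain r (f sg) g) /\
    forall e, 0 < e -> exists2 eta, 0 < eta &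
      forall s, sg - eta < s < sg -> t0 < s ->
      - (2 * r)^-1 * ((sg - s) * (\int[lebN R N]_w gain r (f sg) g w +
        4 * e * \int[lebN R N]_w \1_[set w | enorm w <= rho + r] w)) <=
      \int[lebN R N]_x (g x * (f sg x - f s x)).

Definition right_lsc (f : R -> 'rV[R]_N -> R) :=
  forall u e, t0 <= u < t1 -> 0 < e -> exists2 tau, 0 < tau &
    forall s x, u < s < u + tau -> s < t1 -> f u x - e <= f s x.

Hypothesis gainE : left_gain_bound dE.
Hypothesis gainG : left_gain_bound dG.
Hypothesis lscE : right_lsc dE.
Hypothesis lscG : right_lsc dG.
Hypothesis supp0 : forall s x, t0 < s < t1 -> dE s x + dG s x < D -> K0 x.
Hypothesis init : forall x, D <= dE t0 x + dG t0 x.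

Definition gap (s : R) (x : 'rV[R]_N) : R := Num.max 0 (D - (dE s x + dG s x)).

Let gap_ge0 s x : 0 <= gap s x.
Proof. by rewrite /gap le_max lexx. Qed.

Let gap_leD s x : t0 <= s -> gap s x <= D.
Proof.
move=> s0; rewrite /gap ge_max (ltW D0)/=.
by have := dE0 x s0; have := dG0 x s0; lra.
Qed.

Let gap_supp s x : t0 < s < t1 -> gap s x != 0 -> K0 x.
Proof.
move=> s01 h; apply: (supp0 s01); move: h; apply: contraNT; rewrite -leNgt => h.
by rewrite /gap; apply/eqP/max_idPl; rewrite subr_le0.
Qed.

Let gap_out s x : t0 <= s < t1 -> ~ K x -> gap s x = 0.
Proof.
move=> /andP[]; rewrite le_eqVlt => /predU1P[<- _ _|s0 s1 nK].
  by rewrite /gap; apply/max_idPl; rewrite subr_le0.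
by apply/eqP/negPn/negP => /gap_supp; rewrite s0 s1 => /(_ isT)/K0K.
Qed.

Let elip_gap s : t0 < s < t1 -> elip (1 + 1) (gap s).
Proof.
move=> s01; apply: elip_max; first exact: elip_weak (elip_cst 0).
move=> x y; have := LE s01 y x; have := LG s01 y x.
by rewrite (enormB_sym x) !mul1r; lra.
Qed.

Let gap_init x : gap t0 x = 0.
Proof. by rewrite /gap; apply/max_idPl; rewrite subr_le0. Qed.

Let gap_cont s : t0 <= s < t1 -> continuous (gap s).
Proof.
move=> /andP[]; rewrite le_eqVlt => /predU1P[<- _|s0 s1].
  rewrite (_ : gap t0 = cst 0); first exact: cst_continuous.
  by apply/funext => x; exact: gap_init.
by apply: (@elip_continuous _ _ (1 + 1)); apply: elip_gap; rewrite s0.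
Qed.

Let sq_integrable s : t0 <= s < t1 ->
  (lebN R N).-integrable setT (EFin \o (fun x => gap s x ^+ 2)).
Proof.
move=> s01; apply: (Cc_integrable cK); last by move=> x nK; rewrite gap_out// expr0n.
move=> x; rewrite (_ : (fun x => gap s x ^+ 2) = (fun x => gap s x * gap s x)); last first.
  by apply/funext => y; rewrite expr2.
by apply: (@cvgM _ _ (nbhs x)); exact: gap_cont.
Qed.

Let m s := \int[lebN R N]_x (gap s x ^+ 2).

(** Put h = D - dG. Adding the gap turns dE into max (dE, h) and dG into
    D - min (dE, h), so the sum of the gains is nonpositive by submodularity. *)
Lemma gap_gain_le0 s w : t0 < s < t1 ->
  gain r (dE s) (gap s) w + gain r (dG s) (gap s) w <= 0.
Proof.
move=> s01; have L1 := LE s01; have L2 := LG s01.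
pose h x := D - dG s x.
have Lh : elip 1 h.
  by move=> x y; rewrite /h enormB_sym; have := L2 y x; lra.
have e1 : (fun x => dE s x + gap s x) = (fun x => Num.max (dE s x) (h x)).
  by apply/funext => x; rewrite /gap /h /Num.max; case: ltP => ?; case: ltP => ?; lra.
have e2 : (fun x => dG s x + gap s x) = (fun x => D - Num.min (dE s x) (h x)).
  by apply/funext => x; rewrite /gap /h /Num.max /Num.min; case: ltP => ?; case: ltP => ?; lra.
have e3 : h = (fun x => D - dG s x) by [].
have Lm := elip_min L1 Lh.
have h1 := oscB_submodular r0 w L1 Lh.
have h2 := oscB_reflect r0 w D Lm.
have h3 : oscB r w h <= oscB r w (dG s) by exact: (oscB_reflect r0 w D L2).
rewrite /gain e1 e2; lra.
Qed.

Let gap_left sg e : t0 < sg < t1 -> 0 < e -> exists2 eta, 0 < eta &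
  forall s, sg - eta < s < sg -> t0 < s -> m sg - m s <= e * (sg - s).
Proof.
move=> sg01 e0; have /andP[sg0 sg1] := sg01.
have gB x : 0 <= gap sg x <= D by rewrite gap_ge0 gap_leD// ltW.
have gS x : gap sg x != 0 -> K0 x by exact: gap_supp.
have [iE HE] := gainE sg01 (elip_gap sg01) gB gS.
have [iG HG] := gainG sg01 (elip_gap sg01) gB gS.
set mW := \int[lebN R N]_w \1_[set w | enorm w <= rho + r] w in HE HG.
have mW0 : 0 <= mW by apply: Rintegral_ge0.
have ir0 : 0 <= (2 * r)^-1 by rewrite invr_ge0 mulr_ge0// ltW.
pose e2 := e / (16 * (2 * r)^-1 * mW + 1).
have den : 0 < 16 * (2 * r)^-1 * mW + 1 by rewrite ltr_wpDl// !mulr_ge0.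
have e20 : 0 < e2 by rewrite divr_gt0.
have he : (2 * r)^-1 * (16 * e2 * mW) <= e.
  have -> : (2 * r)^-1 * (16 * e2 * mW) =
      e * (16 * (2 * r)^-1 * mW) / (16 * (2 * r)^-1 * mW + 1).
    by rewrite /e2; ring.
  by rewrite ler_pdivrMr// ler_pM2l// lerDl.
have [n1 n10 H1] := HE e2 e20; have [n2 n20 H2] := HG e2 e20.
exists (Num.min n1 n2); first by rewrite lt_min n10.
move=> s /andP[s1 s2] t0s.
have s1' : sg - n1 < s.
  by apply: le_lt_trans s1; rewrite lerD2l lerN2 ge_min lexx.
have s1'' : sg - n2 < s.
  by apply: le_lt_trans s1; rewrite lerD2l lerN2 ge_min lexx orbT.
have s01 : t0 < s < t1 by rewrite t0s (lt_trans s2).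
have h1 := H1 s _ t0s; rewrite s1' s2 in h1; have {}h1 := h1 isT.
have h2 := H2 s _ t0s; rewrite s1'' s2 in h2; have {}h2 := h2 isT.
have PP : \int[lebN R N]_w gain r (dE sg) (gap sg) w +
    \int[lebN R N]_w gain r (dG sg) (gap sg) w <= 0.
  rewrite -RintegralD//.
  have <- : \int[lebN R N]_w (0 : R) = 0 by rewrite /Rintegral integral0.
  apply: le_Rintegral => //.
  - exact: (integrableD measurableT iE iG).
  - exact: integrable0.
  - by move=> w _; exact: gap_gain_le0.
have ci f : (forall u, t0 < u < t1 -> elip 1 (f u)) ->
    (lebN R N).-integrable setT (EFin \o (fun x => gap sg x * (f sg x - f s x))).
  move=> Lf; have c1 := elip_continuous (Lf _ sg01); have c2 := elip_continuous (Lf _ s01).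
  apply: (Cc_integrable cK); last by move=> x nK; rewrite gap_out ?mul0r// sg1 ltW.
  move=> x; apply: (@cvgM _ _ (nbhs x)); first by apply: gap_cont; rewrite sg1 ltW.
  by apply: (@cvgB _ _ _ (nbhs x)); [exact: c1|exact: c2].
have iEE := ci _ LE; have iGG := ci _ LG.
have s0' : t0 <= s < t1 by rewrite (ltW t0s) (lt_trans s2).
have sg0' : t0 <= sg < t1 by rewrite (ltW sg0).
have sum_int := integrableD measurableT iEE iGG.
apply: (le_trans _ (left_estimate_arith ir0 _ PP he h1 h2)); last first.
  by rewrite subr_ge0 ltW.
rewrite /m -RintegralB//; try exact: sq_integrable.
rewrite -RintegralD// -RintegralZl//.
apply: le_Rintegral => //.
- exact: (integrableB measurableT (sq_integrable sg0') (sq_integrable s0')).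
- exact: (integrableZl measurableT (- 2) sum_int).
move=> x _; have g1 := gap_ge0 sg x; have g2 := gap_ge0 s x.
have k1 : D - (dE s x + dG s x) <= gap s x by rewrite /gap le_max lexx orbT.
have k2 : gap sg x * (dE sg x + dG sg x) = gap sg x * (D - gap sg x).
  have [->|gn] := eqVneq (gap sg x) 0; first by rewrite !mul0r.
  have ge : gap sg x = D - (dE sg x + dG sg x).
    by move: gn; rewrite /gap /Num.max; case: ltP => //; rewrite eqxx.
  by congr (_ * _); rewrite ge opprB [RHS]addrC subrK.
have k3 : gap sg x * (D - (dE s x + dG s x)) <= gap sg x * gap s x by rewrite ler_wpM2l.
have k4 : 0 <= (gap sg x - gap s x) ^+ 2 by exact: sqr_ge0.
nra.
Qed.

Let gap_right s t e : t0 <= s -> s < t -> t < t1 -> 0 < e ->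
  exists2 u, s < u < t & m u <= m s + e.
Proof.
move=> s0 st tt1 e0.
have mK : measurable K by apply: rV_closed_measurable; exact: compact_closed.
have iK : (lebN R N).-integrable setT (EFin \o \1_K).
  by apply: integrable_indic_lty => //; exact: (lebN_bounded_lty mK Krho).
pose mK1 := \int[lebN R N]_x (\1_K x : R).
have mK0 : 0 <= mK1 by apply: Rintegral_ge0.
have s01 : t0 <= s < t1 by rewrite s0 (lt_trans st).
pose d := Num.min 1 (e / ((4 * D + 4) * (mK1 + 1))).
have den : 0 < (4 * D + 4) * (mK1 + 1).
  by apply: mulr_gt0; [rewrite addr_gt0// mulr_gt0|rewrite ltr_wpDl].
have d0 : 0 < d by rewrite lt_min ltr01 divr_gt0.
have d1 : d <= 1 by rewrite ge_min lexx.
have de : d * (4 * D + 4) * mK1 <= e.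
  have : d <= e / ((4 * D + 4) * (mK1 + 1)) by rewrite ge_min lexx orbT.
  rewrite ler_pdivlMr// => h; apply: le_trans h; rewrite mulrA ler_wpM2l ?lerDl//.
  by rewrite mulr_ge0 ?ltW// addr_gt0// mulr_gt0.
have [n1 n10 H1] := lscE s01 d0; have [n2 n20 H2] := lscG s01 d0.
pose n := Num.min (t - s) (Num.min n1 n2).
have n0 : 0 < n by rewrite !lt_min subr_gt0 st n10.
pose u := s + n / 2.
have su : s < u by rewrite ltrDl divr_gt0.
have nn : n / 2 < n by rewrite ltr_pdivrMr// ltr_pMr// ltr1n.
have ub v : n <= v -> u < s + v by move=> nv; rewrite ltrD2l (lt_le_trans nn).
have ut : u < t.
  by have := ub (t - s); rewrite ge_min lexx [s + _]addrC subrK; apply.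
exists u; first by rewrite su.
have u1 : s < u < s + n1 by rewrite su ub// !ge_min lexx !orbT.
have u2 : s < u < s + n2 by rewrite su ub// !ge_min lexx !orbT.
have ut1 : u < t1 by exact: lt_trans tt1.
have u01 : t0 <= u < t1 by rewrite ut1 andbT (le_trans s0)// ltW.
have iKe := integrableZl measurableT (d * (4 * D + 4)) iK.
apply: (@le_trans _ _ (m s + d * (4 * D + 4) * mK1)); last by rewrite lerD2l.
rewrite /m /mK1 -(RintegralZl _ measurableT iK).
have iS := sq_integrable s01.
rewrite -RintegralD//; apply: le_Rintegral => //.
- exact: sq_integrable.
- exact: (integrableD measurableT iS iKe).
move=> x _; rewrite indicE.
have [Kx|nK] := pselect (K x); last by rewrite memNset// !gap_out// mulr0 addr0.
rewrite mem_set//= mulr1.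
have h1 := H1 u x u1 ut1; have h2 := H2 u x u2 ut1.
have h3 : gap u x <= gap s x + 2 * d.
  by rewrite /gap /Num.max; case: ltP => ?; case: ltP => ?; lra.
have g1 := gap_ge0 u x; have g2 := gap_ge0 s x; have g3 := gap_leD x s0.
have h4 : gap u x ^+ 2 <= (gap s x + 2 * d) ^+ 2.
  by rewrite ler_pXn2r// nnegrE addr_ge0// mulr_ge0// ltW.
apply: (le_trans h4).
have h5 : d * gap s x <= d * D by rewrite ler_wpM2l// ltW.
have h6 : d * d <= d * 1 by rewrite ler_wpM2l// ltW.
nra.
Qed.

(** The integral m(t) of the squared gap vanishes at t0. By convexity of the square
    and the two gain bounds, its upper derivative from the left is nonpositive, and
    by right lower semicontinuity of dE and dG it cannot jump up immediately after
    a time. Induction on the reals, downwards from t to t0, gives m(t) <= 0. It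
    runs downwards because the left estimate only reaches earlier times. *)
Lemma comparison_principle t x : t0 < t < t1 -> D <= dE t x + dG t x.
Proof.
move=> /andP[t0t tt1]; have t01 : t0 < t < t1 by rewrite t0t.
have t01' : t0 <= t < t1 by rewrite ltW.
have m0 : m t0 = 0.
  rewrite /m; under eq_Rintegral do rewrite gap_init expr0n.
  by rewrite /Rintegral integral0.
have mt e : 0 < e -> m t <= e * (t - t0).
  move=> e0; rewrite -[m t]subr0 -m0.
  apply: (@real_induction_down _ (fun s => m t - m s <= e * (t - s)) t0 t).
  - exact: ltW.
  - by rewrite !subrr mulr0.
  - move=> s /andP[s0 st] H; apply/ler_addgt0Pr => e1 e10.
    have [u /andP[su ut] hu] := gap_right s0 st tt1 e10.
    have := H u; rewrite su (ltW ut) => /(_ isT) h.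
    have : e * (t - u) <= e * (t - s).
      by apply: ler_wpM2l; [exact: ltW|rewrite lerD2l lerN2 ltW].
    lra.
  - move=> s /andP[s0 st] hs.
    have s01 : t0 < s < t1 by rewrite s0 (le_lt_trans st).
    have [eta eta0 H] := gap_left s01 e0.
    exists (Num.min eta (s - t0)); first by rewrite lt_min eta0 subr_gt0.
    move=> u /andP[u1 u2] _.
    have u3 : t0 < u.
      apply: le_lt_trans u1; rewrite lerBrDr -lerBrDl ge_min lexx orbT//.
    have u4 : s - eta < u < s.
      rewrite u2 andbT; apply: le_lt_trans u1.
      by rewrite lerD2l lerN2 ge_min lexx.
    by have := H u u4 u3; lra.
have mt0 : m t <= 0.
  apply/ler_addgt0Pr => e e0; rewrite add0r.
  have tt0 : 0 < t - t0 by rewrite subr_gt0.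
  have := mt (e / (t - t0)); rewrite divfK ?gt_eqF//; apply.
  by rewrite divr_gt0.
rewrite leNgt; apply/negP => hx.
have gx : 0 < gap t x by rewrite /gap lt_max subr_gt0 hx orbT.
pose c := gap t x / 2; have c0 : 0 < c by rewrite divr_gt0.
pose U := [set y | c < gap t y].
have Ux : U x by rewrite /U /= /c ltr_pdivrMr// ltr_pMr// ltr1n.
have oU : open U.
  apply: (@open_comp _ _ (gap t) [set v | c < v]); last exact: open_gt.
  by move=> y _; exact: gap_cont.
have mU := rV_open_measurable oU.
have UK : U `<=` K.
  move=> y Uy; apply: contrapT => nK; move: Uy; rewrite /U /= gap_out//.
  by rewrite ltNge ltW.
have Uoo : (lebN R N U < +oo)%E.
  by apply: (lebN_bounded_lty mU (c := rho)) => y /UK; exact: Krho.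
have iU : (lebN R N).-integrable setT (EFin \o \1_U) by exact: integrable_indic_lty.
have U0 := lebN_open_gt0 oU Ux.
have : c ^+ 2 * fine (lebN R N U) <= m t.
  have -> : fine (lebN R N U) = \int[lebN R N]_y (\1_U y : R).
    by rewrite /Rintegral integral_indic// setIT.
  rewrite /m -(RintegralZl _ measurableT iU); apply: le_Rintegral => //.
  - exact: (integrableZl measurableT (c ^+ 2) iU).
  - exact: sq_integrable.
  move=> y _; rewrite indicE; have [Uy|nU] := pselect (U y).
    rewrite mem_set//= mulr1 ler_pXn2r// ?nnegrE ?(ltW c0)//.
    exact: ltW.
  by rewrite memNset//= mulr0 sqr_ge0.
move=> /le_trans /(_ mt0); rewrite leNgt => /negP; apply.
by rewrite mulr_gt0 ?exprn_gt0// fine_gt0// U0.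
Qed.

End comparison_principle.

(** * Separation of two flows *)

(** This gathers what the comparison needs from the differential inequality; the
    speed M depends only on the distance lam to E. *)
Lemma superflow_left_gain (R : realType) (N : nat) (r : R) (r0 : 0 < r)
    (E0 : set 'rV[R]_N) (E : set ('rV[R]_N * R)) (hE : weak_superflow r E0 E)
    (lam : R) (lam0 : 0 < lam) :
  exists2 M : R, 0 <= M & forall (K K0 : set 'rV[R]_N) (rho rho0 t0 t1 c0 : R),
    compact K -> (forall x, K x -> enorm x <= rho) -> 0 <= t0 ->
    (t1%:E <= Text E)%E ->
    (forall x t, K x -> t0 < t < t1 -> lam <= dfun E (x, t)) ->
    0 < rho0 -> (forall x y, K0 y -> `|x - y| <= rho0 -> K x) ->
    left_gain_bound r K0 rho t0 t1 (dtrunc E M c0).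
Proof.
have [z [_ [Dp [Dn [hDiv [dp [dn [hdt hle]]] hcal hLoo]]]]] := hE.2.2.2.2.2.2.
have [M M0 hM] := in_Linfty_le (hLoo lam lam0).
exists M => // K K0 rho rho0 t0 t1 c0 cK Krho t00 t1T hK rho00 K0K sg g Lg Bg sg01 Lipg gB gK0.
split.
  exact: (gain_integrable r0 hE M Krho t00 t1T rho00 K0K c0 sg01 Lipg gK0).
move=> e e0.
exact: (flow_left r0 hE hDiv hdt hle hcal cK Krho t00 t1T lam0 hK M0 hM rho00 K0K
  c0 sg01 Lipg gB gK0 e0).
Qed.

Section local_comparison.
Context {R : realType} {N : nat} (r : R) (r0 : 0 < r).
Variables (E0 G0 : set 'rV[R]_N) (E G : set ('rV[R]_N * R)).
Hypothesis hE : weak_superflow r E0 E.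
Hypothesis hG : weak_superflow r G0 G.
Variables (D t0 : R).
Hypotheses (D0 : 0 < D) (t00 : 0 <= t0).
Hypotheses (tE : (t0%:E < Text E)%E) (tG : (t0%:E < Text G)%E).
Hypothesis bd : bounded_set (slice E t0) \/ bounded_set (slice G t0).
Hypothesis sep : forall e f, slice E t0 e -> slice G t0 f -> D <= enorm (e - f).

Let dist_sum x : D <= dfun E (x, t0) + dfun G (x, t0).
Proof.
apply/ler_addgt0Pr => e e0; have e20 : 0 < e / 2 by rewrite divr_gt0.
have [y Ey xy] := dist_pt_adherent x (slice_nonempty hE t00 tE) e20.
have [w Gw xw] := dist_pt_adherent x (slice_nonempty hG t00 tG) e20.
have := sep Ey Gw; have := enorm_dist_triangle x y w.
rewrite (enormB_sym y x) /dfun /=; lra.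
Qed.

Let LE := elip_dfun hE t00 tE.
Let LG := elip_dfun hG t00 tG.

Let shell (a b : R) : set 'rV[R]_N := [set x |
  (a <= dfun E (x, t0) /\ dfun E (x, t0) <= b) /\
  (a <= dfun G (x, t0) /\ dfun G (x, t0) <= b)].

Let bounded_shell (F : set ('rV[R]_N * R)) (b : R) : slice F t0 !=set0 ->
  bounded_set (slice F t0) -> exists rho, forall x, dfun F (x, t0) <= b -> enorm x <= rho.
Proof.
move=> F0 [M [_ HM]]; exists (b + 1 + N%:R * (M + 1)) => x xb.
have [y Fy xy] := dist_pt_adherent x F0 ltr01.
have y1 : `|y| <= M + 1 by apply: (HM (M + 1)) => //; rewrite ltrDl.
have h1 : enorm y <= N%:R * (M + 1).
  by apply: (le_trans (enorm_le_norm y)); rewrite ler_wpM2l.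
have := enormD (x - y) y; rewrite subrK.
by move: xy xb; rewrite /dfun /=; lra.
Qed.

Let compact_shell a b : compact (shell a b).
Proof.
have [rho Hrho] : exists rho, forall x, shell a b x -> enorm x <= rho.
  case: bd => h.
    have [rho H] := bounded_shell b (slice_nonempty hE t00 tE) h.
    by exists rho => x [[_ /H]].
  have [rho H] := bounded_shell b (slice_nonempty hG t00 tG) h.
  by exists rho => x [_ [_ /H]].
apply: bounded_closed_compact; first exact: bounded_enorm Hrho.
have cl (f : 'rV[R]_N -> R) : elip 1 f -> closed [set x | a <= f x /\ f x <= b].
  move=> Lf; apply: closedI.
    apply: (@closed_comp _ _ f [set c | a <= c]); last exact: closed_ge.
    by move=> x _; exact: (elip_continuous Lf).
  apply: (@closed_comp _ _ f [set c | c <= b]); last exact: closed_le.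
  by move=> x _; exact: (elip_continuous Lf).
exact: closedI (cl _ LE) (cl _ LG).
Qed.

Let time_room (F : set ('rV[R]_N * R)) : (t0%:E < Text F)%E ->
  exists2 tau, 0 < tau & ((t0 + tau)%:E <= Text F)%E.
Proof.
case: (Text F) => [T| |]//; rewrite ?lte_fin => tT.
  by exists (T - t0); rewrite ?subr_gt0// addrC subrK.
by exists 1; rewrite ?leey.
Qed.

(** Distances are truncated at levels that start from D/4 and stay below D/2, so
    that two points of the flows closer than D have a midpoint where the truncated
    distances add up to less than D. On the other hand, where E(t0) is closer
    than D/8, the distance to G(t0) is at least 7D/8, it loses at most D/32 for a
    short time, and together with the level D/4 it exceeds D; the same holds with
    E and G exchanged. Hence the gap is supported in the shell K0, near which both
    flows stay at distance at least D/32, and the comparison principle applies. *)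
Lemma local_comparison : exists2 tau, 0 < tau & forall t, t0 < t < t0 + tau ->
  forall e f, slice E t e -> slice G t f -> D <= enorm (e - f).
Proof.
have lam0 : 0 < D / 32 by rewrite divr_gt0.
have [M M0 HM] := superflow_left_gain r0 hE lam0.
have [M' M'0 HM'] := superflow_left_gain r0 hG lam0.
have [a a0 Ha] := dfun_right_lsc hE t00 lam0.
have [b b0 Hb] := dfun_right_lsc hG t00 lam0.
have [aT aT0 HaT] := time_room tE; have [bT bT0 HbT] := time_room tG.
(* During a time cM the level rises by at most D / 16. *)
pose cM := D / 16 / (M + 1); pose cM' := D / 16 / (M' + 1).
have cM0 : 0 < cM by rewrite !divr_gt0// ltr_wpDl.
have cM'0 : 0 < cM' by rewrite !divr_gt0// ltr_wpDl.
pose tau := Num.min (Num.min a b) (Num.min (Num.min aT bT) (Num.min cM cM')).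
have tau0 : 0 < tau by rewrite !lt_min a0 b0 aT0 bT0 cM0.
exists tau => //; pose t1 := t0 + tau.
have taua : tau <= a by rewrite !ge_min lexx.
have taub : tau <= b by rewrite !ge_min lexx !orbT.
have tauaT : tau <= aT by rewrite !ge_min lexx !orbT.
have taubT : tau <= bT by rewrite !ge_min lexx !orbT.
have taucM : tau <= cM by rewrite !ge_min lexx !orbT.
have taucM' : tau <= cM' by rewrite !ge_min lexx !orbT.
have t1E : (t1%:E <= Text E)%E.
  by apply: (le_trans _ HaT); rewrite lee_fin lerD2l.
have t1G : (t1%:E <= Text G)%E.
  by apply: (le_trans _ HbT); rewrite lee_fin lerD2l.
have ltE u : u < t1 -> (u%:E < Text E)%E.
  by move=> h; apply: (lt_le_trans _ t1E); rewrite lte_fin.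
have ltG u : u < t1 -> (u%:E < Text G)%E.
  by move=> h; apply: (lt_le_trans _ t1G); rewrite lte_fin.
have lE u x : t0 < u < t1 -> dfun E (x, t0) - D / 32 <= dfun E (x, u).
  move=> /andP[u0 u1]; apply: Ha; last exact: ltE.
  by rewrite u0 (lt_le_trans u1)// lerD2l.
have lG u x : t0 < u < t1 -> dfun G (x, t0) - D / 32 <= dfun G (x, u).
  move=> /andP[u0 u1]; apply: Hb; last exact: ltG.
  by rewrite u0 (lt_le_trans u1)// lerD2l.
pose K := shell (D / 16) (3 * D); pose K0 := shell (D / 8) (2 * D).
have cK : compact K by exact: compact_shell.
have [rho Krho] := compact_enorm_bounded cK.
pose rho0 := D / 16 / (N%:R + 1).
have N1 : 0 < N%:R + 1 :> R by rewrite ltr_wpDl.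
have rho00 : 0 < rho0 by rewrite !divr_gt0.
have K0K x y : K0 y -> `|x - y| <= rho0 -> K x.
  move=> [[y1 y2] [y3 y4]] xy.
  have h : enorm (x - y) <= D / 16.
    apply: (le_trans (enorm_le_norm _)); apply: (@le_trans _ _ ((N%:R + 1) * rho0)).
      by apply: ler_pM => //; rewrite lerDl.
    by rewrite /rho0 mulrC divfK// gt_eqF.
  have := LE x y; have := LE y x; have := LG x y; have := LG y x.
  rewrite (enormB_sym y x) !mul1r => h1 h2 h3 h4.
  by split; split; lra.
have hKE x t : K x -> t0 < t < t1 -> D / 32 <= dfun E (x, t).
  by move=> [[h _] _] /(lE t x); lra.
have hKG x t : K x -> t0 < t < t1 -> D / 32 <= dfun G (x, t).
  by move=> [_ [h _]] /(lG t x); lra.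
(* With these constants the levels are D / 4 + M (t - t0) and D / 4 + M' (t - t0). *)
pose cE := D / 4 - M * t0; pose cG := D / 4 - M' * t0.
have gE := HM K K0 rho rho0 t0 t1 cE cK Krho t00 t1E hKE rho00 K0K.
have gG := HM' K K0 rho rho0 t0 t1 cG cK Krho t00 t1G hKG rho00 K0K.
have levE u : t0 <= u -> D / 4 <= cE + M * u.
  by move=> h; have := ler_wpM2l M0 h; rewrite /cE; lra.
have levG u : t0 <= u -> D / 4 <= cG + M' * u.
  by move=> h; have := ler_wpM2l M'0 h; rewrite /cG; lra.
have truncE u x : t0 <= u -> D / 4 <= dtrunc E M cE u x.
  by move=> /levE h; rewrite /dtrunc le_max h orbT.
have truncG u x : t0 <= u -> D / 4 <= dtrunc G M' cG u x.
  by move=> /levG h; rewrite /dtrunc le_max h orbT.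
have geE u x : dfun E (x, u) <= dtrunc E M cE u x by rewrite /dtrunc le_max lexx.
have geG u x : dfun G (x, u) <= dtrunc G M' cG u x by rewrite /dtrunc le_max lexx.
have lipE u : t0 < u < t1 -> elip 1 (dtrunc E M cE u).
  exact: (elip_dtrunc hE M t00 t1E cE).
have lipG u : t0 < u < t1 -> elip 1 (dtrunc G M' cG u).
  exact: (elip_dtrunc hG M' t00 t1G cG).
have D40 : 0 <= D / 4 by rewrite divr_ge0// ltW.
have lsc (F : set ('rV[R]_N * R)) (F0 : set 'rV[R]_N) (hF : weak_superflow r F0 F) m c :
    0 <= m -> (t1%:E <= Text F)%E ->
    right_lsc t0 t1 (dtrunc F m c).
  move=> m0 tF u e /andP[u0 u1] e0.
  have [v v0 Hv] := dfun_right_lsc hF (le_trans t00 u0) e0.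
  exists v => // s x us st1.
  have sF : (s%:E < Text F)%E by apply: (lt_le_trans _ tF); rewrite lte_fin.
  have h := Hv s x us sF.
  have h2 : m * u <= m * s by rewrite ler_wpM2l// ltW//; case/andP: us.
  rewrite /dtrunc lerBlDr ge_max; apply/andP; split.
    have : dfun F (x, s) <= Num.max (dfun F (x, s)) (c + m * s) by rewrite le_max lexx.
    by lra.
  have : c + m * s <= Num.max (dfun F (x, s)) (c + m * s) by rewrite le_max lexx orbT.
  by lra.
have supp0 s x : t0 < s < t1 -> dtrunc E M cE s x + dtrunc G M' cG s x < D -> K0 x.
  move=> s01; have s0 : t0 <= s by apply: ltW; case/andP: s01.
  have h1 := truncE s x s0; have h2 := truncG s x s0.
  have h3 := geE s x; have h4 := geG s x; have h5 := lE s x s01; have h6 := lG s x s01.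
  have h7 := dist_sum x.
  by move=> h; split; split; rewrite leNgt; apply/negP => k; lra.
have init x : D <= dtrunc E M cE t0 x + dtrunc G M' cG t0 x.
  by apply: (le_trans (dist_sum x)); exact: lerD.
have K0K' : K0 `<=` K.
  by move=> x K0x; apply: (K0K x x) => //; rewrite subrr normr0 ltW.
have pos1 u x : t0 <= u -> 0 <= dtrunc E M cE u x.
  by move=> h; apply: (le_trans D40); exact: truncE.
have pos2 u x : t0 <= u -> 0 <= dtrunc G M' cG u x.
  by move=> h; apply: (le_trans D40); exact: truncG.
move=> t t01 e f Ee Gf; rewrite leNgt; apply/negP => ef.
have := comparison_principle r0 cK Krho K0K' D0 pos1 pos2 lipE lipG gE gG
  (lsc E E0 hE M cE M0 t1E) (lsc G G0 hG M' cG M'0 t1G) supp0 init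
  (2^-1 *: (e + f)) t01.
have half (x y : 'rV[R]_N) : enorm (2^-1 *: (x + y) - x) = enorm (x - y) / 2.
  have -> : 2^-1 *: (x + y) - x = - (2^-1 *: (x - y)) :> 'rV[R]_N.
    by apply/rowP => i; rewrite !mxE; field.
  by rewrite enormN enormZ ger0_norm ?invr_ge0// mulrC.
have t0t : t0 <= t by apply: ltW; case/andP: t01.
have tt1 : t - t0 < tau by case/andP: t01 => _; rewrite ltrBlDl.
have small m c : 0 <= m -> c = D / 4 - m * t0 -> tau <= D / 16 / (m + 1) ->
    c + m * t < D / 2.
  move=> m0 -> htau.
  have : m * (t - t0) <= D / 16.
    apply: (@le_trans _ _ (m * (D / 16 / (m + 1)))).
      by rewrite ler_wpM2l// (le_trans (ltW tt1)).
    by rewrite mulrA ler_pdivrMr ?ltr_wpDl// mulrC ler_pM2l ?divr_gt0// lerDl.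
  by lra.
have h1 : dtrunc E M cE t (2^-1 *: (e + f)) < D / 2.
  rewrite /dtrunc gt_max (small M cE)// andbT.
  apply: (le_lt_trans (dist_pt_le _ Ee)); rewrite /= half; lra.
have h2 : dtrunc G M' cG t (2^-1 *: (e + f)) < D / 2.
  rewrite /dtrunc gt_max (small M' cG)// andbT.
  apply: (le_lt_trans (dist_pt_le _ Gf)).
  by rewrite /= [e + f]addrC half (enormB_sym f); lra.
lra.
Qed.

End local_comparison.

Lemma cobounded_meet (R : realType) (N : nat) (A B : set 'rV[R]_N) : (0 < N)%N ->
  bounded_set (~` A) -> bounded_set (~` B) -> exists2 x, A x & B x.
Proof.
move=> N0 [MA [_ HA]] [MB [_ HB]].
pose c := `|MA| + `|MB| + 2.
have c0 : 0 <= c by rewrite !addr_ge0.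
have nx : c <= `|const_mx c : 'rV[R]_N|.
  have := coord_le_norm (const_mx c : 'rV[R]_N) (Ordinal N0).
  by rewrite mxE ger0_norm.
have far (F : set 'rV[R]_N) M : (forall y, M < y -> forall x, (~` F) x -> `|x| <= y) ->
    M + 1 < c -> F (const_mx c).
  move=> H Mc; apply: contrapT => nF; have := H (M + 1) _ _ nF.
  rewrite ltrDl ltr01 => /(_ isT) h.
  by have := le_lt_trans (le_trans nx h) Mc; rewrite ltxx.
exists (const_mx c); [apply: (far A MA) => //|apply: (far B MB) => //].
  by have := ler_norm MA; have := normr_ge0 MB; rewrite /c; lra.
by have := ler_norm MB; have := normr_ge0 MA; rewrite /c; lra.
Qed.

(** The separation passes to limits from the left by Kuratowski continuity, and
    holds for a short time to the right by the local comparison, or because one of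
    the flows becomes extinct. Since the flows are apart at time 0, their
    complements cannot both be bounded, so one of the flows is bounded. *)
Lemma superflows_stay_apart (R : realType) (N : nat) (hN : (0 < N)%N) (r : R) (r0 : 0 < r)
    (E0 G0 : set 'rV[R]_N) (E G : set ('rV[R]_N * R)) (D : R) (D0 : 0 < D)
    (hE : weak_superflow r E0 E) (hG : weak_superflow r G0 G) :
  (forall e f, slice E 0 e -> slice G 0 f -> D <= enorm (e - f)) ->
  forall t, 0 <= t -> forall e f, slice E t e -> slice G t f -> D <= enorm (e - f).
Proof.
move=> sep0.
have bd t : 0 <= t -> bounded_set (slice E t) \/ bounded_set (slice G t).
  move=> t0; have [h|hE'] := hE.2.2.2.1; first by left; exact: h.
  have [h|hG'] := hG.2.2.2.1; first by right; exact: h.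
  have [x Ex Gx] := cobounded_meet hN (hE' 0 (lexx _)) (hG' 0 (lexx _)).
  by have := sep0 x x Ex Gx; rewrite subrr enorm0 leNgt D0.
apply: real_induction => // [t t0 H e f Ee Gf|t t0 H].
- apply/ler_addgt0Pr => eps eps0.
  have [hcE hcG] := (hE.2.2.2.2.2.1, hG.2.2.2.2.2.1).
  have [s [s1 s2]] := left_seq t0.
  have s0 n : 0 <= s n < t by exact: s1.
  have [_ /(_ _ Ee)[x Ex xe]] := hcE t t0 s s0 s2.
  have [_ /(_ _ Gf)[y Gy yf]] := hcG t t0 s s0 s2.
  have e20 : 0 < eps / 2 by rewrite divr_gt0.
  have near_pt (u : nat -> 'rV[R]_N) (l : 'rV[R]_N) : u @ \oo --> l ->
      \forall n \near \oo, enorm (u n - l) < eps / 2.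
    move=> ul; have : nbhs l (eball l (eps / 2)).
      by apply: open_nbhs_nbhs; split; [exact: open_eball|rewrite /eball/= subrr enorm0].
    by move=> /ul.
  near \oo => n.
  have h1 : enorm (x n - e) < eps / 2 by near: n; exact: near_pt.
  have h2 : enorm (y n - f) < eps / 2 by near: n; exact: near_pt.
  have h3 := H _ (s1 n) _ _ (Ex n) (Gy n).
  have h4 := enorm_dist_triangle e (x n) (y n).
  have h5 := enorm_dist_triangle f e (y n).
  by move: h2; rewrite (enormB_sym (y n) f); lra.
- have [tE|tE] := ltP t%:E (Text E); last first.
    by exists 1 => // s /andP[ts _] e f; rewrite (slice_empty_Text t0 tE ts).
  have [tG|tG] := ltP t%:E (Text G); last first.
    by exists 1 => // s /andP[ts _] e f _; rewrite (slice_empty_Text t0 tG ts).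
  exact: (local_comparison r0 hE hG D0 t0 tE tG (bd t t0) H).
Unshelve. all: by end_near. Qed.

Lemma closure_sep (R : realType) (N : nat) (A B : set 'rV[R]_N) (D : R) :
  (forall x y, A x -> B y -> D <= enorm (x - y)) ->
  forall x y, A x -> closure B y -> D <= enorm (x - y).
Proof.
move=> H x y Ax By; apply/ler_addgt0Pr => e e0.
have /By[z [Bz yz]] : nbhs y (eball y e).
  by apply: open_nbhs_nbhs; split; [exact: open_eball|rewrite /eball/= subrr enorm0].
have := H x z Ax Bz; have := enorm_dist_triangle y x z.
by move: yz; rewrite /eball/= (enormB_sym z); lra.
Qed.

Theorem theorem3p21 (R : realType) (N : nat) (hN : (0 < N)%N)
  (r : R) (hr : 0 < r)
  (E0 F0 : set 'rV[R]_N) (E F : set ('rV[R]_N * R))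
  (hE0 : closed E0) (hE0b : compact (boundary E0))
  (hF0 : closed F0) (hF0b : compact (boundary F0))
  (hE : weak_superflow r E0 E) (hF : weak_subflow r F0 F)
  (hD : (0 < dist_set E0 (~` F0))%E) :
  forall t : R, 0 <= t ->
    (dist_set E0 (~` F0) <= dist_set (slice E t) (~` slice F t))%E.
Proof.
move=> t t0; apply: le_ereal_inf_tmp => _ [[e f] /= [Ee Ff] <-].
rewrite leNgt; apply/negP => lt_ef.
have [D [D0 DD eD]] : exists D : R,
    [/\ 0 < D, (D%:E <= dist_set E0 (~` F0))%E & enorm (e - f) < D].
  move: hD lt_ef; case: (dist_set _ _) => [D| |]//; rewrite ?lte_fin => D0 h.
    by exists D.
  exists (enorm (e - f) + 1); rewrite leey ltrDl ltr01; split => //.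
  by rewrite ltr_wpDl// enorm_ge0.
have sep0 x y : E0 x -> (~` F0) y -> D <= enorm (x - y).
  move=> Ex Fy; rewrite -lee_fin; apply: (le_trans DD); apply: ge_ereal_inf.
  by exists (enorm (x - y))%:E => //; exists (x, y).
have [_ hG] := hF.
have := superflows_stay_apart hN hr D0 hE hG.
have sep x y : slice E 0 x -> slice (@halfspace R N `\` F) 0 y -> D <= enorm (x - y).
  move=> Ex Gy; apply: (closure_sep sep0); first exact: hE.2.2.1.
  have : (~` F0°) y by exact: hG.2.2.1.
  by rewrite closure_setC.
move=> /(_ sep t t0 e f Ee) h.
have : slice (@halfspace R N `\` F) t f by [].
by move=> /h; rewrite leNgt eD.
Qed.
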